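(* Let $\alpha>1$. Assume that $\tilde W$ is a normal operator and that $$(\ln^{1+1/\alpha}x)'\big|_{x=\lambda_i(H)}=o(i^{-1/\alpha}),\quad i\to\infty.$$ Assume further that either (i) $\Theta(A)\subset\mathfrak{L}_0(\theta)$ with $\theta<\pi/2\alpha$, in which case put $\varpi:=\gamma(A)$; or (ii) there is $C_3>0$ with $|\mathrm{Im}(Lf,g)_{\mathfrak H}|\le C_3\|f\|_{\mathfrak H_+}\|g\|_{\mathfrak H}$ for all $f,g\in\mathfrak{M}$, in which case put $\varpi:=\Gamma(A)$. Let $0<\tau<1/\alpha$. Then a sequence of natural numbers $\{N_\nu\}_0^\infty$ can be chosen so that, for all $f\in\mathfrak H$ and $t>0$, $$\frac{1}{2\pi i}\int_{\varpi}e^{-\lambda^{\alpha}t}A(I-\lambda A)^{-1}f\,d\lambda=\sum_{\nu=0}^{\infty}\ \sum_{q=N_\nu+1}^{N_{\nu+1}}\ \sum_{\xi=1}^{m(q)}\ \sum_{i=0}^{k(q_\xi)}e_{q_\xi+i}\,c_{q_\xi+i}(t),$$ moreover $$\sum_{\nu=0}^{\infty}\Bigl\|\sum_{q=N_\nu+1}^{N_{\nu+1}}\ \sum_{\xi=1}^{m(q)}\ \sum_{i=0}^{k(q_\xi)}e_{q_\xi+i}\,c_{q_\xi+i}(t)\Bigr\|_{\mathfrak H}<\infty,$$ and the following relation holds for the corresponding characteristic numbers, with a constant $C>0$: $$|\lambda_{N_\nu+k}|-|\lambda_{N_\nu+k-1}|\le C\,|\lambda_{N_\nu+k}|^{1-1/\tau},\qquad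 k=2,3,\dots,N_{\nu+1}-N_\nu.$$
   Context: Setting. $\mathfrak H$ is a separable complex Hilbert space and $L$ is a non-selfadjoint linear densely defined operator acting in $\mathfrak H$ such that: (H1) There is a Hilbert space $\mathfrak H_+$, dense in $\mathfrak H$ as a set, with $\|f\|_{\mathfrak H}\le C_0\|f\|_{\mathfrak H_+}$ ($C_0>0$) and such that every set bounded in $\mathfrak H_+$ is (relatively) compact in $\mathfrak H$; there is a linear manifold $\mathfrak M$ dense in $\mathfrak H_+$ on which $L$ is defined. (H2) There are $C_1,C_2>0$ with $|(Lf,g)_{\mathfrak H}|\le C_1\|f\|_{\mathfrak H_+}\|g\|_{\mathfrak H_+}$ and $\mathrm{Re}(Lf,f)_{\mathfrak H}\ge C_2\|f\|^2_{\mathfrak H_+}$ for all $f,g\in\mathfrak M$. $W$ is the restriction of $L$ to $\mathfrak M$, $\tilde W$ its closure, understood to be m-sectorial with $0$ in its resolvent set; $A:=\tilde W^{-1}$ (a compact operator); $H:=Re\,\tilde W$ is the real part of $\tilde W$ in Kato's sense, i.e. the selfadjoint operator associated with the real part $(t+t^* )/2$ of the closed sectorial form $t$ generated by $\tilde W$. $H$ has compact resolvent and $\lambda_i(H)$ are its eigenvalues in nondecreasing order, counted with multiplicity. $\Theta(T)=\{(Tf,f)_{\mathfrak H}:f\in\mathrm D(T),\|f\|_{\mathfrak H}=1\}$ is the numerical range; $\mathfrak L_\iota(\theta)=\{\zeta:|\arg(\zeta-\iota)|\le\theta\}$. Contours. $\gamma(A)=\{|\lambda|=r,\ |\arg\lambda|\le\theta+\varepsilon\}\cup\{|\lambda|>r,\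 |\arg\lambda|=\theta+\varepsilon\}$. $\Gamma(A)=\mathrm{Fr}\{(\mathfrak L_0(\theta_0+\varepsilon)\cap\mathfrak L_\iota(\theta_\iota+\varepsilon))\setminus\mathfrak C_r\}$, where $\mathrm{Fr}$ is the boundary, $\mathfrak C_r=\{|\lambda|<r,\ |\arg\lambda|\le\theta_0+\varepsilon\}$, $\theta_0<\pi/2$ is such that $\Theta(\tilde W)\subset\mathfrak L_0(\theta_0)$, and, for $k>0$, $\iota=C_2/(2C_0^2)-(kC_3)^2/(2C_2)$, $\theta_\iota=\arctan(1/k)$ (then $\Theta(\tilde W)\subset\mathfrak L_\iota(\theta_\iota)$); $k$ is taken so large that $\iota<0$ and $\theta_\iota<\pi/2\alpha$. In both cases $r>0$ is such that $(I-\lambda A)^{-1}$ is regular in $|\lambda|\le r$, and $\varepsilon>0$ is sufficiently small (in particular $\theta+\varepsilon<\pi/2\alpha$, respectively $\theta_\iota+\varepsilon<\pi/2\alpha$ and $\theta_0+\varepsilon<\pi/2$). Contours are traversed from the end at infinity in the lower half-plane to the end at infinity in the upper half-plane; $\lambda^\alpha$ is the principal branch. Root vectors (with $B=A$): let $\mu_1,\mu_2,\dots$ be the distinct nonzero eigenvalues of $B$, $\lambda_q=1/\mu_q$ the characteristic numbers, numbered so that $|\lambda_q|$ is nondecreasing (if there are only finitely many, sums over nonexistent indices are empty and relations involving them void). $m(q)$ is the geometric multiplicity of $\mu_q$. In the root subspace of $\mu_q$ choose a Jordan basis consisting of chains $e_{q_\xi},\dots,e_{q_\xi+k}$, $k=k(q_\xi)$,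 $\xi=1,\dots,m(q)$, with $Be_{q_\xi}=\mu_qe_{q_\xi}$, $Be_{q_\xi+j}=\mu_qe_{q_\xi+j}+e_{q_\xi+j-1}$, $1\le j\le k$. Let $g_{q_\xi},\dots,g_{q_\xi+k}$ be the corresponding Jordan chains of $B^*$ in the root subspace of $B^*$ for $\overline{\mu_q}$ (eigenvector first: $B^*g_{q_\xi}=\overline{\mu_q}g_{q_\xi}$, $B^*g_{q_\xi+j}=\overline{\mu_q}g_{q_\xi+j}+g_{q_\xi+j-1}$) forming the biorthogonal system: $e_{q_\xi+i}$ is paired with $g_{q_\xi+k-i}$ and is orthogonal to all other $g$'s. For $f\in\mathfrak H$ put $$c_{q_\xi+i}=\frac{(f,g_{q_\xi+k-i})}{(e_{q_\xi+i},g_{q_\xi+k-i})},\quad c_{q_\xi+i}(t)=e^{-\lambda_q^{\alpha}t}\sum_{j=0}^{k-i}P_j^{\alpha}(\lambda_q,t)\,c_{q_\xi+i+j},\quad 0\le i\le k(q_\xi),$$ $$P_j^{\alpha}(\zeta^{-1},t)=\frac{e^{t\zeta^{-\alpha}}}{j!}\frac{d^j}{d\zeta^j}e^{-t\zeta^{-\alpha}}.$$ *)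

(* Defs.v *)
From HB Require Import structures.
From mathcomp Require Export all_boot all_order all_algebra.
From mathcomp Require Export sesquilinear.
From mathcomp Require Export all_classical all_reals all_analysis.
From mathcomp Require Export complex.

Set Implicit Arguments.
Unset Strict Implicit.
Unset Printing Implicit Defensive.

Import Order.TTheory GRing.Theory Num.Theory.
Import numFieldNormedType.Exports.

Local Open Scope classical_set_scope.
Local Open Scope ring_scope.
Local Open Scope complex_scope.

(* Conventions.
   - The topology of the complex plane is the one of the regular module
     [R[i]^o].
   - The norm [`|x|] of an [R[i]]-normed module is an element of [R[i]];
     [rnorm x], or [absC z] for a complex number, is the same number in [R].
   - Sequences such as [lambda_1, lambda_2, ...], which may be finite, are
     functions on [nat] together with the set of those indices (starting at 1)
     for which a term exists.
   - A possibly unbounded operator is represented by its graph. *)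

Definition rnorm (R : realType) (V : normedModType R[i]) (x : V) : R :=
  complex.Re `|x|.

Definition index_set (I : set nat) : Prop :=
  forall i, I i -> (0 < i)%N /\ forall j, (0 < j <= i)%N -> I j.

Section ComplexFunctions.
Variable R : realType.
Implicit Types z : R[i].

Definition absC z : R := complex.Re `|z|.

Definition expC z : R[i] :=
  (expR (complex.Re z) * cos (complex.Im z)) +i*
  (expR (complex.Re z) * sin (complex.Im z)).

(* Principal argument, in ]-pi, pi]; by convention the argument of 0 is 0, so
   that a sector contains its vertex. *)
Definition argC z : R :=
  if z == 0 then 0
  else if 0 <= complex.Im z then acos (complex.Re z / absC z)
  else - acos (complex.Re z / absC z).

(* Principal branch of [z ^ a]; only meaningful for [z != 0]. *)
Definition powC z (a : R) : R[i] :=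
  expC (a%:C * (ln (absC z) +i* argC z)).

Definition sector (iota theta : R) : set R[i] :=
  [set z | `|argC (z - iota%:C)| <= theta].

(* [P_j^alpha (z, t)] with [zeta = z^-1]; the iterated derivative is the
   complex one. *)
Definition Palpha (alpha : R) (j : nat) z (t : R) : R[i] :=
  expC (t%:C * powC z^-1 (- alpha)) / (j`!)%:R *
  derive1n j (fun w : R[i] => expC (- t%:C * powC w (- alpha)) : R[i]^o) z^-1.

End ComplexFunctions.

Section Contours.
Variables (R : realType) (V : normedModType R[i]).
Implicit Types (p : R -> R[i]^o) (F : R[i] -> V) (varpi : set R[i]^o).

(* The parameter [phi] stands for [theta + eps]. *)
Definition gamma_contour (phi r : R) : set R[i]^o :=
  [set z | absC z = r /\ `|argC z| <= phi] `|`
  [set z | r < absC z /\ `|argC z| = phi].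

Definition Gamma_contour (phi0 iota phi r : R) : set R[i]^o :=
  let E : set R[i]^o :=
    (sector 0 phi0 `&` sector iota phi) `\`
    [set z | absC z < r /\ `|argC z| <= phi0] in
  closure E `\` E°.

(* [p] runs once through [varpi], from the end at infinity in the lower
   half-plane to the end at infinity in the upper half-plane. *)
Definition contour_param p varpi : Prop :=
  [/\ continuous p, injective p, range p = varpi,
      complex.Im (p s) @[s --> -oo] --> -oo &
      complex.Im (p s) @[s --> +oo] --> +oo].

(* Complex line integral of [F] along [p] over [[a, b]], as the limit of the
   sums [F(p(xi_j)) (p(x_{j+1}) - p(x_j))] over tagged subdivisions. *)
Definition is_line_integral p F (a b : R) (v : V) : Prop :=
  forall eta : R, 0 < eta -> exists2 delta : R, 0 < delta &
    forall (n : nat) (x xi : nat -> R), x 0%N = a -> x n = b ->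
      (forall j, (j < n)%N ->
         x j <= xi j <= x j.+1 /\ x j.+1 - x j < delta) ->
      rnorm (\sum_(j < n) (p (x j.+1) - p (x j) : R[i]) *: F (p (xi j)) - v)
        < eta.

Definition is_contour_integral varpi F (v : V) : Prop :=
  exists2 p, contour_param p varpi &
    forall eta : R, 0 < eta -> exists S : R, forall a b : R, a < - S -> S < b ->
      exists2 w, is_line_integral p F a b w & rnorm (w - v) < eta.

End Contours.

Section LinearAlgebra.
Variables (R : realType) (V : lmodType R[i]).
Implicit Types (E : set V) (s : seq V).

Definition subspace E : Prop :=
  E 0 /\ forall (a : R[i]) x y, E x -> E y -> E (a *: x + y).

Definition lin_basis s E : Prop :=
  (forall c : nat -> R[i], \sum_(j < size s) c j *: s`_j = 0 ->
     forall j, (j < size s)%N -> c j = 0) /\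
  E = [set \sum_(j < size s) c j *: s`_j | c in [set: nat -> R[i]]].

Definition has_dim E (n : nat) : Prop :=
  exists2 s, size s = n & lin_basis s E.

End LinearAlgebra.

Section Operators.
Variables (R : realType) (H : completeNormedModType R[i]).
Variable ip : {dot H for @conjc R}.
Implicit Types (S T : set (H * H)) (A B : H -> H) (z : R[i]).

Definition operator T : Prop :=
  subspace T /\ forall x y y', T (x, y) -> T (x, y') -> y = y'.

Definition op_dom T : set H := fst @` T.

Definition op_graph A : set (H * H) := [set p | p.2 = A p.1].

Definition op_restr T (D : set H) : set (H * H) := [set p | T p /\ D p.1].

Definition op_shift T z : set (H * H) := [set p | T (p.1, p.2 - z *: p.1)].

Definition op_comp S T : set (H * H) :=
  [set p | exists2 y, T (p.1, y) & S (y, p.2)].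

(* When [T] is not densely defined this is a linear relation only. *)
Definition adjoint T : set (H * H) :=
  [set q | forall p, T p -> ip p.2 q.1 = ip p.1 q.2].

Definition selfadjoint T : Prop := T = adjoint T.

Definition normal_operator T : Prop :=
  [/\ closed T, dense (op_dom T) & op_comp T (adjoint T) = op_comp (adjoint T) T].

Definition numerical_range T : set R[i] :=
  [set ip p.2 p.1 | p in [set p | T p /\ `|p.1| = 1]].

Definition m_accretive T : Prop :=
  forall z, 0 < complex.Re z -> exists2 B : {linear H -> H},
    (forall p, op_shift T z p <-> p.1 = B p.2) &
    forall y, rnorm (B y) <= (complex.Re z)^-1 * rnorm y.

(* Kato: sectorial and quasi-m-accretive. *)
Definition m_sectorial T : Prop :=
  (exists g theta : R, [/\ 0 <= theta, theta < pi / 2 &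
     numerical_range T `<=` sector g theta]) /\
  (exists a : R, m_accretive (op_shift T a%:C)).

(* The form generated by [T] is the closure of [(T u, v)], [u, v] in [op_dom T]:
   [u] is in its domain iff some sequence [u_n] of [op_dom T] converges to [u]
   with [(T (u_n - u_m), u_n - u_m) --> 0]. *)
Definition form_cvg T (x : nat -> H * H) (u : H) : Prop :=
  [/\ forall n, T (x n), (x n).1 @[n --> \oo] --> u &
      forall eta : R, 0 < eta -> exists n0 : nat, forall n m,
        (n0 <= n)%N -> (n0 <= m)%N ->
        `|ip ((x n).2 - (x m).2) ((x n).1 - (x m).1)| < eta%:C].

Definition form_dom T : set H := [set u | exists x, form_cvg T x u].

Definition form_val T (u v : H) : R[i] :=
  xget 0 [set c : R[i]^o | forall x y, form_cvg T x u -> form_cvg T y v ->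
            (ip (x n).2 (y n).1 : R[i]^o) @[n --> \oo] --> c].

Definition form_re (t : H -> H -> R[i]) (u v : H) : R[i] :=
  (t u v + conjc (t v u)) / 2.

Definition form_operator (D : set H) (h : H -> H -> R[i]) : set (H * H) :=
  [set p | D p.1 /\ forall v, D v -> h p.1 v = ip p.2 v].

Definition real_part T : set (H * H) :=
  form_operator (form_dom T) (form_re (form_val T)).

Definition eigenspace T z : set H := [set x | T (x, z *: x)].

Definition eigenvalue_sequence T (I : set nat) (ev : nat -> R) : Prop :=
  [/\ index_set I,
      forall i j, I i -> I j -> (i <= j)%N -> ev i <= ev j &
      forall z, exists2 n, has_dim (eigenspace T z) n &
        ([set i | I i /\ (ev i)%:C = z] #= `I_n)%card].

Definition one_minus A z (u : H) : H := u - z *: A u.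

Definition regular_point A z : Prop :=
  exists B : {linear H -> H},
    [/\ continuous B, cancel B (one_minus A z) & cancel (one_minus A z) B].

(* [(I - z A)^-1 f], meaningful when [I - z A] is bijective. *)
Definition fredholm_resolvent A z (f : H) : H :=
  xget 0 [set u | one_minus A z u = f].

Definition root_subspace A z : set H :=
  [set x | exists n, iter n (fun y => A y - z *: y) x = 0].

Definition characteristic_sequence A (Q : set nat) (mu : nat -> R[i]) : Prop :=
  [/\ index_set Q,
      forall p q, Q p -> Q q -> mu p = mu q -> p = q,
      [set mu q | q in Q] =
        [set z | z != 0 /\ exists2 x, x != 0 & A x = z *: x] &
      forall p q, Q p -> Q q -> (p <= q)%N ->
        absC (mu p)^-1 <= absC (mu q)^-1].

(* The chains of index [xi = 1, ..., m q] are numbered [0, ..., (m q).-1], and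
   [e q xi i] stands for [e_{q_xi + i}], with [0 <= i <= k q xi]. *)
Definition jordan_basis A (Q : set nat) (mu : nat -> R[i]) (m : nat -> nat)
    (k : nat -> nat -> nat) (e : nat -> nat -> nat -> H) : Prop :=
  forall q, Q q ->
    [/\ has_dim [set x | A x = mu q *: x] (m q),
        lin_basis [seq e q xi i | xi <- iota 0 (m q), i <- iota 0 (k q xi).+1]
          (root_subspace A (mu q)),
        forall xi, (xi < m q)%N -> A (e q xi 0%N) = mu q *: e q xi 0%N &
        forall xi i, (xi < m q)%N -> (i < k q xi)%N ->
          A (e q xi i.+1) = mu q *: e q xi i.+1 + e q xi i].

Definition adjoint_chains A (Q : set nat) (mu : nat -> R[i]) (m : nat -> nat)
    (k : nat -> nat -> nat) (g : nat -> nat -> nat -> H) : Prop :=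
  forall q xi, Q q -> (xi < m q)%N ->
    adjoint (op_graph A) (g q xi 0%N, conjc (mu q) *: g q xi 0%N) /\
    forall i, (i < k q xi)%N ->
      adjoint (op_graph A)
        (g q xi i.+1, conjc (mu q) *: g q xi i.+1 + g q xi i).

Definition biorthogonal (Q : set nat) (m : nat -> nat)
    (k : nat -> nat -> nat) (e g : nat -> nat -> nat -> H) : Prop :=
  forall q xi i, Q q -> (xi < m q)%N -> (i <= k q xi)%N ->
    ip (e q xi i) (g q xi (k q xi - i)%N) != 0 /\
    forall q' xi' i', Q q' -> (xi' < m q')%N -> (i' <= k q' xi')%N ->
      ~ [/\ q' = q, xi' = xi & i' = (k q xi - i)%N] ->
      ip (e q xi i) (g q' xi' i') = 0.

Definition root_coef (k : nat -> nat -> nat) (e g : nat -> nat -> nat -> H)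
    (f : H) (q xi i : nat) : R[i] :=
  ip f (g q xi (k q xi - i)%N) / ip (e q xi i) (g q xi (k q xi - i)%N).

Definition root_coef_t (alpha : R) (mu : nat -> R[i]) (k : nat -> nat -> nat)
    (e g : nat -> nat -> nat -> H) (f : H) (t : R) (q xi i : nat) : R[i] :=
  expC (- powC (mu q)^-1 alpha * t%:C) *
  \sum_(j < (k q xi - i).+1)
    Palpha alpha j (mu q)^-1 t * root_coef k e g f q xi (i + j).

Definition root_group (alpha : R) (Q : set nat) (mu : nat -> R[i])
    (m : nat -> nat) (k : nat -> nat -> nat) (e g : nat -> nat -> nat -> H)
    (N : nat -> nat) (f : H) (t : R) (nu : nat) : H :=
  \sum_((N nu).+1 <= q < (N nu.+1).+1 | q \in Q)
    \sum_(xi < m q) \sum_(i < (k q xi).+1)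
      root_coef_t alpha mu k e g f t q xi i *: e q xi i.

End Operators.

Section Hypotheses.
Variables (R : realType) (H Hp : completeNormedModType R[i]).
Variable ip : {dot H for @conjc R}.
Implicit Types (J : {linear Hp -> H}) (L : set (H * H)) (M : set Hp).

(* The norm of the space is the one of its inner product; as the space is
   complete, it is a Hilbert space. *)
Definition hilbert (K : completeNormedModType R[i])
    (d : {dot K for @conjc R}) : Prop :=
  forall x, d x x = `|x| ^+ 2.

(* The inclusion of [Hp] into [H] is the injective linear map [J]. *)
Definition condition_H1 J L M (C0 : R) : Prop :=
  [/\ injective J /\ dense (range J),
      0 < C0 /\ (forall f, rnorm (J f) <= C0 * rnorm f),
      forall B : set Hp, bounded_set B -> precompact (J @` B) &
      [/\ subspace M, dense M & J @` M `<=` op_dom L]].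

Definition condition_H2 J L M (C1 C2 : R) : Prop :=
  [/\ 0 < C1, 0 < C2 &
      forall f h, M f -> M h -> forall Lf, L (J f, Lf) ->
        absC (ip Lf (J h)) <= C1 * rnorm f * rnorm h /\
        C2 * rnorm f ^+ 2 <= complex.Re (ip Lf (J f))].

Definition Wtilde J L M : set (H * H) := closure (op_restr L (J @` M)).

Definition contour_case_i (A : H -> H) (alpha : R)
    (varpi : set R[i]^o) : Prop :=
  exists theta eps r : R,
    [/\ 0 <= theta /\ theta < pi / (2 * alpha),
        numerical_range ip (op_graph A) `<=` sector 0 theta,
        0 < eps /\ theta + eps < pi / (2 * alpha),
        0 < r /\ (forall z, absC z <= r -> regular_point A z) &
        varpi = gamma_contour (theta + eps) r].

Definition contour_case_ii J L M (C0 C2 : R) (A : H -> H) (alpha : R)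
    (varpi : set R[i]^o) : Prop :=
  exists C3 kappa theta0 eps r : R,
    let iota := C2 / (2 * C0 ^+ 2) - (kappa * C3) ^+ 2 / (2 * C2) in
    let thetai := atan (1 / kappa) in
    [/\ 0 < C3 /\ (forall f h, M f -> M h -> forall Lf, L (J f, Lf) ->
          `|complex.Im (ip Lf (J h))| <= C3 * rnorm f * rnorm (J h)),
        [/\ 0 <= theta0, theta0 < pi / 2 &
            numerical_range ip (Wtilde J L M) `<=` sector 0 theta0],
        [/\ 0 < kappa, iota < 0 & thetai < pi / (2 * alpha)],
        [/\ 0 < eps, thetai + eps < pi / (2 * alpha) &
            theta0 + eps < pi / 2] &
        (0 < r /\ (forall z, absC z <= r -> regular_point A z)) /\
        varpi = Gamma_contour (theta0 + eps) iota (thetai + eps) r].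

End Hypotheses.

(* Main.v *)
(* As [Wtilde] is normal, [A] is a compact normal operator with trivial kernel:
   its Jordan chains have length one, its eigenprojections [P q] are orthogonal
   and total, and a group of root vectors contributes the sum of the
   [exp (- lambda_q ^ alpha * t) *: P q f].  Under [P q] the integrand becomes
   [exp (- lambda ^ alpha * t) / (lambda_q - lambda)], so the integral is
   computed by a scalar Cauchy formula in each component; since either contour
   is the graph of a Lipschitz function of the imaginary part, at positive
   distance from all the [lambda_q], the integrals over [[a, b]] are bounded
   uniformly in [q], and Parseval's identity reduces the convergence in [H] to
   finitely many components.  The characteristic numbers are grouped according
   to the integer part of [|lambda_q| ^ (1 / tau)]; the [nu]-th group then has
   [|lambda_q| >= nu ^ tau], and the decay of the exponential in a sector of
   angle less than [pi / (2 alpha)] beats any power of [|lambda_q|]. *)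

(* The scalar Cauchy formula is obtained without a theory of holomorphic functions. For each [lam],
   a primitive of [phi z / (lam - z)] is built on the right half-plane slit to the right of [lam]: a
   primitive of the divided difference of [phi], which exists because the half-plane is star-shaped
   about [lam], plus a multiple of a logarithm. An integral along the contour is then an increment
   of this primitive, and the residue is the jump of the logarithm across the slit. The contours
   have corners and integrals are limits of tagged Riemann sums, so a primitive must control
   increments between two moving points; hence differentiability is taken in the strict sense
   throughout. Uniformity in [q] is the delicate point. No bound on the primitives themselves is
   used, only one on their increments, by the increments of one fixed bounded increasing function of
   the parameter. That [I - z A] is invertible on the contour is likewise read off from the distance
   of [z] to the characteristic numbers. *)
From HB Require Import structures.
Require Import Defs.
From mathcomp Require Import ring lra.

Set Implicit Arguments.
Unset Strict Implicit.
Unset Printing Implicit Defensive.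

Import Order.TTheory GRing.Theory Num.Theory.
Import numFieldNormedType.Exports.

Local Open Scope classical_set_scope.
Local Open Scope ring_scope.
Local Open Scope complex_scope.

Local Notation Re := complex.Re.
Local Notation Im := complex.Im.

(** * Complex numbers *)

Section ComplexModulus.
Variable R : realType.
Implicit Types (z w : R[i]) (x y : R).

Lemma absCE z : absC z = Num.sqrt (Re z ^+ 2 + Im z ^+ 2).
Proof. by rewrite /absC normc_def. Qed.

Lemma normCE z : `|z| = (absC z)%:C.
Proof. by rewrite absCE normc_def. Qed.

Lemma absC_sqr z : absC z ^+ 2 = Re z ^+ 2 + Im z ^+ 2.
Proof. by rewrite absCE sqr_sqrtr// addr_ge0 ?sqr_ge0. Qed.

Lemma absC_ge0 z : 0 <= absC z.
Proof. by rewrite absCE sqrtr_ge0. Qed.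

Lemma absC0 : absC (0 : R[i]) = 0.
Proof. by rewrite /absC normr0. Qed.

Lemma absC1 : absC (1 : R[i]) = 1.
Proof. by rewrite /absC normr1. Qed.

Lemma absCN z : absC (- z) = absC z.
Proof. by rewrite /absC normrN. Qed.

Lemma absC_sub z w : absC (z - w) = absC (w - z).
Proof. by rewrite /absC distrC. Qed.

Lemma absCM z w : absC (z * w) = absC z * absC w.
Proof. by apply: (@complexI R); rewrite rmorphM/= -!normCE normrM. Qed.

Lemma absCV z : absC z^-1 = (absC z)^-1.
Proof. by apply: (@complexI R); rewrite fmorphV/= -!normCE normfV. Qed.

Lemma absCD z w : absC (z + w) <= absC z + absC w.
Proof. by rewrite -lecR rmorphD/= -!normCE ler_normD. Qed.

Lemma absCB z w : absC (z - w) <= absC z + absC w.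
Proof. by rewrite -(absCN w) absCD. Qed.

Lemma absC_lerB z w : absC z - absC w <= absC (z - w).
Proof. by rewrite lerBlDr (le_trans _ (absCD _ _))// subrK. Qed.

Lemma absC_eq0 z : (absC z == 0) = (z == 0).
Proof. by rewrite -(inj_eq (@complexI R)) -normCE normr_eq0. Qed.

Lemma absC_gt0 z : (0 < absC z) = (z != 0).
Proof. by rewrite lt0r absC_ge0 andbT absC_eq0. Qed.

Lemma absC_real x : absC x%:C = `|x|.
Proof. by rewrite absCE/= expr0n addr0 sqrtr_sqr. Qed.

Lemma absC_nat n : absC (n%:R : R[i]) = n%:R.
Proof. by rewrite -(rmorph_nat (real_complex R)) absC_real normr_nat. Qed.

Lemma absC_sum (T : Type) (s : seq T) (P : pred T) (F : T -> R[i]) :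
  absC (\sum_(i <- s | P i) F i) <= \sum_(i <- s | P i) absC (F i).
Proof.
elim/big_ind2: _ => [|a b c d h1 h2|//]; first by rewrite absC0.
by rewrite (le_trans (absCD _ _))// lerD.
Qed.

Lemma Re_le_absC z : `|Re z| <= absC z.
Proof. by rewrite absCE -sqrtr_sqr ler_sqrt ?addr_ge0 ?sqr_ge0// lerDl sqr_ge0. Qed.

Lemma Im_le_absC z : `|Im z| <= absC z.
Proof. by rewrite absCE -sqrtr_sqr ler_sqrt ?addr_ge0 ?sqr_ge0// lerDr sqr_ge0. Qed.

Lemma absC_le z : absC z <= `|Re z| + `|Im z|.
Proof.
rewrite -(@ler_pXn2r _ 2)// ?nnegrE ?absC_ge0 ?addr_ge0//.
rewrite absC_sqr sqrrD !real_normK ?num_real//.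
by rewrite lerD2r lerDl mulrn_wge0// mulr_ge0.
Qed.

Lemma ReD z w : @complex.Re R (z + w) = Re z + Re w.
Proof. by case: z w => [? ?] []. Qed.

Lemma ImD z w : @complex.Im R (z + w) = Im z + Im w.
Proof. by case: z w => [? ?] []. Qed.

Lemma ReN z : @complex.Re R (- z) = - Re z.
Proof. by case: z. Qed.

Lemma ImN z : @complex.Im R (- z) = - Im z.
Proof. by case: z. Qed.

Lemma ReM z w : @complex.Re R (z * w) =
  Re z * Re w - Im z * Im w.
Proof. by case: z w => [? ?] []. Qed.

Lemma ImM z w : @complex.Im R (z * w) =
  Re z * Im w + Im z * Re w.
Proof. by case: z w => [? ?] []. Qed.

Lemma complex_eq z w :
  Re z = Re w -> Im z = Im w -> z = w.
Proof. by case: z w => [? ?] [? ?] /= -> ->. Qed.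

End ComplexModulus.

Section ComplexExponential.
Variable R : realType.
Implicit Types (z w : R[i]) (x y : R).

Lemma expCD z w : expC (z + w) = expC z * expC w.
Proof.
by apply: complex_eq; rewrite ?ReM ?ImM /= ReD ImD expRD ?cosD ?sinD; ring.
Qed.

Lemma expC0 : expC (0 : R[i]) = 1.
Proof. by rewrite /expC /= expR0 cos0 sin0 !mul1r. Qed.

Lemma absC_expC z : absC (expC z) = expR (Re z).
Proof.
by rewrite absCE /= !exprMn -mulrDr cos2Dsin2 mulr1 sqrtr_sqr ger0_norm ?expR_ge0.
Qed.

Lemma expC_neq0 z : expC z != 0.
Proof. by rewrite -absC_gt0 absC_expC expR_gt0. Qed.

Lemma expCN z : expC (- z) = (expC z)^-1.
Proof.
apply: (mulfI (expC_neq0 z)).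
by rewrite -expCD subrr expC0 divff ?expC_neq0.
Qed.

Lemma is_derive_eps (f : R -> R) x df : is_derive x 1 f df ->
  forall eta : R, 0 < eta -> exists2 d : R, 0 < d &
    forall h, `|h| < d -> `|f (x + h) - f x - df * h| <= eta * `|h|.
Proof.
move=> [dx dE] eta eta0.
have := derivable_nbhs dx; rewrite dE => /eqaddoP /(_ eta eta0).
case=> /= d d0 H; exists d => // h hd.
have := H h; rewrite /= sub0r normrN => /(_ hd).
rewrite /cst !fctE /=.
have -> : h *: (1 : R) = h by rewrite /GRing.scale /= mulr1.
suff -> : f (x + h) - f x - df * h = f (h + x) - (f x + h *: (df : R)) by [].
by rewrite [x + h]addrC opprD addrA [df * h]mulrC.
Qed.

(** Only the real derivatives of [expR], [cos] and [sin] at 0 enter; the functional equation [expCD]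
    later carries the estimate to every point. *)
Lemma expC_first_order (eta : R) : 0 < eta -> exists2 d : R, 0 < d &
  forall h : R[i], absC h < d -> absC (expC h - 1 - h) <= eta * absC h.
Proof.
(* The errors of the real and imaginary parts add up to at most [9 * e * absC h], which [eta / 12]
   covers. *)
move=> eta0; have [e [e0 e1 eE]] : exists e : R, [/\ 0 < e, e <= 1 & e <= eta / 12].
  exists (Num.min 1 (eta / 12)); rewrite lt_min ltr01 divr_gt0//=.
  by rewrite !ge_min !lexx orbT.
have [d1 d10 H1] := is_derive_eps (@is_derive_expR R 0) e0.
have [d2 d20 H2] := is_derive_eps (@is_derive_cos R 0) e0.
have [d3 d30 H3] := is_derive_eps (@is_derive_sin R 0) e0.
exists (Num.min e (Num.min d1 (Num.min d2 d3))); first by rewrite !lt_min e0 d10 d20.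
move=> [x y]; rewrite !lt_min => /and4P[h1 h2 h3 h4].
have hx := Re_le_absC (x +i* y); have hy := Im_le_absC (x +i* y).
move: hx hy; rewrite /=; set a := absC _ in h1 h2 h3 h4 *; move=> hx hy.
have := H1 x (le_lt_trans hx h2); rewrite !add0r expR0 mul1r => {}H1.
have := H2 y (le_lt_trans hy h3).
rewrite !add0r cos0 sin0 oppr0 mul0r subr0 => {}H2.
have := H3 y (le_lt_trans hy h4); rewrite !add0r cos0 sin0 subr0 mul1r => {}H3.
apply: (le_trans (absC_le _)). rewrite ReD ImD /=.
set X := expR x - 1 - x in H1; set c := cos y - 1 in H2; set s := sin y - y in H3.
have X1 : `|X| <= e * a by rewrite (le_trans H1)// ler_wpM2l// ltW.
have c1 : `|c| <= e * a by rewrite (le_trans H2)// ler_wpM2l// ltW.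
have s1 : `|s| <= e * a by rewrite (le_trans H3)// ler_wpM2l// ltW.
have a0 : 0 <= a by exact: absC_ge0.
have E1 : `|1 + x + X| <= 3.
  rewrite (le_trans (ler_normD _ _))// (le_trans (lerD (ler_normD _ _) (lexx _)))//.
  by rewrite normr1; nra.
have -> : expR x * cos y - 1 - x = X + c * (1 + x + X) by rewrite /X /c; ring.
have -> : expR x * sin y - 0 - y = (x + X) * y + s * (1 + x + X).
  by rewrite /X /s; ring.
have W1 : `|X + c * (1 + x + X)| <= 4 * (e * a).
  rewrite (le_trans (ler_normD _ _))// normrM.
  have : `|c| * `|1 + x + X| <= e * a * 3 by rewrite ler_pM.
  lra.
have W2 : `|(x + X) * y + s * (1 + x + X)| <= (a + e * a) * a + 3 * (e * a).
  rewrite (le_trans (ler_normD _ _))// !normrM lerD//; last first.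
    by rewrite [leRHS]mulrC ler_pM.
  by rewrite ler_pM// (le_trans (ler_normD _ _))// lerD.
have W3 : (a + e * a) * a <= 2 * (e * a).
  have -> : (a + e * a) * a = (1 + e) * a * a by ring.
  have -> : 2 * (e * a) = 2 * e * a by ring.
  have: (1 + e) * a <= 2 * e by nra.
  by move=> ?; rewrite ler_wpM2r.
have : e * a <= eta / 12 * a by rewrite ler_wpM2r.
have : 0 <= eta * a by rewrite mulr_ge0// ltW.
lra.
Qed.
End ComplexExponential.

(** * Strict complex differentiability and line integrals *)

Section StrictDerivative.
Variable R : realType.
Implicit Types (z w u v f g : R[i]) (F G : R[i] -> R[i]).

(** Both points vary independently near [z]. This makes the derivative continuous wherever it
    exists, and lets the tag of a Riemann sum sit anywhere in its cell. *)
Definition strict_deriv F z f : Prop :=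
  forall eta : R, 0 < eta -> exists2 d : R, 0 < d &
    forall u v, absC (u - z) < d -> absC (v - z) < d ->
      absC (F u - F v - f * (u - v)) <= eta * absC (u - v).

Lemma strict_deriv_affine a b z : strict_deriv (fun x => a * x + b) z a.
Proof.
move=> eta eta0; exists 1 => // u v _ _.
have -> : a * u + b - (a * v + b) - a * (u - v) = 0 by ring.
by rewrite absC0 mulr_ge0 ?absC_ge0 ?ltW.
Qed.

Lemma strict_derivD F G z f g : strict_deriv F z f -> strict_deriv G z g ->
  strict_deriv (fun x => F x + G x) z (f + g).
Proof.
move=> hF hG eta eta0.
have e0 : 0 < eta / 2 by rewrite divr_gt0.
have [d1 d10 H1] := hF _ e0; have [d2 d20 H2] := hG _ e0.
exists (Num.min d1 d2); first by rewrite lt_min d10.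
move=> u v; rewrite !lt_min => /andP[u1 u2] /andP[v1 v2].
have -> : F u + G u - (F v + G v) - (f + g) * (u - v) =
  (F u - F v - f * (u - v)) + (G u - G v - g * (u - v)) by ring.
rewrite (le_trans (absCD _ _))// (le_trans (lerD (H1 u v u1 v1) (H2 u v u2 v2)))//.
by rewrite -mulrDl -splitr.
Qed.

Lemma strict_derivZ c F z f : strict_deriv F z f ->
  strict_deriv (fun x => c * F x) z (c * f).
Proof.
move=> hF eta eta0.
have c0 : 0 < absC c + 1 by rewrite ltr_wpDl ?absC_ge0.
have [d d0 H] := hF _ (divr_gt0 eta0 c0); exists d => // u v hu hv.
have -> : c * F u - c * F v - c * f * (u - v) = c * (F u - F v - f * (u - v)).
  by ring.
rewrite absCM; have := H u v hu hv; set A := absC (F u - _ - _) => hA.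
rewrite (@le_trans _ _ ((absC c + 1) * A))//.
  by rewrite ler_wpM2r ?absC_ge0// lerDl.
by rewrite -ler_pdivlMl// mulrA [_^-1 * _]mulrC.
Qed.

Lemma strict_deriv_sum n (F : nat -> R[i] -> R[i]) z (f : nat -> R[i]) :
  (forall j, (j < n)%N -> strict_deriv (F j) z (f j)) ->
  strict_deriv (fun x => \sum_(j < n) F j x) z (\sum_(j < n) f j).
Proof.
elim: n => [_|n IH H].
  move=> eta eta0; exists 1 => // u v _ _.
  by rewrite !big_ord0 mul0r !subr0 absC0 mulr_ge0 ?absC_ge0 ?ltW.
have hF := strict_derivD (IH (fun j hj => H j (ltnW hj))) (H n (ltnSn n)).
move=> eta eta0; have [d d0 {}hF] := hF _ eta0; exists d => // u v hu hv.
by rewrite !big_ord_recr; exact: hF.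
Qed.

Lemma strict_deriv_lip F z f : strict_deriv F z f ->
  exists2 d : R, 0 < d & forall u v, absC (u - z) < d -> absC (v - z) < d ->
    absC (F u - F v) <= (absC f + 1) * absC (u - v).
Proof.
move=> /(_ 1 ltr01)[d d0 H]; exists d => // u v hu hv.
have -> : F u - F v = (F u - F v - f * (u - v)) + f * (u - v) by ring.
rewrite (le_trans (absCD _ _))// mulrDl addrC lerD//; first by rewrite absCM.
exact: H.
Qed.

Lemma strict_deriv_cont F z f : strict_deriv F z f ->
  forall eta : R, 0 < eta -> exists2 d : R, 0 < d &
    forall u, absC (u - z) < d -> absC (F u - F z) < eta.
Proof.
move=> /strict_deriv_lip[d d0 H] eta eta0.
have c0 : 0 < absC f + 1 by rewrite ltr_wpDl ?absC_ge0.
exists (Num.min d (eta / (absC f + 1))); first by rewrite lt_min d0 divr_gt0.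
move=> u; rewrite lt_min => /andP[h1 h2].
have zz : absC (z - z) < d by rewrite subrr absC0.
by rewrite (le_lt_trans (H u z h1 zz))// mulrC -ltr_pdivlMr.
Qed.

Lemma strict_deriv_comp F G z f g : strict_deriv G z g ->
  strict_deriv F (G z) f -> strict_deriv (fun x => F (G x)) z (f * g).
Proof.
move=> hG hF eta eta0.
have [d1 d10 H1] := strict_deriv_lip hG.
have c0 : 0 < absC g + 1 by rewrite ltr_wpDl ?absC_ge0.
have f0 : 0 < absC f + 1 by rewrite ltr_wpDl ?absC_ge0.
have [d2 d20 H2] : exists2 d : R, 0 < d & forall u v, absC (u - z) < d ->
    absC (v - z) < d -> absC (G u - G v - g * (u - v)) <=
    eta / 2 / (absC f + 1) * absC (u - v) by apply: hG; rewrite !divr_gt0.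
have [d3 d30 H3] : exists2 d : R, 0 < d & forall u v, absC (u - G z) < d ->
    absC (v - G z) < d -> absC (F u - F v - f * (u - v)) <=
    eta / 2 / (absC g + 1) * absC (u - v) by apply: hF; rewrite !divr_gt0.
have [d4 d40 H4] := strict_deriv_cont hG d30.
exists (Num.min d1 (Num.min d2 d4)); first by rewrite !lt_min d10 d20.
move=> u v; rewrite !lt_min => /and3P[u1 u2 u4] /and3P[v1 v2 v4].
have -> : F (G u) - F (G v) - f * g * (u - v) =
  (F (G u) - F (G v) - f * (G u - G v)) + f * (G u - G v - g * (u - v)) by ring.
rewrite (le_trans (absCD _ _))// [eta]splitr mulrDl lerD//.
  rewrite (le_trans (H3 _ _ (H4 _ u4) (H4 _ v4)))//.
  rewrite -mulrA ler_pM2l ?divr_gt0// ler_pdivrMl//.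
  exact: H1.
rewrite absCM (@le_trans _ _ ((absC f + 1) * absC (G u - G v - g * (u - v))))//.
  by rewrite ler_wpM2r ?absC_ge0// lerDl.
rewrite -ler_pdivlMl// mulrA [_^-1 * _]mulrC; exact: H2.
Qed.

(** After factoring out [expC z], the error is a combination of [expC (u - v) - 1 - (u - v)] and
    [expC (v - z) - 1], both governed by the behaviour at 0. *)
Lemma strict_deriv_expC z : strict_deriv (@expC R) z (expC z).
Proof.
move=> eta eta0; set M := absC (expC z).
have M0 : 0 < M by rewrite absC_gt0 expC_neq0.
have [d1 d10 H1] : exists2 d : R, 0 < d & forall h : R[i], absC h < d ->
   absC (expC h - 1 - h) <= Num.min 1 (eta / 6 / M) * absC h.
  by apply: expC_first_order; rewrite lt_min ltr01 !divr_gt0.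
set d := Num.min (d1 / 2) (Num.min 1 (eta / 6 / M)).
exists (Num.min (d1 / 2) (Num.min (1/2) (eta / 6 / M))).
  by rewrite !lt_min !divr_gt0.
move=> u v; rewrite !lt_min => /and3P[u1 u2 u3] /and3P[v1 v2 v3].
have uv : absC (u - v) < d1.
  have -> : u - v = (u - z) - (v - z) by ring.
  rewrite (le_lt_trans (absCB _ _))//; lra.
have {}H1 h : absC h < d1 -> absC (expC h - 1 - h) <= absC h /\
     absC (expC h - 1 - h) <= eta / 6 / M * absC h.
  move=> /H1 hh; split; apply: (le_trans hh).
    by rewrite -[leRHS]mul1r ler_wpM2r ?absC_ge0// ge_min lexx.
  by rewrite ler_wpM2r ?absC_ge0// ge_min lexx orbT.
have vd : absC (v - z) < d1 by lra.
have [_ E1] := H1 _ uv; have [E2 _] := H1 _ vd.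
have E3 : absC (expC (v - z) - 1) <= 2 * absC (v - z).
  have -> : expC (v - z) - 1 = (expC (v - z) - 1 - (v - z)) + (v - z) by ring.
  rewrite (le_trans (absCD _ _))//; lra.
have -> : expC u - expC v - expC z * (u - v) = expC z *
   (expC (v - z) * (expC (u - v) - 1 - (u - v)) + (expC (v - z) - 1) * (u - v)).
  have -> : expC u = expC z * expC (v - z) * expC (u - v).
    by rewrite -!expCD; congr expC; ring.
  have -> : expC v = expC z * expC (v - z) by rewrite -!expCD; congr expC; ring.
  by ring.
rewrite absCM -ler_pdivlMl// (le_trans (absCD _ _))// !absCM.
have E4 : absC (expC (v - z)) <= 2.
  have -> : expC (v - z) = (expC (v - z) - 1) + 1 by ring.
  rewrite (le_trans (absCD _ _))// absC1; lra.
rewrite (@le_trans _ _ (2 * (eta / 6 / M * absC (u - v)) +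
                       2 * (eta / 6 / M) * absC (u - v)))//.
  rewrite lerD ?ler_pM ?absC_ge0//.
  by rewrite (le_trans E3)// ler_pM2l// ltW.
have -> : M^-1 * (eta * absC (u - v)) = eta / M * absC (u - v) by ring.
have -> : 2 * (eta / 6 / M * absC (u - v)) + 2 * (eta / 6 / M) * absC (u - v) =
   4 / 6 * (eta / M * absC (u - v)).
  by field; rewrite gt_eqF.
by rewrite -[leRHS]mul1r ler_wpM2r ?mulr_ge0 ?invr_ge0 ?absC_ge0// ?ltW//; lra.
Qed.

(** Both approximations are tested on the same small real increment at [z']. Besides uniqueness,
    this yields the continuity of the derivative needed for uniformity on compact sets. *)
Lemma strict_deriv_unique F z z' f f' (eta d : R) :
  (forall u v, absC (u - z) < d -> absC (v - z) < d ->
      absC (F u - F v - f * (u - v)) <= eta * absC (u - v)) ->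
  absC (z' - z) < d -> strict_deriv F z' f' -> absC (f' - f) <= eta.
Proof.
move=> H zd hF; apply/ler_addgt0Pr => e e0.
have [d' d'0 H'] := hF e e0.
pose h := Num.min (d' / 2) ((d - absC (z' - z)) / 2).
have h0 : 0 < h by rewrite lt_min !divr_gt0// subr_gt0.
have h1 : h <= d' / 2 by rewrite ge_min lexx.
have h2 : h <= (d - absC (z' - z)) / 2 by rewrite ge_min lexx orbT.
have ah : absC (h%:C : R[i]) = h by rewrite absC_real gtr0_norm.
have K1 : absC (z' + h%:C - z) < d.
  have -> : z' + h%:C - z = (z' - z) + h%:C by ring.
  rewrite (le_lt_trans (absCD _ _))// ah; lra.
have K2 : absC (z' + h%:C - z') < d' by rewrite addrC addKr ah; lra.
have K3 : absC (z' - z') < d' by rewrite subrr absC0.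
have E1 := H _ _ K1 zd; have E2 := H' _ _ K2 K3.
move: E1 E2; rewrite [z' + h%:C]addrC addrK ah => E1 E2.
rewrite -(ler_pM2r h0) -{1}ah -absCM.
have -> : (f' - f) * h%:C = (F (h%:C + z') - F z' - f * h%:C) -
                        (F (h%:C + z') - F z' - f' * h%:C) by ring.
by rewrite (le_trans (absCB _ _))// mulrDl lerD.
Qed.

(** Compactness extracts a common radius. Near [s], the estimate at [q s] serves for [q s'] too:
    half of [eta] is spent on the increment and half on replacing [f (q s)] by [f (q s')]. The
    parameter space is arbitrary so that the lemma covers both segments and rectangles. *)
Lemma strict_deriv_uniform (T : topologicalType) (K : set T) (q : T -> R[i]^o)
    F (f : R[i] -> R[i]) (eta : R) : compact K -> 0 < eta ->
  (forall s, K s -> {for s, continuous q}) ->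
  (forall s, K s -> strict_deriv F (q s) (f (q s))) ->
  exists2 d : R, 0 < d & forall s, K s -> forall u v,
    absC (u - q s) < d -> absC (v - q s) < d ->
    absC (F u - F v - f (q s) * (u - v)) <= eta * absC (u - v).
Proof.
move=> /compact_near_coveringP/near_covering_withinP cK eta0 cq hF.
have e2 : 0 < eta / 2 by rewrite divr_gt0.
pose P (d : R) s := forall u v,
    absC (u - q s) < d -> absC (v - q s) < d ->
    absC (F u - F v - f (q s) * (u - v)) <= eta * absC (u - v).
have : \forall d \near (0:R)^'+, K `<=` P d.
  apply: cK => s Ks; have [d d0 H] := hF s Ks _ e2.
  have d2 : 0 < d / 2 by rewrite divr_gt0.
  have cqs : \forall s' \near s, absC (q s' - q s) < d / 2.
    have := cq s Ks; move=> /cvgrPdist_lt /(_ (d / 2)%:C).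
    rewrite ltcR => /(_ d2); apply: filterS => s'.
    by rewrite normCE ltcR absC_sub.
  near=> s' i => /= Ks' u v hu hv.
  have qd : absC (q s' - q s) < d / 2 by near: s'.
  have id : i < d / 2 by near: i; exact: nbhs_right_lt.
  have hu' : absC (u - q s) < d.
    have -> : u - q s = (u - q s') + (q s' - q s) by rewrite addrA subrK.
    rewrite (le_lt_trans (absCD _ _))//; lra.
  have hv' : absC (v - q s) < d.
    have -> : v - q s = (v - q s') + (q s' - q s) by rewrite addrA subrK.
    rewrite (le_lt_trans (absCD _ _))//; lra.
  have ff : absC (f (q s') - f (q s)) <= eta / 2.
    by apply: (strict_deriv_unique H _ (hF _ Ks')); lra.
  have -> : F u - F v - f (q s') * (u - v) =
    (F u - F v - f (q s) * (u - v)) - (f (q s') - f (q s)) * (u - v) by ring.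
  rewrite (le_trans (absCB _ _))// absCM [eta]splitr mulrDl lerD//.
    exact: H.
  by rewrite ler_wpM2r ?absC_ge0.
move=> hnear; have : \forall d \near (0:R)^'+, 0 < d /\ K `<=` P d.
  near=> d; split; first by near: d; exact: nbhs_right_gt.
  by near: d.
by move=> /filter_ex[d [d0 Hd]]; exists d.
Unshelve. all: by end_near.
Qed.

End StrictDerivative.

(** * Riemann sums along Lipschitz paths *)

Section PathIntegral.
Variable R : realType.
Implicit Types (p : R -> R[i]^o) (F f : R[i] -> R[i]) (a b : R) (x xi : nat -> R).

Definition tagged_subdivision a b (d : R) n x xi : Prop :=
  [/\ x 0%N = a, x n = b & forall j, (j < n)%N ->
      x j <= xi j <= x j.+1 /\ x j.+1 - x j < d].

Lemma tagged_subdivision_bounds a b d n x xi :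
  tagged_subdivision a b d n x xi -> forall j, (j < n)%N ->
  [/\ a <= x j, x j <= xi j, xi j <= x j.+1 & x j.+1 <= b].
Proof.
move=> [x0 xn H].
have lo j : (j <= n)%N -> a <= x j.
  elim: j => [|j IH] jn; first by rewrite x0.
  have [/andP[h1 h2] _] := H j jn.
  by rewrite (le_trans (IH (ltnW jn)))// (le_trans h1).
have hi j : (j <= n)%N -> x (n - j)%N <= b.
  elim: j => [|j IH] jn; first by rewrite subn0 xn.
  have jn' : (n - j.+1 < n)%N by rewrite ltn_subrL ltn0Sn (leq_trans _ jn).
  have [/andP[h1 h2] _] := H _ jn'.
  by rewrite (le_trans _ (IH (ltnW jn)))// -(subnSK jn) (le_trans h1).
move=> j jn; have [/andP[h1 h2] _] := H j jn; split=> //; first exact/lo/ltnW.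
by have := hi (n - j.+1)%N (leq_subr _ _); rewrite subKn.
Qed.

Lemma uniform_subdivision a b (d : R) : a <= b -> 0 < d ->
  exists n x, tagged_subdivision a b d n x x.
Proof.
move=> ab d0; have [n hn] : exists n : nat, (b - a) / d < n%:R.
  exists (Num.truncn ((b - a) / d)).+1; exact: truncnS_gt.
have n0 : 0 < n%:R :> R by rewrite (le_lt_trans _ hn)// divr_ge0 ?subr_ge0// ltW.
exists n, (fun j => a + j%:R * ((b - a) / n%:R)); split.
- by rewrite mul0r addr0.
- by rewrite mulrCA divff ?gt_eqF// mulr1 addrC subrK.
move=> j _; rewrite lexx/= lerD2l ler_wpM2r ?divr_ge0 ?subr_ge0 ?(ltW n0)// ?ler_nat//.
split=> //; have -> : a + j.+1%:R * ((b - a) / n%:R) -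
  (a + j%:R * ((b - a) / n%:R)) = (b - a) / n%:R by rewrite -natr1; ring.
by rewrite ltr_pdivrMr// mulrC -ltr_pdivrMr.
Qed.

Lemma sum_telescope (V : zmodType) (u : nat -> V) n :
  \sum_(j < n) (u j.+1 - u j) = u n - u 0%N.
Proof. by rewrite -(big_mkord xpredT (fun j => u j.+1 - u j)) telescope_sumr. Qed.

Lemma lipschitz_path_continuous p (Lp : R) :
  (forall s t, absC (p s - p t) <= Lp * `|s - t|) -> continuous p.
Proof.
move=> lipp s; apply/cvgrPdist_lt => -[e1 e2].
rewrite ltcE/= => /andP[/eqP -> e10].
have Lp0 : 0 <= Lp.
  by have := lipp 1 0; rewrite subr0 normr1 mulr1; apply: le_trans; exact: absC_ge0.
have L1 : 0 < Lp + 1 by rewrite ltr_wpDl.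
exists (e1 / (Lp + 1)); first by rewrite /= divr_gt0.
move=> t /= st; rewrite normCE ltcR (le_lt_trans (lipp _ _))//.
rewrite (@le_lt_trans _ _ ((Lp + 1) * `|s - t|))//.
  by rewrite ler_wpM2r// lerDl.
by rewrite mulrC -ltr_pdivlMr.
Qed.

(** The increment of [F] telescopes over the cells, and on each cell strict differentiability at the
    tag bounds the error by a small multiple of the length of the cell. The path itself need not be
    differentiable. *)
Lemma path_integral_primitive p (Lp a b : R) F f :
  (forall s t, absC (p s - p t) <= Lp * `|s - t|) ->
  (forall s, a <= s <= b -> strict_deriv F (p s) (f (p s))) ->
  forall eta : R, 0 < eta -> exists2 d : R, 0 < d & forall n x xi,
    tagged_subdivision a b d n x xi ->
    absC (\sum_(j < n) (p (x j.+1) - p (x j)) * f (p (xi j)) -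
          (F (p b) - F (p a))) < eta.
Proof.
move=> lipp hF eta eta0.
have Lp0 : 0 <= Lp.
  have := lipp 1 0; rewrite subr0 normr1 mulr1; apply: le_trans.
  exact: absC_ge0.
have c0 : 0 < (Lp + 1) * (`|b - a| + 1).
  by rewrite mulr_gt0// ltr_wpDl.
have e0 : 0 < eta / ((Lp + 1) * (`|b - a| + 1)) / 2 by rewrite !divr_gt0.
have cp := lipschitz_path_continuous lipp.
have [d d0 H] := @strict_deriv_uniform R _ `[a, b] p F f _
  (@segment_compact _ a b) e0 (fun s _ => cp s)
  (fun s => fun h => hF s ltac:(by move: h; rewrite /= in_itv)).
exists (d / (Lp + 1)); first by rewrite divr_gt0// ltr_wpDl.
move=> n x xi hx; have bnd := tagged_subdivision_bounds hx.
have [x0 xn hj] := hx.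
have -> : F (p b) - F (p a) = \sum_(j < n) (F (p (x j.+1)) - F (p (x j))).
  by rewrite (sum_telescope (fun j => F (p (x j)))) x0 xn.
rewrite -sumrB (le_lt_trans (absC_sum _ _ _))//.
apply: (@le_lt_trans _ _ (\sum_(j < n)
   eta / ((Lp + 1) * (`|b - a| + 1)) / 2 * (Lp * (x j.+1 - x j)))).
  apply: ler_sum => -[j /= jn] _.
  have [h1 h2 h3 h4] := bnd j jn; have [_ hd] := hj j jn.
  have xx : 0 <= x j.+1 - x j by rewrite subr_ge0 (le_trans h2).
  have near1 u : x j <= u <= x j.+1 -> absC (p u - p (xi j)) < d.
    move=> /andP[u1 u2]; rewrite (le_lt_trans (lipp _ _))//.
    rewrite (@le_lt_trans _ _ ((Lp + 1) * (x j.+1 - x j)))//; last first.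
      by rewrite mulrC -ltr_pdivlMr// ltr_wpDl.
    rewrite ler_pM// ?lerDl// ler_norml; apply/andP; split; lra.
  have xij : `[a, b]%classic (xi j).
    by rewrite /= in_itv/= (le_trans h1 h2) (le_trans h3 h4).
  rewrite -absCN opprB.
  have -> : F (p (x j.+1)) - F (p (x j)) - (p (x j.+1) - p (x j)) * f (p (xi j)) =
    F (p (x j.+1)) - F (p (x j)) - f (p (xi j)) * (p (x j.+1) - p (x j)) by ring.
  apply: (le_trans (H _ xij _ _ _ _)).
  - by apply: near1; rewrite lexx (le_trans h2 h3).
  - by apply: near1; rewrite lexx (le_trans h2 h3).
  rewrite ler_wpM2l ?(ltW e0)// (le_trans (lipp _ _))//.
  by rewrite ger0_norm.
rewrite -mulr_sumr -mulr_sumr sum_telescope x0 xn.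
have -> : eta / ((Lp + 1) * (`|b - a| + 1)) / 2 * (Lp * (b - a)) =
  eta / 2 * ((Lp * (b - a)) / ((Lp + 1) * (`|b - a| + 1))).
  by field; rewrite !gt_eqF// ltr_wpDl.
rewrite (@le_lt_trans _ _ (eta / 2 * 1))//; last by lra.
rewrite ler_pM2l ?divr_gt0// ler_pdivrMr// mul1r.
rewrite (@le_trans _ _ (Lp * `|b - a|))//.
  by rewrite ler_wpM2l// ler_norm.
by rewrite ler_pM// lerDl.
Qed.

(** [h] is a primitive of a majorant of the integrand with respect to arc length. Only cells shorter
    than 1 have to be compared with it, since the subdivision may be refined. *)
Lemma path_increment_bound p (Lp a b : R) F f (h : R -> R) : a <= b ->
  (forall s t, absC (p s - p t) <= Lp * `|s - t|) ->
  (forall s, a <= s <= b -> strict_deriv F (p s) (f (p s))) ->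
  (forall s t m, a <= s -> s <= m -> m <= t -> t <= b -> t - s < 1 ->
     absC (p t - p s) * absC (f (p m)) <= h t - h s) ->
  absC (F (p b) - F (p a)) <= h b - h a.
Proof.
move=> ab lipp hF hh; apply/ler_addgt0Pr => eta eta0.
have [d d0 H] := path_integral_primitive lipp hF eta0.
have dd : 0 < Num.min d 1 by rewrite lt_min d0 ltr01.
have [n [x hx]] := uniform_subdivision ab dd.
have hx' : tagged_subdivision a b d n x x.
  case: hx => x0 xn hj; split=> // j jn; have [? ] := hj j jn.
  by rewrite lt_min => /andP[].
have := H _ _ _ hx'; set S := \sum_(_ < _) _ => HS.
have -> : F (p b) - F (p a) = S - (S - (F (p b) - F (p a))).
  by rewrite subKr.
rewrite (le_trans (absCB _ _))// lerD//; last exact: ltW.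
rewrite (le_trans (absC_sum _ _ _))//.
case: (hx) => x0 xn hj.
rewrite -x0 -xn -(sum_telescope (fun j => h (x j))) ler_sum// => -[j /= jn] _.
have [h1 h2 h3 h4] := tagged_subdivision_bounds hx jn.
have [_] := hj j jn; rewrite lt_min => /andP[_ hd].
by rewrite absCM; apply: hh.
Qed.

Lemma segment_increment_bound F f (z w : R[i]) (M : R) :
  (forall s : R, 0 <= s <= 1 -> strict_deriv F (z + s%:C * (w - z))
     (f (z + s%:C * (w - z)))) ->
  (forall s : R, 0 <= s <= 1 -> absC (f (z + s%:C * (w - z))) <= M) ->
  absC (F w - F z) <= M * absC (w - z).
Proof.
move=> hF hM; pose p (s : R) : R[i]^o := z + s%:C * (w - z).
have lipp s t : absC (p s - p t) <= absC (w - z) * `|s - t|.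
  have -> : p s - p t = (s - t)%:C * (w - z) by rewrite /p rmorphB/=; ring.
  by rewrite absCM absC_real mulrC.
have := @path_increment_bound p _ 0 1 F f (fun s => M * absC (w - z) * s) ler01
  lipp hF.
have -> : p 1 = w by rewrite /p rmorph1 mul1r addrC subrK.
have -> : p 0 = z by rewrite /p rmorph0 mul0r addr0.
rewrite mulr1 mulr0 subr0; apply=> s t xi s0 sxi xit t1 _.
have -> : M * absC (w - z) * t - M * absC (w - z) * s =
  absC (w - z) * (t - s) * M by ring.
rewrite ler_pM ?absC_ge0//.
  by rewrite (le_trans (lipp _ _))// ger0_norm// subr_ge0 (le_trans sxi).
by apply: hM; rewrite (le_trans s0 sxi) (le_trans xit t1).
Qed.

End PathIntegral.

(** * The logarithm and a primitive of the Cauchy kernel *)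

Section ComplexLogarithm.
Variable R : realType.
Implicit Types z w u v : R[i].

Lemma Re_div_absC_bounds z : z != 0 -> -1 <= Re z / absC z <= 1.
Proof.
rewrite -absC_gt0 => z0; rewrite ler_pdivrMr// ler_pdivlMr// mulN1r mul1r.
by rewrite -ler_norml Re_le_absC.
Qed.

Lemma norm_argC z : z != 0 -> `|argC z| = acos (Re z / absC z).
Proof.
move=> z0; have h := acos_ge0 (Re_div_absC_bounds z0).
by rewrite /argC (negbTE z0); case: ifP => _; rewrite ?normrN ger0_norm.
Qed.

Lemma norm_argC_le z (phi : R) : z != 0 -> 0 <= phi <= pi ->
  (`|argC z| <= phi) = (cos phi * absC z <= Re z).
Proof.
move=> z0 hphi; have z1 : 0 < absC z by rewrite absC_gt0.
have b := Re_div_absC_bounds z0.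
rewrite norm_argC// -ler_pdivlMr// leNgt.
have acp : acos (Re z / absC z) \in `[0, pi]%R.
  by rewrite in_itv/= acos_ge0// acos_lepi.
have pp : phi \in `[0, pi]%R by rewrite in_itv.
by rewrite -(ltr_cos pp acp) acosK ?in_itv// -leNgt.
Qed.

Lemma cos_argC z : z != 0 -> cos (argC z) = Re z / absC z.
Proof.
move=> z0; have b := Re_div_absC_bounds z0.
by rewrite /argC (negbTE z0); case: ifP => _; rewrite ?cosN acosK ?in_itv.
Qed.

Lemma sin_argC z : z != 0 -> sin (argC z) = Im z / absC z.
Proof.
move=> z0; have b := Re_div_absC_bounds z0.
have z1 : 0 < absC z by rewrite absC_gt0.
have E : Num.sqrt (1 - (Re z / absC z) ^+ 2) = `|Im z| / absC z.
  have -> : 1 - (Re z / absC z) ^+ 2 = (Im z / absC z) ^+ 2.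
    rewrite !exprMn !exprVn absC_sqr; field.
    by rewrite -absC_sqr sqrf_eq0 gt_eqF.
  by rewrite sqrtr_sqr normrM normfV (ger0_norm (absC_ge0 z)).
rewrite /argC (negbTE z0); case: ifPn => [h|]; rewrite ?sinN sin_acos// E.
  by rewrite ger0_norm.
by rewrite -ltNge => h; rewrite ltr0_norm// mulNr opprK.
Qed.

Definition LogC z : R[i] := ln (absC z) +i* argC z.

Lemma expC_LogC z : z != 0 -> expC (LogC z) = z.
Proof.
move=> z0; have z1 : 0 < absC z by rewrite absC_gt0.
rewrite /expC /= lnK ?posrE// cos_argC// sin_argC//.
by apply: complex_eq => /=; rewrite mulrCA divff ?mulr1// gt_eqF.
Qed.

(** The half-angle formula expresses the argument without case distinction off the closed negative
    real half-line, which is what the hypothesis says; continuity becomes visible. *)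
Lemma argC_atan z : 0 < absC z + Re z ->
  argC z = 2 * atan (Im z / (absC z + Re z)).
Proof.
move=> hz; have z0 : z != 0.
  by apply: contraTneq hz => ->; rewrite absC0 add0r ltxx.
have z1 : 0 < absC z by rewrite absC_gt0.
have b := Re_div_absC_bounds z0.
have c1 : -1 < Re z / absC z by rewrite ltr_pdivlMr// mulN1r; lra.
have ap : `|argC z| < pi.
  by rewrite norm_argC// acos_ltpi// c1; case/andP: b.
set psi := argC z in ap *.
have hp : psi / 2 \in `](- (pi / 2)), (pi / 2)[%R.
  by rewrite in_itv/=; move: ap; rewrite ltr_norml; lra.
have cp : 0 < cos (psi / 2) by apply: cos_gt0_pihalf; move: hp; rewrite in_itv.
suff -> : Im z / (absC z + Re z) = tan (psi / 2).
  by rewrite tanK//; field.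
have Ez : Im z = absC z * sin psi.
  by rewrite sin_argC// mulrCA divff ?mulr1// gt_eqF.
have Er : Re z = absC z * cos psi.
  by rewrite cos_argC// mulrCA divff ?mulr1// gt_eqF.
have p2 : psi = psi / 2 + psi / 2 by field.
have s2 : sin psi = 2 * sin (psi / 2) * cos (psi / 2).
  by rewrite {1}p2 sinD; ring.
have c2 : 1 + cos psi = 2 * cos (psi / 2) ^+ 2.
  by rewrite {1}p2 cosD -{1}(cos2Dsin2 (psi / 2)); ring.
rewrite Ez Er -{2}[absC z]mulr1 -mulrDr c2 s2 /tan.
by field; rewrite !gt_eqF.
Qed.

Lemma LogC_continuous z : 0 < absC z + Re z ->
  forall eta : R, 0 < eta -> exists2 d : R, 0 < d &
    forall w, absC (w - z) < d -> absC (LogC w - LogC z) < eta.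
Proof.
move=> hz eta eta0.
have z1 : 0 < absC z.
  rewrite absC_gt0; apply: contraTneq hz => ->.
  by rewrite absC0 add0r ltxx.
have lip_cont (h : R[i]^o -> R) : (forall a b, `|h a - h b| <= absC (a - b)) ->
    continuous h.
  move=> hl a; apply/(@cvgrPdist_lt _ _ _ (nbhs a) (nbhs_filter a)) => e e0.
  exists e%:C; first by rewrite /= ltcR.
  move=> b /=; rewrite normCE ltcR; exact: le_lt_trans.
have cR : continuous (@complex.Re R : R[i]^o -> R).
  by apply: lip_cont => a b; rewrite -ReN -ReD Re_le_absC.
have cI : continuous (@complex.Im R : R[i]^o -> R).
  by apply: lip_cont => a b; rewrite -ImN -ImD Im_le_absC.
have cA : continuous (@absC R : R[i]^o -> R).
  apply: lip_cont => a b; rewrite ler_norml absC_lerB andbT.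
  by rewrite lerNl opprB absC_sub absC_lerB.
have c1 : {for z, continuous (fun w : R[i]^o => ln (absC w))}.
  apply: (@continuous_comp R[i]^o R R (@absC R) (@ln R)); first exact: cA.
  exact: continuous_ln.
have c2 : {for z, continuous (fun w : R[i]^o =>
    2 * atan (Im w / (absC w + Re w)))}.
  apply: (@continuousM R R[i]^o); first exact: cst_continuous.
  apply: (@continuous_comp R[i]^o R R _ (@atan R)); last exact: continuous_atan.
  apply: (@continuousM R R[i]^o); first exact: cI.
  apply: (@continuousV R R[i]^o); first by rewrite gt_eqF.
  by apply: (@continuousD R R R[i]^o); [exact: cA|exact: cR].
have c3 : {for z, continuous (fun w : R[i]^o => absC w + Re w)}.
  by apply: (@continuousD R R R[i]^o); [exact: cA|exact: cR].
have e2 : 0 < eta / 2 by rewrite divr_gt0.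
have FF := @nbhs_filter R[i]^o z.
move/(@cvgrPdist_lt _ _ _ _ FF)/(_ _ e2) : c1 => n1.
move/(@cvgrPdist_lt _ _ _ _ FF)/(_ _ e2) : c2 => n2.
move/(@cvgrPdist_lt _ _ _ _ FF)/(_ _ hz) : c3 => n3.
have : \forall w \near (z : R[i]^o), absC (LogC w - LogC z) < eta.
  near=> w; rewrite (le_lt_trans (absC_le _))//= [eta]splitr ltrD//.
    by rewrite distrC; near: w.
  rewrite distrC argC_atan// argC_atan; first by near: w.
  have : `|absC z + Re z - (absC w + Re w)| <
    absC z + Re z by near: w.
  by rewrite ltr_norml => /andP[_]; lra.
move=> /nbhs_ballP[[d1 d2]]; rewrite /= ltcE/= => /andP[/eqP -> d0] H.
exists d1 => // w wd; apply: H; rewrite /ball/= normCE ltcR.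
by rewrite absC_sub.
Unshelve. all: by end_near.
Qed.

(** Local inversion of [expC]: continuity of [LogC] brings [LogC u] and [LogC v] into the disc where
    the strict estimate for [expC] holds, and that estimate is solved for [LogC u - LogC v]. *)
Lemma strict_deriv_LogC z : 0 < absC z + Re z ->
  strict_deriv LogC z z^-1.
Proof.
move=> hz eta eta0.
have z0 : z != 0.
  by apply: contraTneq hz => ->; rewrite absC0 add0r ltxx.
have z1 : 0 < absC z by rewrite absC_gt0.
(* The first bound makes [LogC] Lipschitz with constant [2 / absC z]; the second one then brings the
   error below [eta]. *)
have [e [e0 e1 e2]] : exists e : R,
    [/\ 0 < e, e <= absC z / 2 & e <= eta * absC z ^+ 2 / 2].
  exists (Num.min (absC z / 2) (eta * absC z ^+ 2 / 2)).
  rewrite lt_min !divr_gt0 ?mulr_gt0 ?exprn_gt0//=.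
  by rewrite !ge_min !lexx orbT.
have [d1 d10 H1] := @strict_deriv_expC R (LogC z) _ e0.
have [d2 d20 H2] := LogC_continuous hz d10.
exists (Num.min (absC z) d2); first by rewrite lt_min z1.
have nz u : absC (u - z) < absC z -> u != 0.
  by apply: contraTneq => ->; rewrite sub0r absCN ltxx.
move=> u v; rewrite !lt_min => /andP[u1 u2] /andP[v1 v2].
have := H1 _ _ (H2 _ u2) (H2 _ v2).
rewrite !expC_LogC ?(nz _ u1) ?(nz _ v1)//; set U := LogC u; set V := LogC v => H.
have H3 : absC z * absC (U - V) <= 2 * absC (u - v).
  have : absC (z * (U - V)) <= absC (u - v) + e * absC (U - V).
    have -> : z * (U - V) = (u - v) - (u - v - z * (U - V)) by ring.
    by rewrite (le_trans (absCB _ _))// lerD2l.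
  rewrite absCM; have : e * absC (U - V) <= absC z / 2 * absC (U - V).
    by rewrite ler_wpM2r ?absC_ge0.
  lra.
have -> : U - V - z^-1 * (u - v) = - z^-1 * (u - v - z * (U - V)).
  by field.
rewrite absCM absCN absCV -ler_pdivlMl ?invr_gt0// invrK (le_trans H)//.
rewrite -(ler_pM2l z1) mulrCA (le_trans (ler_wpM2l (ltW e0) H3))//.
have : e * absC (u - v) <= eta * absC z ^+ 2 / 2 * absC (u - v).
  by rewrite ler_wpM2r ?absC_ge0.
lra.
Qed.

Lemma LogCN_upper z : 0 < Im z -> LogC (- z) = LogC z - (0 +i* pi).
Proof.
move=> h; have z0 : z != 0 by apply: contraTneq h => ->; rewrite ltxx.
apply: complex_eq; rewrite /= ?subr0 ?absCN//.
rewrite /argC oppr_eq0 (negbTE z0) (ltW h) ImN oppr_ge0 leNgt h/= ReN absCN.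
by rewrite mulNr acosN ?Re_div_absC_bounds// opprB.
Qed.

Lemma LogCN_lower z : Im z < 0 -> LogC (- z) = LogC z + (0 +i* pi).
Proof.
move=> h; have hN : 0 < Im (- z) by rewrite ImN oppr_gt0.
by have := LogCN_upper hN; rewrite opprK => ->; rewrite subrK.
Qed.

End ComplexLogarithm.

Lemma cauchy_seq_cvg (K : numFieldType) (V : completeNormedModType K)
    (u : nat -> V) :
  (forall eps : K, 0 < eps -> exists N : nat, forall n m : nat, (N <= n)%N -> (N <= m)%N ->
     `|u n - u m| < eps) -> cvgn u.
Proof.
move=> H; apply/cauchy_cvgP/cauchy_exP => eps eps0.
have [N HN] := H _ eps0; exists (u N).
by exists N => // n /= nN; rewrite -ball_normE /=; exact: HN.
Qed.

Section CauchyKernel.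
Variable R : realType.

Lemma convex_comb_gt0 (s a b : R) :
  0 <= s <= 1 -> 0 < a -> 0 < b -> 0 < a + s * (b - a).
Proof.
move=> /andP[s0 s1] a0 b0; have -> : a + s * (b - a) = (1 - s) * a + s * b by ring.
have [s_gt0|s_le0] := ltP 0 s.
  by rewrite ltr_wpDl ?mulr_gt0// mulr_ge0 ?(ltW a0)// subr_ge0.
by have -> : s = 0; [lra|rewrite subr0 mul1r mul0r addr0].
Qed.
Implicit Types z w u v : R[i].

Lemma complex_cauchy_limit (u : nat -> R[i]) :
  (forall eta : R, 0 < eta -> exists N : nat, forall n m : nat, (N <= n)%N ->
     (N <= m)%N -> absC (u n - u m) <= eta) ->
  exists l, forall eta : R, 0 < eta -> exists N : nat, forall n : nat,
     (N <= n)%N -> absC (u n - l) <= eta.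
Proof.
move=> H.
have lim_part (h : R[i] -> R) : (forall a b, `|h a - h b| <= absC (a - b)) ->
    exists l, forall eta : R, 0 < eta -> exists N : nat, forall n : nat,
     (N <= n)%N -> `|h (u n) - l| <= eta.
  move=> hh; have : cvgn (h \o u).
    apply: cauchy_seq_cvg => eps eps0.
    have e2 : 0 < eps / 2 by rewrite divr_gt0.
    have [N HN] := H _ e2; exists N => n m nN mN.
    by rewrite (le_lt_trans (hh _ _))// (le_lt_trans (HN _ _ nN mN))//; lra.
  move=> cu; exists (limn (h \o u)) => eta eta0.
  move/cvgrPdist_le : cu => /(_ _ eta0)[N _ HN]; exists N => n nN.
  by rewrite distrC; exact: HN.
have [a Ha] := lim_part (@complex.Re R)
  (fun a b => ltac:(by rewrite -ReN -ReD Re_le_absC)).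
have [b Hb] := lim_part (@complex.Im R)
  (fun a b => ltac:(by rewrite -ImN -ImD Im_le_absC)).
exists (a +i* b) => eta eta0; have e2 : 0 < eta / 2 by rewrite divr_gt0.
have [N1 H1] := Ha _ e2; have [N2 H2] := Hb _ e2.
exists (maxn N1 N2) => n; rewrite geq_max => /andP[n1 n2].
rewrite (le_trans (absC_le _))// [eta]splitr ReD ImD ReN ImN/=.
by rewrite lerD ?H1 ?H2.
Qed.

Variables phi phi' : R[i] -> R[i].
Hypothesis dphi : forall z, 0 < Re z -> strict_deriv phi z (phi' z).
Variable lam : R[i].
Hypothesis lam0 : 0 < Re lam.

Let rect (x X Y : R) z := x <= Re z <= X /\ `|Im z| <= Y.

Lemma uniform_on_rect (x X Y eta : R) : 0 < x -> 0 < eta ->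
  exists2 d : R, 0 < d & forall z, rect x X Y z -> forall u v,
    absC (u - z) < d -> absC (v - z) < d ->
    absC (phi u - phi v - phi' z * (u - v)) <= eta * absC (u - v).
Proof.
move=> x0 eta0; pose q (t : R * R) : R[i]^o := t.1 +i* t.2.
have cK := compact_setX (@segment_compact R x X) (@segment_compact R (- Y) Y).
have cq s : {for s, continuous q}.
  apply/(@cvgrPdist_lt _ _ _ (nbhs s) (nbhs_filter s)) => -[e1 e2].
  rewrite ltcE/= => /andP[/eqP -> e10].
  have h2 : 0 < e1 / 2 by rewrite divr_gt0.
  exists (ball s.1 (e1 / 2), ball s.2 (e1 / 2)).
    by split; apply: nbhsx_ballx.
  move=> [a b] /=[]; rewrite /ball/= => ha hb.
  rewrite normCE ltcR (le_lt_trans (absC_le _))// [e1]splitr ltrD//=.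
have hK s : (`[x, X] `*` `[- Y, Y])%classic s -> strict_deriv phi (q s) (phi' (q s)).
  case: s => a b []; rewrite /= !in_itv/= => /andP[ha _] _; apply: dphi.
  exact: lt_le_trans ha.
have [d d0 H] := strict_deriv_uniform cK eta0 (fun s _ => cq s) hK.
exists d => // z [hz1 hz2].
have := H (Re z, Im z); rewrite /q/=.
have -> : Re z +i* Im z = z by case: (z).
by apply; rewrite !in_itv /= -ler_norml.
Qed.

Let diffquot z := if z == lam then phi' lam else (phi z - phi lam) / (z - lam).

Let pt n j z := lam + (j%:R / n%:R) * (z - lam).

(** The divided difference is the integral over [s] in [[0, 1]] of [phi' (lam + s (z - lam))], and
    [k n] is its Riemann sum. Integrating each summand in [z] divides by [s = j.+1 / n], so the
    weight [1 / n] becomes [1 / j.+1]: [G n] is the primitive of [k n] vanishing at [lam]. *)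
Let G n z := \sum_(j < n) j.+1%:R^-1 * (phi (pt n j.+1 z) - phi lam).

Let k n z := \sum_(j < n) n%:R^-1 * phi' (pt n j.+1 z).

Let Re_pt n j z : Re (pt n j z) =
  Re lam + j%:R / n%:R * (Re z - Re lam).
Proof.
rewrite /pt; have -> : (j%:R / n%:R : R[i]) = (j%:R / n%:R : R)%:C.
  by rewrite fmorph_div !rmorph_nat.
by rewrite ReD ReM /= mul0r subr0 ReD ReN.
Qed.

Let Im_pt n j z : Im (pt n j z) =
  Im lam + j%:R / n%:R * (Im z - Im lam).
Proof.
rewrite /pt; have -> : (j%:R / n%:R : R[i]) = (j%:R / n%:R : R)%:C.
  by rewrite fmorph_div !rmorph_nat.
by rewrite ImD ImM /= mul0r addr0 ImD ImN.
Qed.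

Let frac01 n j : (j <= n)%N -> 0 <= (j%:R / n%:R : R) <= 1.
Proof.
move=> jn; rewrite divr_ge0//=; have [->|n0] := posnP n.
  by rewrite invr0 mulr0.
by rewrite ler_pdivrMr ?ltr0n// mul1r ler_nat.
Qed.

Let rect_pt (x X Y : R) n j z : rect x X Y lam -> rect x X Y z ->
  (j <= n)%N -> rect x X Y (pt n j z).
Proof.
move=> [l1 l2] [z1 z2] /frac01; rewrite /rect Re_pt Im_pt.
set s := (j%:R / n%:R) => /andP[s0 s1]; split; first by nra.
by move: l2 z2; rewrite !ler_norml; nra.
Qed.

Let strict_deriv_G n z : 0 < Re z -> strict_deriv (G n) z (k n z).
Proof.
move=> z0; apply: (@strict_deriv_sum R n
  (fun j x => j.+1%:R^-1 * (phi (pt n j.+1 x) - phi lam)) z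
  (fun j => n%:R^-1 * phi' (pt n j.+1 z))) => j jn.
have n0 : n%:R != 0 :> R[i] by rewrite pnatr_eq0 -lt0n (leq_ltn_trans _ jn).
have hp : 0 < Re (pt n j.+1 z).
  by rewrite Re_pt convex_comb_gt0// frac01.
have -> : n%:R^-1 * phi' (pt n j.+1 z) =
    j.+1%:R^-1 * (phi' (pt n j.+1 z) * (j.+1%:R / n%:R)).
  by rewrite [RHS]mulrCA mulKf ?pnatr_eq0// mulrC.
apply: (@strict_derivZ _ _ (fun x => phi (pt n j.+1 x) - phi lam)).
rewrite -[_ * (_ / _)]addr0.
apply: (@strict_derivD _ (fun x => phi (pt n j.+1 x)) (fun=> - phi lam)); last first.
  by move=> eta eta0; exists 1 => // u v _ _;
     rewrite subrr mul0r subr0 absC0 mulr_ge0 ?absC_ge0// ltW.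
apply: (@strict_deriv_comp _ phi (pt n j.+1)); last exact: dphi.
have := @strict_deriv_affine _ (j.+1%:R / n%:R) (lam - j.+1%:R / n%:R * lam) z.
move=> H eta eta0; have [d d0 {}H] := H _ eta0; exists d => // u v hu hv.
have := H u v hu hv; congr (absC _ <= _); rewrite /pt; ring.
Qed.

Let k_close (x X Y eta : R) : 0 < x -> 0 < eta -> rect x X Y lam ->
  exists N, forall n z, (N <= n)%N -> rect x X Y z ->
    absC (k n z - diffquot z) <= eta.
Proof.
move=> x0 eta0 hl.
have [d d0 Hd] := @uniform_on_rect x X Y eta x0 eta0.
(* [D] bounds [absC (z - lam)] on the whole rectangle, so that [N] does not depend on [z]. *)
pose D : R := (X - x) + 2 * Y.
exists (Num.truncn (D / d)).+1 => n z nN hz.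
have n0 : (0 < n)%N by rewrite (leq_trans _ nN).
have nR0 : 0 < n%:R :> R by rewrite ltr0n.
have nC0 : n%:R != 0 :> R[i] by rewrite pnatr_eq0 -lt0n.
rewrite /diffquot; have [->|zl] := eqVneq z lam.
  have -> : k n lam = phi' lam; last by rewrite subrr absC0 ltW.
  rewrite /k (eq_bigr (fun=> n%:R^-1 * phi' lam)).
    by rewrite sumr_const card_ord -[LHS]mulr_natr mulrAC mulVf// mul1r.
  by move=> j _; rewrite /pt subrr mulr0 addr0.
have zl0 : 0 < absC (z - lam) by rewrite absC_gt0 subr_eq0.
rewrite -(ler_pM2r zl0) -absCM mulrBl divfK ?subr_eq0// /k mulr_suml.
have small : absC ((z - lam) / n%:R) < d.
  rewrite absCM absCV absC_nat ltr_pdivrMr// mulrC -ltr_pdivrMr//.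
  apply: (@le_lt_trans _ _ (D / d)).
    rewrite ler_wpM2r ?invr_ge0 ?(ltW d0)// (le_trans (absC_le _))//.
    rewrite ReD ImD ReN ImN /D.
    case: hl hz => /andP[a1 a2] a3 [/andP[b1 b2] b3]; rewrite lerD//.
      by rewrite ler_norml; apply/andP; split; lra.
    by rewrite (le_trans (ler_normB _ _))//; lra.
  by apply: (@lt_le_trans _ _ (Num.truncn (D / d)).+1%:R);
    [exact: truncnS_gt|rewrite ler_nat].
have -> : phi z - phi lam =
    \sum_(j < n) (phi (pt n j.+1 z) - phi (pt n j z)).
  rewrite (sum_telescope (fun j => phi (pt n j z))) /pt divff// mul1r.
  by rewrite mul0r mul0r addr0 [lam + _]addrC subrK.
rewrite -sumrB (le_trans (absC_sum _ _ _))//.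
apply: (@le_trans _ _ (\sum_(j < n) (eta * absC (z - lam) / n%:R))); last first.
  by rewrite sumr_const card_ord -[leLHS]mulr_natr divfK// gt_eqF.
apply: ler_sum => -[j /= jn] _.
have step : pt n j.+1 z - pt n j z = (z - lam) / n%:R.
  by rewrite /pt -natr1; field.
have -> : n%:R^-1 * phi' (pt n j.+1 z) * (z - lam) -
   (phi (pt n j.+1 z) - phi (pt n j z)) =
  - (phi (pt n j.+1 z) - phi (pt n j z) -
     phi' (pt n j.+1 z) * (pt n j.+1 z - pt n j z)) by rewrite step; field.
have hr := rect_pt hl hz jn.
rewrite absCN (le_trans (Hd _ hr _ _ _ _))//.
- by rewrite subrr absC0.
- by rewrite absC_sub step.
by rewrite step absCM absCV absC_nat mulrA.
Qed.

(** The mean value inequality for [G n - G m] on a segment, which stays in the convex rectangle;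
    both derivatives are compared with the divided difference. *)
Let G_increment (x X Y eta : R) (n m : nat) u v : 0 < x ->
  (forall z, rect x X Y z -> absC (k n z - diffquot z) <= eta) ->
  (forall z, rect x X Y z -> absC (k m z - diffquot z) <= eta) ->
  rect x X Y u -> rect x X Y v ->
  absC ((G n u - G m u) - (G n v - G m v)) <= 2 * eta * absC (u - v).
Proof.
move=> x0 Hn Hm hu hv.
have hs s : 0 <= s <= 1 -> rect x X Y (v + s%:C * (u - v)).
  case: hu hv => /andP[a1 a2] a3 [/andP[b1 b2] b3] /andP[s0 s1].
  rewrite /rect ReD ImD ReM ImM /= !mul0r subr0 addr0 ReD ImD ReN ImN.
  by move: a3 b3; rewrite !ler_norml; nra.
have hre z : rect x X Y z -> 0 < Re z.
  by move=> [/andP[h _] _]; exact: lt_le_trans x0 h.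
apply: (@segment_increment_bound _ (fun z => G n z - G m z)
  (fun z => k n z + (-1) * k m z)).
- move=> s hs'; have h0 := hre _ (hs _ hs').
  have H1 := strict_derivD (strict_deriv_G n h0)
     (strict_derivZ (-1) (strict_deriv_G m h0)).
  move=> e e0; have [d d0 {}H1] := H1 e e0; exists d => // a b ha hb.
  by have := H1 a b ha hb; rewrite !mulN1r.
- move=> s hs'; have hr := hs _ hs'; set z := v + _ in hr *.
  have -> : k n z + (-1) * k m z = (k n z - diffquot z) - (k m z - diffquot z).
    by ring.
  by rewrite (le_trans (absCB _ _))// mulr_natl mulr2n lerD ?Hn ?Hm.
Qed.

Let G_lam n : G n lam = 0.
Proof.
by rewrite /G big1// => j _; rewrite /pt subrr mulr0 addr0 subrr mulr0.
Qed.

Let enclosing_rect z : 0 < Re z -> exists x X Y r : R,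
  [/\ 0 < x, 0 < r, rect x X Y lam & forall u, absC (u - z) < r -> rect x X Y u].
Proof.
move=> z0; pose r := Re z / 2.
have r0 : 0 < r by rewrite divr_gt0.
exists (Num.min r (Re lam)), (`|Re z| + r + `|Re lam|),
  (`|Im z| + r + `|Im lam|), r; split=> //.
- by rewrite lt_min r0.
- split; last by rewrite lerDr addr_ge0// ltW.
  by rewrite ge_min lexx orbT/= (le_trans (ler_norm _))// lerDr addr_ge0// ltW.
move=> u ur; have h1 := Re_le_absC (u - z); have h2 := Im_le_absC (u - z).
move: h1 h2; rewrite ReD ImD ReN ImN => h1 h2; split.
  rewrite ge_min; have := ler_norm (Re z).
  have h3 := le_lt_trans h1 ur.
  have := normr_ge0 (Re lam).
  move: h3; rewrite ltr_norml /r => h3 h4 h5; apply/andP; split.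
    apply/orP; left; lra.
  lra.
have -> : Im u = (Im u - Im z) + Im z by ring.
rewrite (le_trans (ler_normD _ _))//.
have := normr_ge0 (Im lam); lra.
Qed.

(** Termwise differentiation: all [G n] vanish at [lam] and their derivatives converge uniformly on
    rectangles containing [lam], so [G n] converges and the limit has the limit derivative. *)
Lemma divided_difference_primitive : exists P : R[i] -> R[i],
  forall z, 0 < Re z ->
    strict_deriv P z
      (if z == lam then phi' lam else (phi z - phi lam) / (z - lam)).
Proof.
have cau z : exists l, 0 < Re z -> forall eta : R, 0 < eta ->
    exists N : nat, forall n : nat, (N <= n)%N -> absC (G n z - l) <= eta.
  have [z0|] := boolP (0 < Re z); last by exists 0.
  have [x [X [Y [r [x0 r0 hl hz]]]]] := enclosing_rect z0.
  have zr : rect x X Y z by apply: hz; rewrite subrr absC0.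
  have [l Hl] : exists l, forall eta : R, 0 < eta -> exists N : nat,
    forall n : nat, (N <= n)%N -> absC (G n z - l) <= eta; last by exists l.
  apply: complex_cauchy_limit => eta eta0.
  have c0 : 0 < 2 * (absC (z - lam) + 1).
    by rewrite mulr_gt0// ltr_wpDl ?absC_ge0.
  have [N HN] := k_close x0 (divr_gt0 eta0 c0) hl; exists N => n m nN mN.
  have := G_increment x0 (fun z => HN n z nN) (fun z => HN m z mN) zr hl.
  rewrite !G_lam !subr0 => /le_trans; apply.
  have -> : 2 * (eta / (2 * (absC (z - lam) + 1))) * absC (z - lam) =
    eta * (absC (z - lam) / (absC (z - lam) + 1)).
    by field; rewrite gt_eqF// ltr_wpDl ?absC_ge0.
  rewrite -[leRHS]mulr1 ler_pM2l// ler_pdivrMr ?ltr_wpDl ?absC_ge0//.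
  by rewrite mul1r lerDl.
have [P HP] := choice cau; exists P => z z0 eta eta0.
have [x [X [Y [r [x0 r0 hl hz]]]]] := enclosing_rect z0.
have zr : rect x X Y z by apply: hz; rewrite subrr absC0.
have e4 : 0 < eta / 4 by rewrite divr_gt0.
have [N HN] := k_close x0 e4 hl.
have [d d0 Hd] := strict_deriv_G N z0 e4.
exists (Num.min d r); first by rewrite lt_min d0.
move=> u v; rewrite !lt_min => /andP[u1 u2] /andP[v1 v2].
have ur := hz _ u2; have vr := hz _ v2.
have hre w : rect x X Y w -> 0 < Re w.
  by move=> [/andP[h _] _]; exact: lt_le_trans x0 h.
have E1 : absC ((P u - G N u) - (P v - G N v)) <= 2 * (eta / 4) * absC (u - v).
  apply/ler_addgt0Pr => e e0; have e2 : 0 < e / 2 by rewrite divr_gt0.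
  have [n1 h1] := HP u (hre _ ur) _ e2; have [n2 h2] := HP v (hre _ vr) _ e2.
  pose n := maxn N (maxn n1 n2).
  have nN : (N <= n)%N by rewrite leq_max leqnn.
  have nn1 : (n1 <= n)%N by rewrite !leq_max leqnn orbT.
  have nn2 : (n2 <= n)%N by rewrite !leq_max leqnn !orbT.
  have := G_increment x0 (fun z => HN n z nN) (fun z => HN N z (leqnn N)) ur vr.
  have {}h1 := h1 n nn1; have {}h2 := h2 n nn2 => h3.
  have -> : P u - G N u - (P v - G N v) =
    (G n u - G N u - (G n v - G N v)) + ((G n v - P v) - (G n u - P u)) by ring.
  rewrite (le_trans (absCD _ _))// lerD// (le_trans (absCB _ _))//.
  by rewrite [e]splitr lerD.
rewrite -/(diffquot z).
have -> : P u - P v - diffquot z * (u - v) =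
  ((P u - G N u) - (P v - G N v)) + (G N u - G N v - k N z * (u - v))
  + (k N z - diffquot z) * (u - v) by ring.
have E2 := Hd _ _ u1 v1.
have E3 : absC ((k N z - diffquot z) * (u - v)) <= eta / 4 * absC (u - v).
  by rewrite absCM ler_wpM2r ?absC_ge0// HN.
rewrite (le_trans (absCD _ _))// (le_trans (lerD (absCD _ _) E3))//.
lra.
Qed.

(* Across the horizontal line through [lam] the branches [LogC (lam - z)] and
   [LogC (z - lam)] differ by [i pi] above and [- i pi] below; this is where
   the residue comes from. *)
Lemma cauchy_kernel_primitive : exists W : R[i] -> R[i],
  (forall z, 0 < Re z ->
    ~ (Im z = Im lam /\ Re lam <= Re z) ->
    strict_deriv W z (phi z / (lam - z))) /\
  forall X y1 y2 M : R, Re lam < X -> y1 < Im lam < y2 ->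
    (forall y, y1 <= y <= y2 -> absC (phi (X +i* y) / (lam - (X +i* y))) <= M) ->
    absC (W (X +i* y2) - W (X +i* y1) - (0 +i* (2 * pi)) * phi lam)
      <= M * (y2 - y1).
Proof.
have [P HP] := divided_difference_primitive.
(* [phi z / (lam - z)] is minus the divided difference minus [phi lam / (z - lam)], and
   [LogC (lam - z)] and [LogC (z - lam)] are both primitives of [1 / (z - lam)]. [Wl] is slit to the
   right of [lam], [Wr] to the left; on a vertical line to the right of [lam], [Wr] supplies the
   bound. *)
pose Wl z := (-1) * P z + (- phi lam) * LogC ((-1) * z + lam).
pose Wr z := (-1) * P z + (- phi lam) * LogC (1 * z + - lam).
have dWl z : 0 < Re z ->
    ~ (Im z = Im lam /\ Re lam <= Re z) ->
    strict_deriv Wl z (phi z / (lam - z)).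
  move=> z0 hz; have zl : z != lam.
    by apply/negP => /eqP E; apply: hz; rewrite E.
  have := HP z z0; rewrite (negbTE zl) => H1.
  have h : 0 < absC ((-1) * z + lam) + Re ((-1) * z + lam).
    rewrite mulN1r; set w := - z + lam.
    have [h|h] := ltP 0 (Re w); first by rewrite ltr_wpDl ?absC_ge0.
    rewrite -ltrBlDr sub0r -(ler0_norm h) -(@ltr_pXn2r _ 2) ?nnegrE ?absC_ge0//.
    rewrite absC_sqr real_normK ?num_real// ltrDl exprn_even_gt0//=.
    apply/negP => /eqP; rewrite /w ImD ImN => h'.
    apply: hz; move: h; rewrite /w ReD ReN; lra.
  have H2 := strict_deriv_comp (strict_deriv_affine (-1) lam z)
    (strict_deriv_LogC h).
  have := strict_derivD (strict_derivZ (-1) H1) (strict_derivZ (- phi lam) H2).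
  congr (strict_deriv _ _ _); rewrite mulN1r.
  by rewrite [- z + lam]addrC; field; rewrite !subr_eq0 zl eq_sym zl.
have dWr z : 0 < Re z -> Re lam < Re z ->
    strict_deriv Wr z (phi z / (lam - z)).
  move=> z0 hz; have zl : z != lam.
    by apply/negP => /eqP E; move: hz; rewrite E ltxx.
  have := HP z z0; rewrite (negbTE zl) => H1.
  have h : 0 < absC (1 * z + - lam) + Re (1 * z + - lam).
    by rewrite mul1r ltr_wpDl ?absC_ge0// ReD ReN subr_gt0.
  have H2 := strict_deriv_comp (strict_deriv_affine 1 (- lam) z)
    (strict_deriv_LogC h).
  have := strict_derivD (strict_derivZ (-1) H1) (strict_derivZ (- phi lam) H2).
  congr (strict_deriv _ _ _); rewrite mul1r.
  by field; rewrite !subr_eq0 zl eq_sym zl.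
exists Wl; split => // X y1 y2 M lX /andP[y1l ly2] HM.
have up : Wl (X +i* y2) = Wr (X +i* y2) + (0 +i* pi) * phi lam.
  rewrite /Wl /Wr; set z := X +i* y2.
  have -> : -1 * z + lam = - (1 * z - lam) by ring.
  rewrite LogCN_upper; first by ring.
  by rewrite mul1r ImD ImN /= subr_gt0.
have low : Wl (X +i* y1) = Wr (X +i* y1) - (0 +i* pi) * phi lam.
  rewrite /Wl /Wr; set z := X +i* y1.
  have -> : -1 * z + lam = - (1 * z - lam) by ring.
  rewrite LogCN_lower; first by ring.
  by rewrite mul1r ImD ImN /= subr_lt0.
have -> : Wl (X +i* y2) - Wl (X +i* y1) - (0 +i* (2 * pi)) * phi lam =
   Wr (X +i* y2) - Wr (X +i* y1).
  rewrite up low; have -> : (0 +i* (2 * pi) : R[i]) = (0 +i* pi) + (0 +i* pi).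
    by apply: complex_eq; rewrite /= ?addr0//; ring.
  by ring.
have y12 : 0 <= y2 - y1 by lra.
have E : (X +i* y2) - (X +i* y1) = 0 +i* (y2 - y1) :> R[i].
  by apply: complex_eq; rewrite /= ?subrr.
have segE s : (X +i* y1) + s%:C * ((X +i* y2) - (X +i* y1)) =
    X +i* (y1 + s * (y2 - y1)) :> R[i].
  by rewrite E; apply: complex_eq; rewrite /=; ring.
have := @segment_increment_bound _ Wr (fun z => phi z / (lam - z))
   (X +i* y1) (X +i* y2) M.
rewrite E; have -> : absC (0 +i* (y2 - y1)) = y2 - y1.
  by rewrite absCE/= expr0n add0r sqrtr_sqr ger0_norm.
apply; move=> s hs; rewrite -E segE.
  by apply: dWr => //=; exact: lt_trans lX.
by apply: HM; move: hs y12; nra.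
Qed.

End CauchyKernel.

(** * Decay of the exponential factor in sectors *)

Section ExpPower.
Variable R : realType.
Implicit Types (z w : R[i]) (alpha t psi : R).

Definition exp_pow alpha t z : R[i] := expC (- powC z alpha * t%:C).

Lemma powC_LogC z alpha : powC z alpha = expC (alpha%:C * LogC z).
Proof. by []. Qed.

Lemma Re_powC z alpha : z != 0 ->
  Re (powC z alpha) = absC z `^ alpha * cos (alpha * argC z).
Proof.
move=> z0; rewrite /powC /expC /powR absC_eq0 (negbTE z0) /=.
by rewrite !mul0r subr0 addr0.
Qed.

Lemma absC_exp_pow alpha t z : z != 0 ->
  absC (exp_pow alpha t z) = expR (- (t * (absC z `^ alpha * cos (alpha * argC z)))).
Proof.
move=> z0; rewrite /exp_pow absC_expC ReM ReN Re_powC//= mulr0 subr0 mulNr.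
by rewrite mulrC.
Qed.

Lemma strict_deriv_exp_pow alpha t z : 0 < Re z ->
  strict_deriv (exp_pow alpha t) z
    (exp_pow alpha t z * (- t%:C * (powC z alpha * (alpha%:C * z^-1)))).
Proof.
move=> z0; have h : 0 < absC z + Re z by rewrite ltr_wpDl ?absC_ge0.
have H1 := strict_derivZ alpha%:C (strict_deriv_LogC h).
have H2 := strict_deriv_comp H1 (strict_deriv_expC _).
have H3 := strict_derivZ (- t%:C) H2.
have H4 := strict_deriv_comp H3 (strict_deriv_expC _).
have E w : expC (- t%:C * expC (alpha%:C * LogC w)) = exp_pow alpha t w.
  by rewrite /exp_pow powC_LogC; congr expC; ring.
rewrite -(E z); move=> eta eta0; have [d d0 H] := H4 _ eta0.
by exists d => // u v hu hv; rewrite -!E; exact: H.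
Qed.

Lemma absC_exp_pow_le alpha t z : 0 <= t -> z != 0 ->
  absC (exp_pow alpha t z) <= expR (t * absC z `^ alpha).
Proof.
move=> t0 z0; rewrite absC_exp_pow// ler_expR -mulrN ler_wpM2l//.
by rewrite -mulrN -[leRHS]mulr1 ler_wpM2l ?powR_ge0// lerNl cos_geN1.
Qed.

Lemma exp_pow_sector_decay alpha t psi n : 1 <= alpha -> 0 < t -> 0 <= psi ->
  alpha * psi < pi / 2 -> exists2 K : R, 0 <= K & forall z, z != 0 ->
  `|argC z| <= psi -> absC (exp_pow alpha t z) * absC z ^+ n.+1 <= K.
Proof.
move=> a1 t0 p0 ap; have a0 : 0 <= alpha by lra.
pose c : R := cos (alpha * psi).
have c0 : 0 < c.
  apply: cos_gt0_pihalf; rewrite ap andbT (lt_le_trans _ (mulr_ge0 a0 p0))//.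
  by rewrite oppr_lt0 divr_gt0 ?pi_gt0.
have tc : 0 < t * c by rewrite mulr_gt0.
(* The 1 covers the unit disc. Outside it [absC z] is at most [absC z] to the power [alpha], and
   [expR x] dominates [x ^+ n.+1 / n.+1!] at [x = t * c * absC z]. *)
exists (1 + n.+1`!%:R / (t * c) ^+ n.+1).
  by rewrite addr_ge0// divr_ge0 ?exprn_ge0 ?ler0n// ltW.
move=> z z0 hz; have z1 : 0 < absC z by rewrite absC_gt0.
have hc : c <= cos (alpha * argC z).
  have -> : cos (alpha * argC z) = cos (alpha * `|argC z|).
    by case: (ger0P (argC z)) => // _; rewrite mulrN cosN.
  have le : alpha * `|argC z| <= alpha * psi by rewrite ler_wpM2l.
  have pi0 := pi_gt0 R.
  have [E|ne] := eqVneq (alpha * `|argC z|) (alpha * psi); first by rewrite E.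
  apply/ltW; rewrite /c ltr_cos ?in_itv/= ?mulr_ge0//.
  - by rewrite lt_neqAle ne.
  - lra.
  - lra.
rewrite absC_exp_pow//.
have [x1|x1] := leP (absC z) 1.
  rewrite (@le_trans _ _ 1)//; last first.
    by rewrite lerDl divr_ge0 ?exprn_ge0 ?ler0n// ltW.
  rewrite mulr_ile1 ?expR_ge0 ?exprn_ge0 ?absC_ge0//.
    rewrite expR_le1 oppr_le0 mulr_ge0 ?mulr_ge0 ?powR_ge0 ?(ltW t0)//.
    by rewrite (le_trans (ltW c0)).
  by rewrite exprn_ile1 ?absC_ge0.
have E : t * c * absC z <= t * (absC z `^ alpha * cos (alpha * argC z)).
  rewrite -mulrA ler_pM2l// mulrC ler_pM ?absC_ge0 ?(ltW c0)//.
  by rewrite le1r_powR// ltW.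
have tcz : 0 < t * c * absC z by rewrite mulr_gt0.
rewrite (@le_trans _ _ (expR (- (t * c * absC z)) * absC z ^+ n.+1))//.
  by rewrite ler_wpM2r ?exprn_ge0 ?absC_ge0// ler_expR lerN2.
rewrite (@le_trans _ _ (n.+1`!%:R / (t * c) ^+ n.+1))//; last by rewrite lerDr.
have F0 : 0 < (n.+1`!%:R : R) by rewrite ltr0n fact_gt0.
have -> : absC z ^+ n.+1 = (t * c * absC z) ^+ n.+1 / (t * c) ^+ n.+1.
  by rewrite exprMn mulrAC divff ?mul1r// gt_eqF// exprn_gt0.
rewrite expRN mulrA ler_pM2r ?invr_gt0 ?exprn_gt0// ler_pdivrMl ?expR_gt0//.
rewrite -ler_pdivrMr// (le_trans _ (expR_ge1Dxn n (ltW tcz)))//.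
by rewrite lerDr.
Qed.

Lemma norm_argC_le_tan z psi : 0 < psi < pi / 2 -> 0 < Re z ->
  `|Im z| <= tan psi * Re z -> `|argC z| <= psi.
Proof.
move=> /andP[p0 p1] z0 h; have zn : z != 0 by apply: contraTneq z0 => ->; rewrite ltxx.
have c0 : 0 < cos psi by apply: cos_gt0_pihalf; rewrite p1 andbT; lra.
have pi0 := pi_gt0 R.
rewrite norm_argC_le//; last by apply/andP; split; lra.
have h2 : cos psi * `|Im z| <= sin psi * Re z.
  by move: h; rewrite /tan mulrAC ler_pdivlMr// mulrC.
rewrite -(@ler_pXn2r _ 2) ?nnegrE ?mulr_ge0 ?absC_ge0 ?(ltW c0) ?(ltW z0)//.
rewrite exprMn absC_sqr -[Im z ^+ 2]real_normK ?num_real//.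
have := cos2Dsin2 psi.
have : (cos psi * `|Im z|) ^+ 2 <= (sin psi * Re z) ^+ 2.
  rewrite ler_pXn2r ?nnegrE ?mulr_ge0 ?(ltW c0) ?(ltW z0)//.
  by apply: sin_ge0_pi; apply/andP; split; lra.
rewrite !exprMn; move: (cos psi ^+ 2) (sin psi ^+ 2) => A B h3 h4.
have BE : B = 1 - A by lra.
by move: h3; rewrite BE; lra.
Qed.

End ExpPower.

(** * Contours as graphs over the imaginary axis *)

Section ContourGraph.
Variables (R : realType) (r k0 k1 iota : R).
Hypotheses (r0 : 0 < r) (k00 : 0 < k0) (k10 : 0 < k1) (iota0 : iota <= 0).
Implicit Types (s t y : R) (z lam : R[i]).

(** The least nonnegative abscissa at ordinate [y] outside the disc of radius [r] and inside the
    sector at 0 whose half-angle has cotangent [k0]. The maximum under the root treats the arc and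
    both rays at once. *)
Definition arc_height y : R := Num.sqrt (Num.max (r ^+ 2 - y ^+ 2) (k0 ^+ 2 * y ^+ 2)).

(** The second argument is the boundary of the sector with vertex [iota] and cotangent [k1], so the
    region to the right of the graph is the set bounded by the contour. *)
Definition graph_height y : R := Num.max (arc_height y) (iota + k1 * `|y|).

Definition graph_path s : R[i]^o := graph_height s +i* s.

Let arc_arg_ge0 y : 0 <= Num.max (r ^+ 2 - y ^+ 2) (k0 ^+ 2 * y ^+ 2).
Proof. by rewrite le_max mulr_ge0 ?orbT// sqr_ge0. Qed.

Lemma arc_height_ge0 y : 0 <= arc_height y.
Proof. exact: sqrtr_ge0. Qed.

Lemma arc_height_le y x : 0 <= x ->
  (arc_height y <= x) = (r ^+ 2 <= x ^+ 2 + y ^+ 2) && (k0 * `|y| <= x).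
Proof.
move=> x0; rewrite -(@ler_pXn2r _ 2)// ?nnegrE ?arc_height_ge0// sqr_sqrtr//.
rewrite ge_max lerBlDr; congr (_ && _).
rewrite -[y ^+ 2]real_normK ?num_real// -exprMn ler_pXn2r// nnegrE.
by rewrite mulr_ge0// ltW.
Qed.

Lemma arc_height_ge_line y : k0 * `|y| <= arc_height y.
Proof.
by have := arc_height_le y (arc_height_ge0 y); rewrite lexx => /esym/andP[].
Qed.

Lemma graph_height_ge0 y : 0 <= graph_height y.
Proof. by rewrite le_max arc_height_ge0. Qed.

Lemma graph_height_le y x : 0 <= x -> (graph_height y <= x) =
  [&& r ^+ 2 <= x ^+ 2 + y ^+ 2, k0 * `|y| <= x & iota + k1 * `|y| <= x].
Proof. by move=> x0; rewrite ge_max arc_height_le// andbA. Qed.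

Lemma graph_height_ge_line y : k0 * `|y| <= graph_height y.
Proof. by rewrite le_max arc_height_ge_line. Qed.

Lemma graph_height_ge_line1 y : iota + k1 * `|y| <= graph_height y.
Proof. by rewrite le_max lexx orbT. Qed.

Lemma max_lipschitz (a b c d e : R) : `|a - c| <= e -> `|b - d| <= e ->
  `|Num.max a b - Num.max c d| <= e.
Proof.
rewrite !ler_norml => /andP[h1 h2] /andP[h3 h4].
by case: (leP a b) => h5; case: (leP c d) => h6; apply/andP; split; lra.
Qed.

(** A circular arc alone has vertical slope at [|y| = r]; the rays cut it off before. The difference
    of squares is divided by the sum of the heights, which is at least [k0 * (|s| + |t|)]. *)
Lemma arc_height_lipschitz s t :
  `|arc_height s - arc_height t| <= (1 + k0 ^+ 2) / k0 * `|s - t|.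
Proof.
have := arc_height_ge_line s; have := arc_height_ge_line t.
set a := arc_height s; set b := arc_height t => hb ha.
have a0 : 0 <= a := arc_height_ge0 s; have b0 : 0 <= b := arc_height_ge0 t.
have [ab0|ab] := leP (a + b) 0.
  have -> : a = 0 by lra.
  have -> : b = 0 by lra.
  by rewrite subrr normr0 mulr_ge0// divr_ge0 ?(ltW k00)// addr_ge0 ?sqr_ge0.
rewrite -(ler_pM2r ab) -{1}(ger0_norm (ltW ab)) -normrM.
have -> : (a - b) * (a + b) = a ^+ 2 - b ^+ 2 by ring.
rewrite /a /b !sqr_sqrtr//.
apply: (@le_trans _ _ ((1 + k0 ^+ 2) * (`|s - t| * (`|s| + `|t|)))).
  have st : `|s ^+ 2 - t ^+ 2| <= `|s - t| * (`|s| + `|t|).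
    have -> : s ^+ 2 - t ^+ 2 = (s - t) * (s + t) by ring.
    by rewrite normrM ler_wpM2l// ler_normD.
  have k2 := sqr_ge0 k0; have h0 := normr_ge0 (s ^+ 2 - t ^+ 2).
  apply: max_lipschitz.
    have -> : r ^+ 2 - s ^+ 2 - (r ^+ 2 - t ^+ 2) = - (s ^+ 2 - t ^+ 2) by ring.
    rewrite normrN; nra.
  by rewrite -mulrBr normrM (ger0_norm k2); nra.
rewrite -!mulrA ler_wpM2l ?addr_ge0 ?sqr_ge0// mulrCA ler_wpM2l//.
by rewrite -/a -/b ler_pdivlMl//; lra.
Qed.

Let Lip := (1 + k0 ^+ 2) / k0 + k1.

Let Lip0 : 0 < Lip.
Proof. by rewrite addr_gt0// divr_gt0// ltr_wpDr ?sqr_ge0. Qed.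

Lemma graph_height_lipschitz s t :
  `|graph_height s - graph_height t| <= Lip * `|s - t|.
Proof.
apply: max_lipschitz.
  rewrite (le_trans (arc_height_lipschitz _ _))// ler_wpM2r// lerDl.
  exact: ltW.
have -> : iota + k1 * `|s| - (iota + k1 * `|t|) = k1 * (`|s| - `|t|) by ring.
rewrite normrM (gtr0_norm k10) /Lip mulrDl.
rewrite (@le_trans _ _ (k1 * `|s - t|))//.
  by rewrite ler_wpM2l ?ler_dist_dist// ltW.
by rewrite lerDr mulr_ge0// divr_ge0 ?(ltW k00)// addr_ge0 ?sqr_ge0.
Qed.

Lemma graph_path_lipschitz s t :
  absC (graph_path s - graph_path t) <= (Lip + 1) * `|s - t|.
Proof.
rewrite (le_trans (absC_le _))//= mulrDl mul1r lerD//.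
exact: graph_height_lipschitz.
Qed.

Lemma graph_height_linear : exists2 c : R, 0 < c &
  forall s, c * (1 + `|s|) <= graph_height s.
Proof.
(* [c1] serves for [|s| >= r / 2], where the rays give the growth; [c2] serves for [|s| < r / 2],
   where the circle keeps the height above [r / 2]. *)
pose c1 := k0 / (1 + 2 / r); pose c2 := r / 2 / (1 + r / 2).
have r2 : 0 < 1 + 2 / r by rewrite addr_gt0// divr_gt0.
have r3 : 0 < 1 + r / 2 by rewrite addr_gt0// divr_gt0.
have c10 : 0 < c1 by rewrite divr_gt0.
have c20 : 0 < c2 by rewrite !divr_gt0.
exists (Num.min c1 c2); first by rewrite lt_min c10.
move=> s; have s0 : 0 <= 1 + `|s| by rewrite addr_ge0.
have [h|h] := leP (r / 2) `|s|.
  apply: (@le_trans _ _ (c1 * (1 + `|s|))).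
    by rewrite ler_wpM2r// ge_min lexx.
  rewrite (le_trans _ (graph_height_ge_line s))// /c1 mulrAC.
  rewrite ler_pdivrMr// -mulrA ler_pM2l//.
  have -> : `|s| * (1 + 2 / r) = `|s| + `|s| / (r / 2).
    by field; rewrite gt_eqF.
  by rewrite addrC lerD2l ler_pdivlMr ?divr_gt0// mul1r.
apply: (@le_trans _ _ (c2 * (1 + `|s|))).
  by rewrite ler_wpM2r// ge_min lexx orbT.
rewrite (@le_trans _ _ (r / 2))//.
  by rewrite /c2 mulrAC ler_pdivrMr// ler_pM2l ?divr_gt0// lerD2l ltW.
rewrite le_max; apply/orP; left.
rewrite -(@ler_pXn2r _ 2)// ?nnegrE ?arc_height_ge0 ?divr_ge0 ?(ltW r0)//.
rewrite sqr_sqrtr// le_max; apply/orP; left.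
have : `|s| ^+ 2 <= (r / 2) ^+ 2.
  by rewrite ler_pXn2r ?nnegrE// ?divr_ge0 ?(ltW r0)// ltW.
rewrite real_normK ?num_real//; have := sqr_ge0 (r / 2).
have : r ^+ 2 = 4 * (r / 2) ^+ 2 by field.
lra.
Qed.

(** The straight parts leave the clearance [g]. At the arc, of abscissa [a], either
    [Re lam >= a + 1], or [Re lam + a <= 2 * r + 1] divides [(Re lam - a) * (Re lam + a) >= rho ^+ 2
    - r ^+ 2]. *)
Lemma graph_gap lam (rho g : R) : 0 < g -> r < rho -> rho <= absC lam ->
  g <= Re lam - k0 * `|Im lam| ->
  g <= Re lam - (iota + k1 * `|Im lam|) ->
  Num.min g (Num.min 1 ((rho ^+ 2 - r ^+ 2) / (2 * r + 1))) <=
    Re lam - graph_height (Im lam).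
Proof.
move=> g0 rrho hrho h1 h2; set y := Im lam in h1 h2 *.
set x := Re lam in h1 h2 *.
have r21 : 0 < 2 * r + 1 by rewrite addr_gt0// mulr_gt0.
have ky : 0 <= k0 * `|y| by rewrite mulr_ge0// ltW.
have x0 : 0 < x by lra.
have [h|h] := leP (arc_height y) (iota + k1 * `|y|).
  by rewrite /graph_height (max_idPr h) ge_min h2.
rewrite /graph_height (max_idPl (ltW h)) ge_min; apply/orP.
have [h3|h3] := leP (r ^+ 2 - y ^+ 2) (k0 ^+ 2 * y ^+ 2).
  left; rewrite /arc_height (max_idPr h3) -exprMn sqrtr_sqr normrM.
  by rewrite (gtr0_norm k00).
right; set a := arc_height y; have a0 : 0 <= a := arc_height_ge0 y.
have a2 : a ^+ 2 = r ^+ 2 - y ^+ 2 by rewrite sqr_sqrtr// (max_idPl (ltW h3)).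
have hl : rho ^+ 2 <= x ^+ 2 + y ^+ 2.
  by rewrite -absC_sqr ler_pXn2r ?nnegrE ?absC_ge0// ltW// (lt_trans r0).
have xa : rho ^+ 2 - r ^+ 2 <= (x - a) * (x + a) by move: a2 hl; nra.
have ar : a <= r.
  rewrite -(@ler_pXn2r _ 2)// ?nnegrE ?(ltW r0)// a2.
  by rewrite gerBl sqr_ge0.
rewrite ge_min; have [h4|h4] := leP (a + 1) x.
  by apply/orP; left; lra.
apply/orP; right; rewrite ler_pdivrMr// (le_trans xa)//.
have h5 : 0 <= x - a.
  rewrite -(pmulr_lge0 _ (_ : 0 < x + a)); last by lra.
  by rewrite (le_trans _ xa)// subr_ge0 ler_pXn2r ?nnegrE ?(ltW r0)// ltW// (lt_trans r0).
by rewrite ler_wpM2l//; lra.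
Qed.

(** The Lipschitz constant of the graph turns horizontal clearance into distance. *)
Lemma graph_distance lam (g : R) s :
  g <= Re lam - graph_height (Im lam) ->
  g / (1 + Lip) <= absC (lam - graph_path s).
Proof.
have L1 : 0 < 1 + Lip by have := Lip0; lra.
move=> hg; rewrite ler_pdivrMr//.
have h1 := Re_le_absC (lam - graph_path s).
have h2 := Im_le_absC (lam - graph_path s).
have h3 := graph_height_lipschitz s (Im lam).
move: h1 h2; rewrite ReD ImD ReN ImN /= => h1 h2.
have h4 : Lip * `|s - Im lam| <= Lip * absC (lam - graph_path s).
  by rewrite ler_wpM2l ?(ltW Lip0)// distrC.
move: h1 h3; rewrite !ler_norml => /andP[_ h1] /andP[h3 h5].
lra.
Qed.

End ContourGraph.

(** * The scalar Cauchy formula on the contour, uniformly in the pole *)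

Section GraphIntegral.
Variables (R : realType) (r k0 k1 iota alpha psi : R).
Hypotheses (r0 : 0 < r) (k00 : 0 < k0) (k10 : 0 < k1) (iota0 : iota <= 0).
Hypotheses (alpha1 : 1 <= alpha) (psi0 : 0 < psi) (psi_lt : psi < pi / 2).
Hypotheses (alpha_psi : alpha * psi < pi / 2) (k1_psi : 1 < k1 * tan psi).
Implicit Types (s t y : R) (z lam : R[i]).

(** Since the vertex [iota] may be negative, the region need not lie in the sector of half-angle
    [psi] near 0; it does so far out because [k1 * tan psi > 1]. The remaining bounded part is
    estimated crudely. *)
Lemma region_decay t n : 0 < t -> exists2 K : R, 0 <= K &
  forall z, 0 < Re z -> k0 * `|Im z| <= Re z ->
    iota + k1 * `|Im z| <= Re z ->
    absC (exp_pow alpha t z) * absC z ^+ n.+1 <= K.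
Proof.
move=> t0; have [K K0 HK] := exp_pow_sector_decay n alpha1 t0 (ltW psi0) alpha_psi.
pose d := k1 * tan psi - 1; have d0 : 0 < d by rewrite subr_gt0.
(* For [absC z >= S], the bound [k0 * absC z <= (1 + k0) * Re z] gives [- iota <= d * Re z], so the
   shift of the vertex is absorbed by the surplus [d] of the slope. *)
pose S := - iota * (1 + k0) / (d * k0).
have S0 : 0 <= S.
  by apply: divr_ge0; apply: mulr_ge0; move: k00 d0 iota0; lra.
exists (K + expR (t * S `^ alpha) * S ^+ n.+1).
  by rewrite addr_ge0// mulr_ge0 ?expR_ge0// exprn_ge0.
move=> z z0 h0 h1; have zn : z != 0 by apply: contraTneq z0 => ->; rewrite ltxx.
have [h|h] := leP S (absC z).
  rewrite ler_wpDr// ?mulr_ge0 ?expR_ge0 ?exprn_ge0//.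
  apply: HK => //; apply: norm_argC_le_tan => //; first by rewrite psi0.
  have k01 : 0 < 1 + k0 by rewrite addr_gt0.
  have e1 : k0 * absC z <= (1 + k0) * Re z.
    have := absC_le z; rewrite (gtr0_norm z0) => a1.
    have : k0 * absC z <= k0 * (Re z + `|Im z|) by rewrite ler_pM2l.
    lra.
  have e2 : - iota <= d * Re z.
    have E : - iota * (1 + k0) = d * (k0 * S).
      by rewrite /S; field; rewrite !gt_eqF.
    rewrite -(ler_pM2r k01) E -mulrA ler_pM2l// [_ * (1 + k0)]mulrC.
    by rewrite (le_trans _ e1)// ler_pM2l.
  rewrite -(ler_pM2l k10); move: e2 h1; rewrite /d; nra.
rewrite ler_wpDl//; apply: ler_pM.
- exact: absC_ge0.
- by rewrite exprn_ge0 ?absC_ge0.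
- rewrite (le_trans (absC_exp_pow_le _ (ltW t0) zn))// ler_expR ler_pM2l//.
  apply: ge0_ler_powR; [exact: le_trans ler01 alpha1|exact: absC_ge0| |exact: ltW].
  by rewrite nnegrE.
- by rewrite ler_pXn2r ?nnegrE ?absC_ge0// ltW.
Qed.

(** An increasing function with derivative [1 / (1 + |s|)^2]. As it is bounded, integrals dominated
    by its increments are bounded over all intervals and small far out. *)
Definition bounded_ramp s : R := s / (1 + `|s|).

Lemma bounded_ramp_norm s : `|bounded_ramp s| <= 1.
Proof.
have h : 0 < 1 + `|s| by rewrite ltr_pwDl.
by rewrite normrM normfV (gtr0_norm h) ler_pdivrMr// mul1r lerDr.
Qed.

(** Across a cell shorter than 1, [1 + |.|] varies by at most a factor 2 on each side of [m], whence
    the 4. If the cell contains 0 in its interior, both halves are compared with 0 separately. *)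
Lemma bounded_ramp_increment s m u : s <= m -> m <= u -> u - s < 1 ->
  (u - s) / (1 + `|m|) ^+ 2 <= 4 * (bounded_ramp u - bounded_ramp s).
Proof.
move=> sm mu us; have us0 : 0 <= u - s by lra.
have m1 : 0 < 1 + `|m| by rewrite ltr_pwDl.
have s1 : 0 < 1 + `|s| by rewrite ltr_pwDl.
have u1 : 0 < 1 + `|u| by rewrite ltr_pwDl.
have same : (0 <= s \/ u <= 0) ->
   bounded_ramp u - bounded_ramp s = (u - s) / ((1 + `|u|) * (1 + `|s|)).
  case=> h; rewrite /bounded_ramp.
    have u0 : 0 <= u by lra.
    rewrite !ger0_norm// in s1 u1 *.
    by field; rewrite !gt_eqF.
  have s0 : s <= 0 by lra.
  rewrite !ler0_norm// in s1 u1 *.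
  by field; rewrite !gt_eqF.
have prod : (1 + `|u|) * (1 + `|s|) <= 4 * (1 + `|m|) ^+ 2.
  have a1 : 1 + `|u| <= 2 * (1 + `|m|).
    have -> : u = m + (u - m) by ring.
    have := ler_normD m (u - m); rewrite (ger0_norm (_ : 0 <= u - m)); last by lra.
    have := normr_ge0 m; lra.
  have a2 : 1 + `|s| <= 2 * (1 + `|m|).
    have -> : s = m - (m - s) by ring.
    have := ler_normB m (m - s); rewrite (ger0_norm (_ : 0 <= m - s)); last by lra.
    have := normr_ge0 m; lra.
  have -> : 4 * (1 + `|m|) ^+ 2 = (2 * (1 + `|m|)) * (2 * (1 + `|m|)) by ring.
  by rewrite ler_pM// ltW.
have samele : (0 <= s \/ u <= 0) ->
    (u - s) / (1 + `|m|) ^+ 2 <= 4 * (bounded_ramp u - bounded_ramp s).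
  move=> h; rewrite same// mulrCA ler_wpM2l//.
  rewrite ler_pdivlMr ?mulr_gt0// mulrC ler_pdivrMr ?exprn_gt0//.
have [h|h] := leP 0 s; first by apply: samele; left.
have [h'|h'] := leP u 0; first by apply: samele; right.
apply: (@le_trans _ _ (u - s)).
  rewrite ler_pdivrMr ?exprn_gt0// ler_peMr//.
  by rewrite expr_ge1//; have := normr_ge0 m; lra.
have -> : bounded_ramp u = u / (1 + u) by rewrite /bounded_ramp gtr0_norm.
have -> : bounded_ramp s = s / (1 - s) by rewrite /bounded_ramp ltr0_norm.
have b1 : u / 2 <= u / (1 + u).
  by rewrite ler_wpM2l ?(ltW h')// lef_pV2 ?posrE//; lra.
have b2 : (- s) / 2 <= (- s) / (1 - s).
  by rewrite ler_wpM2l ?oppr_ge0 ?(ltW h)// lef_pV2 ?posrE//; lra.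
move: b2; rewrite !mulNr; lra.
Qed.

Let p := graph_path r k0 k1 iota.

(** [B] is chosen before [lam]: it depends on the pole only through the clearance [g]. This
    uniformity is what later makes the estimates summable over the eigenspaces. *)
Lemma graph_cauchy t (g : R) : 0 < t -> 0 < g -> exists2 B : R, 0 <= B &
  forall lam, 0 < Re lam ->
    g <= Re lam - graph_height r k0 k1 iota (Im lam) ->
  exists W : R[i] -> R[i],
   [/\ forall s, strict_deriv W (p s) (exp_pow alpha t (p s) / (lam - p s)),
       forall s m u, s <= m -> m <= u -> u - s < 1 ->
         absC (p u - p s) * absC (exp_pow alpha t (p m) / (lam - p m)) <=
         B * (bounded_ramp u - bounded_ramp s) &
       forall eta : R, 0 < eta -> exists2 S : R, 0 <= S & forall a b : R,
         a < - S -> S < b ->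
         absC (W (p b) - W (p a) - (0 +i* (2 * pi)) * exp_pow alpha t lam)
           <= eta].
Proof.
move=> t0 g0; have [K K0 HK] := region_decay 1 t0.
pose Lip := (1 + k0 ^+ 2) / k0 + k1.
have Lip0 : 0 < Lip by rewrite addr_gt0// divr_gt0// ltr_wpDr ?sqr_ge0.
pose del := g / (1 + Lip).
have del0 : 0 < del by rewrite divr_gt0// addr_gt0.
have [c c0 Hc] := graph_height_linear k1 iota r0 k00.
have lipp := @graph_path_lipschitz R r k0 k1 iota k00 k10.
pose B := (Lip + 1) * (K / c ^+ 2 / del) * 4.
have B0 : 0 <= B.
  by rewrite !mulr_ge0 ?invr_ge0 ?sqr_ge0 ?(ltW del0)// addr_ge0// ltW.
exists B => // lam lam0 hlam.
have [W [HW1 HW2]] := cauchy_kernel_primitive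
  (fun z => @strict_deriv_exp_pow R alpha t z) lam0.
have hp0 s : 0 < graph_height r k0 k1 iota s.
  by rewrite (lt_le_trans _ (Hc s))// mulr_gt0// ltr_pwDl.
have dist s : del <= absC (lam - p s) by apply: graph_distance.
have dW s : strict_deriv W (p s) (exp_pow alpha t (p s) / (lam - p s)).
  apply: HW1 => //= -[E h].
  by move: hlam; rewrite -E; have := g0; lra.
have bW s m u : s <= m -> m <= u -> u - s < 1 ->
   absC (p u - p s) * absC (exp_pow alpha t (p m) / (lam - p m)) <=
   B * (bounded_ramp u - bounded_ramp s).
  move=> sm mu us; have us0 : 0 <= u - s by lra.
  have m1 : 0 < 1 + `|m| by rewrite ltr_pwDl.
  have b1 : absC (exp_pow alpha t (p m) / (lam - p m)) <=
      K / c ^+ 2 / del / (1 + `|m|) ^+ 2.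
    rewrite absCM absCV.
    have -> : K / c ^+ 2 / del / (1 + `|m|) ^+ 2 = K / (c * (1 + `|m|)) ^+ 2 / del.
      by field; rewrite !gt_eqF.
    apply: ler_pM; rewrite ?invr_ge0 ?absC_ge0//.
      rewrite ler_pdivlMr ?exprn_gt0 ?mulr_gt0//.
      apply: (le_trans _ (HK (p m) (hp0 m) (graph_height_ge_line _ _ _ k00 _)
        (graph_height_ge_line1 _ _ _ _ _))).
      rewrite ler_wpM2l ?absC_ge0// ler_pXn2r ?nnegrE ?absC_ge0//; last first.
        by rewrite mulr_ge0 ?(ltW c0)// ltW.
      rewrite (le_trans (Hc m))// (le_trans _ (Re_le_absC _))//.
      exact: ler_norm.
    by rewrite lef_pV2 ?posrE ?(lt_le_trans del0).
  apply: (@le_trans _ _ ((Lip + 1) * (u - s) * (K / c ^+ 2 / del / (1 + `|m|) ^+ 2))).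
    apply: ler_pM; rewrite ?absC_ge0//.
    by rewrite (le_trans (lipp _ _))// ger0_norm.
  have := bounded_ramp_increment sm mu us.
  set q := (Lip + 1) * (K / c ^+ 2 / del).
  have -> : (Lip + 1) * (u - s) * (K / c ^+ 2 / del / (1 + `|m|) ^+ 2) =
     q * ((u - s) / (1 + `|m|) ^+ 2) by rewrite /q; ring.
  rewrite /B -/q -mulrA => h; rewrite ler_wpM2l//.
  by rewrite !mulr_ge0 ?invr_ge0 ?sqr_ge0 ?(ltW del0)// addr_ge0// ltW.
exists W; split=> // eta eta0.
have incr a b : a <= b ->
    absC (W (p b) - W (p a)) <= B * (bounded_ramp b - bounded_ramp a).
  move=> ab; rewrite mulrBr.
  apply: (@path_increment_bound R p (Lip + 1) a b W
    (fun z => exp_pow alpha t z / (lam - z)) (fun s => B * bounded_ramp s)) => //.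
  by move=> s u m _ sm mu _ us; rewrite -mulrBr; exact: bW.
pose Q := 2 * B + 2 * (K / c ^+ 2).
have K1 : 0 <= K / c ^+ 2 by rewrite divr_ge0// sqr_ge0.
have Q0 : 0 <= Q by rewrite /Q; lra.
(* The contour beyond the ordinates [S] and [- S] lies past the pole, its abscissa at [S] exceeds
   [Re lam] by 1, and the three error terms total at most [Q / (1 + S) <= eta]. *)
pose S := `|Im lam| + 1 + (Re lam + 1) / c + Q / eta.
have S1 : 0 <= (Re lam + 1) / c by rewrite divr_ge0 ?(ltW c0)//; lra.
have S2 : 0 <= Q / eta by rewrite divr_ge0// ltW.
have S3 : `|Im lam| < S.
  rewrite /S -!addrA ltrDl; lra.
have S0 : 0 < S by rewrite (le_lt_trans _ S3).
exists S => [|a b ha hb]; first exact: ltW.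
have S10 : 0 < 1 + S by lra.
have S4 : Re lam + 1 <= c * (1 + S).
  rewrite -ler_pdivrMl// mulrC; move: (normr_ge0 (Im lam)).
  by rewrite /S; lra.
have S5 : Q / (1 + S) <= eta.
  rewrite (ler_pdivrMr _ _ S10) mulrC -(ler_pdivrMr _ _ eta0).
  move: (normr_ge0 (Im lam)); rewrite /S; lra.
pose X := graph_height r k0 k1 iota S.
have X1 : c * (1 + S) <= X by have := Hc S; rewrite (gtr0_norm S0).
have X2 : Re lam + 1 <= X := le_trans S4 X1.
have EpS : p S = X +i* S by [].
have EpNS : p (- S) = X +i* (- S).
  by rewrite /p /graph_path /graph_height /arc_height normrN sqrrN.
(* The height is even, so [p S] and [p (- S)] are joined by a vertical segment. It passes to the
   right of the pole, inside the region of decay: the quadratic decay beats its length [2 * S]. *)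
have mid : absC (W (p S) - W (p (- S)) - (0 +i* (2 * pi)) * exp_pow alpha t lam)
    <= K / (c * (1 + S)) ^+ 2 * (S - - S).
  rewrite EpS EpNS; apply: HW2; first by lra.
    by rewrite -ltr_norml.
  move=> y hy; have {}hy : `|y| <= S by rewrite ler_norml.
  have Xge : 0 <= X by exact: graph_height_ge0.
  have zre : X <= absC (X +i* y) by have := Re_le_absC (X +i* y); rewrite /= ger0_norm.
  have den : 1 <= absC (lam - (X +i* y)).
    rewrite absC_sub (le_trans _ (Re_le_absC _))// ReD ReN /=.
    rewrite (le_trans _ (ler_norm _))//; lra.
  rewrite absCM absCV -[leRHS]mulr1; apply: ler_pM.
  - exact: absC_ge0.
  - by rewrite invr_ge0 absC_ge0.
  - rewrite ler_pdivlMr ?exprn_gt0 ?mulr_gt0//.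
    apply: (@le_trans _ _ (absC (exp_pow alpha t (X +i* y)) * absC (X +i* y) ^+ 2)).
      rewrite ler_wpM2l ?absC_ge0// ler_pXn2r ?nnegrE ?absC_ge0//; last first.
        by rewrite mulr_ge0 ?(ltW c0) ?(ltW S10).
      exact: le_trans zre.
    apply: HK => /=.
    + exact: hp0.
    + rewrite (@le_trans _ _ (k0 * `|S|))//.
        by rewrite ler_pM2l// (gtr0_norm S0).
      exact: graph_height_ge_line.
    + rewrite (@le_trans _ _ (iota + k1 * `|S|))//.
        by rewrite lerD2l ler_pM2l// (gtr0_norm S0).
      exact: graph_height_ge_line1.
  - by rewrite invf_le1// (lt_le_trans ltr01 den).
have -> : W (p b) - W (p a) - (0 +i* (2 * pi)) * exp_pow alpha t lam =
  (W (p b) - W (p S)) + (W (p S) - W (p (- S)) - (0 +i* (2 * pi)) * exp_pow alpha t lam)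
  + (W (p (- S)) - W (p a)) by ring.
have h1 := incr _ _ (ltW hb); have h2 := incr _ _ (ltW ha).
have r1 : bounded_ramp b - bounded_ramp S <= 1 / (1 + S).
  have -> : 1 / (1 + S) = 1 - bounded_ramp S.
    rewrite /bounded_ramp (gtr0_norm S0); field; rewrite gt_eqF//; lra.
  have := bounded_ramp_norm b; rewrite ler_norml; lra.
have r2 : bounded_ramp (- S) - bounded_ramp a <= 1 / (1 + S).
  have -> : 1 / (1 + S) = 1 + bounded_ramp (- S).
    rewrite /bounded_ramp normrN (gtr0_norm S0); field; rewrite gt_eqF//; lra.
  have := bounded_ramp_norm a; rewrite ler_norml; lra.
have h3 : K / (c * (1 + S)) ^+ 2 * (S - - S) <= 2 * (K / c ^+ 2) * (1 / (1 + S)).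
  have -> : K / (c * (1 + S)) ^+ 2 * (S - - S) =
    2 * (K / c ^+ 2) * (1 / (1 + S)) * (S / (1 + S)).
    by field; rewrite !gt_eqF.
  rewrite -[leRHS]mulr1 ler_wpM2l//.
    by rewrite !mulr_ge0 ?invr_ge0 ?sqr_ge0// ltW.
  by rewrite ler_pdivrMr// mul1r lerDr.
have {}r1 := ler_wpM2l B0 r1; have {}r2 := ler_wpM2l B0 r2.
rewrite (le_trans (absCD _ _))// (le_trans (lerD (absCD _ _) (lexx _)))//.
apply: le_trans S5; rewrite /Q.
have -> : (2 * B + 2 * (K / c ^+ 2)) / (1 + S) = B * (1 / (1 + S)) +
  2 * (K / c ^+ 2) * (1 / (1 + S)) + B * (1 / (1 + S)) by ring.
by rewrite lerD ?(le_trans h2)// lerD ?(le_trans h1)// (le_trans mid).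
Qed.

End GraphIntegral.

(** * Hilbert spaces and compact normal operators *)

Section NormedModuleReal.
Variables (R : realType) (V : normedModType R[i]).
Implicit Types (x y : V) (c : R[i]) (u : nat -> V).

Lemma rnormE x : `|x| = (rnorm x)%:C.
Proof. by rewrite /rnorm RRe_real// normr_real. Qed.

Lemma rnorm_ge0 x : 0 <= rnorm x.
Proof. by rewrite -lecR -rnormE normr_ge0. Qed.

Lemma rnorm0 : rnorm (0 : V) = 0.
Proof. by rewrite /rnorm normr0. Qed.

Lemma rnorm_eq0 x : (rnorm x == 0) = (x == 0).
Proof. by rewrite -(inj_eq (@complexI R)) -rnormE normr_eq0. Qed.

Lemma rnorm_gt0 x : (0 < rnorm x) = (x != 0).
Proof. by rewrite lt0r rnorm_ge0 andbT rnorm_eq0. Qed.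

Lemma rnormN x : rnorm (- x) = rnorm x.
Proof. by rewrite /rnorm normrN. Qed.

Lemma rnorm_sub x y : rnorm (x - y) = rnorm (y - x).
Proof. by rewrite /rnorm distrC. Qed.

Lemma rnormD x y : rnorm (x + y) <= rnorm x + rnorm y.
Proof. by rewrite -lecR rmorphD/= -!rnormE ler_normD. Qed.

Lemma rnormB x y : rnorm (x - y) <= rnorm x + rnorm y.
Proof. by rewrite -(rnormN y) rnormD. Qed.

Lemma rnorm_lerB x y : rnorm x - rnorm y <= rnorm (x - y).
Proof. by rewrite lerBlDr (le_trans _ (rnormD _ _))// subrK. Qed.

Lemma rnormZ c x : rnorm (c *: x) = absC c * rnorm x.
Proof. by apply: (@complexI R); rewrite rmorphM/= -normCE -!rnormE normrZ. Qed.

Lemma cvg_rnormP u x : u @ \oo --> x <->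
  forall eps : R, 0 < eps -> exists N : nat, forall n : nat, (N <= n)%N ->
    rnorm (u n - x) < eps.
Proof.
split=> [/cvgrPdist_lt H eps eps0|H].
  have /H[N _ HN] : 0 < eps%:C by rewrite ltcR.
  by exists N => n nN; rewrite rnorm_sub -ltcR -rnormE; exact: HN.
apply/cvgrPdist_lt => -[e1 e2]; rewrite ltcE/= => /andP[/eqP -> e10].
have [N HN] := H _ e10; exists N => // n /= nN.
by rewrite rnormE ltcR rnorm_sub; exact: HN.
Qed.

Lemma nbhs_rnormP x (B : set V) : nbhs x B <->
  exists2 eps : R, 0 < eps & forall y, rnorm (y - x) < eps -> B y.
Proof.
split=> [/nbhs_ballP[[e1 e2]]|[eps eps0 H]].
  rewrite /= ltcE/= => /andP[/eqP -> e10] H; exists e1 => // y yx.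
  by apply: H; rewrite -ball_normE /= rnormE ltcR rnorm_sub.
apply/nbhs_ballP; exists eps%:C; first by rewrite /= ltcR.
by move=> y; rewrite -ball_normE /= rnormE ltcR rnorm_sub => /H.
Qed.

Lemma closure_rnormP (B : set V) x : closure B x <->
  forall eps : R, 0 < eps -> exists2 y, B y & rnorm (y - x) < eps.
Proof.
split=> [H eps eps0|H C /nbhs_rnormP[eps eps0 HC]].
  have /H[y [By yx]] : nbhs x [set y | rnorm (y - x) < eps].
    by apply/nbhs_rnormP; exists eps.
  by exists y.
by have [y By yx] := H _ eps0; exists y; split=> //; exact: HC.
Qed.

End NormedModuleReal.

Lemma eq0_of_le_eps (R : realType) (a K : R) : 0 <= a -> 0 <= K ->
  (forall eps : R, 0 < eps -> a <= K * eps) -> a = 0.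
Proof.
move=> a0 K0 H; apply/eqP; rewrite eq_le a0 andbT; apply/ler_addgt0Pr => e e0.
have K1 : 0 < K + 1 by rewrite ltr_wpDl.
rewrite add0r (le_trans (H _ (divr_gt0 e0 K1)))// mulrA ler_pdivrMr// mulrC.
by rewrite ler_pM2l// lerDl.
Qed.

Lemma conjc_div (R : rcfType) (a b : R[i]) : conjc (a / b) = conjc a / conjc b.
Proof. exact: fmorph_div. Qed.

Section HilbertSpace.
Variables (R : realType) (H : completeNormedModType R[i]).
Variable ip : {dot H for @conjc R}.
Hypothesis hip : hilbert ip.
Implicit Types (x y z v w : H) (c : R[i]) (V : set H) (T G A : H -> H).

Lemma ipDl x y z : ip (x + y) z = ip x z + ip y z.
Proof. by rewrite linearDl. Qed.
Lemma ipBl x y z : ip (x - y) z = ip x z - ip y z.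
Proof. by rewrite linearBl. Qed.
Lemma ip0l z : ip 0 z = 0.
Proof. by rewrite linear0l. Qed.
Lemma ipZl c x z : ip (c *: x) z = c * ip x z.
Proof. by rewrite linearZl_LR. Qed.
Lemma ipDr x y z : ip x (y + z) = ip x y + ip x z.
Proof. by rewrite linearDr. Qed.
Lemma ipBr x y z : ip x (y - z) = ip x y - ip x z.
Proof. by rewrite linearBr. Qed.
Lemma ipNr x z : ip x (- z) = - ip x z.
Proof. by rewrite linearNr. Qed.
Lemma ip0r x : ip x 0 = 0.
Proof. by rewrite linear0r. Qed.
Lemma ipZr c x z : ip x (c *: z) = conjc c * ip x z.
Proof. by rewrite linearZr. Qed.
Lemma ipC x y : ip x y = conjc (ip y x).
Proof. by rewrite hermC expr0 mul1r. Qed.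

Lemma ip_eq0C x y : ip x y = 0 -> ip y x = 0.
Proof. by rewrite [ip y x]ipC => ->; rewrite conjc0. Qed.

Lemma ip_sqr x : ip x x = (rnorm x ^+ 2)%:C.
Proof. by rewrite hip rnormE rmorphXn. Qed.

Lemma rnorm_sqr x : rnorm x ^+ 2 = Re (ip x x).
Proof. by rewrite ip_sqr. Qed.

Lemma rnormD_sqr x y :
  rnorm (x + y) ^+ 2 = rnorm x ^+ 2 + rnorm y ^+ 2 + 2 * Re (ip x y).
Proof.
rewrite !rnorm_sqr ipDl !ipDr !ReD [ip y x]ipC.
by rewrite (_ : Re (conjc _) = Re (ip x y)); [ring|case: (ip x y)].
Qed.

Lemma rnormB_sqr x y :
  rnorm (x - y) ^+ 2 = rnorm x ^+ 2 + rnorm y ^+ 2 - 2 * Re (ip x y).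
Proof.
have := rnormD_sqr x (- y).
by rewrite rnormN ipNr ReN => ->; ring.
Qed.

Lemma pythagoras x y : ip x y = 0 -> rnorm (x + y) ^+ 2 = rnorm x ^+ 2 + rnorm y ^+ 2.
Proof. by move=> h; rewrite rnormD_sqr h /= mulr0 addr0. Qed.

Lemma parallelogram x y :
  rnorm (x + y) ^+ 2 + rnorm (x - y) ^+ 2 = 2 * rnorm x ^+ 2 + 2 * rnorm y ^+ 2.
Proof. by rewrite rnormD_sqr rnormB_sqr; ring. Qed.

(** Used twice: nonnegativity gives the Cauchy-Schwarz inequality, and minimality of a distance
    gives orthogonality. *)
Lemma line_distance_sqr x y : y != 0 ->
  rnorm (x - (ip x y / ip y y) *: y) ^+ 2 =
    rnorm x ^+ 2 - absC (ip x y) ^+ 2 / rnorm y ^+ 2.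
Proof.
move=> y0; have n0 : 0 < rnorm y by rewrite rnorm_gt0.
rewrite rnormB_sqr rnormZ ipZr ip_sqr conjc_div conjc_real.
have -> : conjc (ip x y) / (rnorm y ^+ 2)%:C * ip x y =
   (absC (ip x y) ^+ 2 / rnorm y ^+ 2)%:C.
  rewrite mulrAC fmorph_div; congr (_ / _).
  by rewrite [RHS]rmorphXn/= -normCE sqr_normc mulrC.
rewrite /= absCM absCV absC_real ger0_norm ?sqr_ge0//.
by field; rewrite gt_eqF.
Qed.

Lemma cauchy_schwarz x y : absC (ip x y) <= rnorm x * rnorm y.
Proof.
have [->|y0] := eqVneq y 0; first by rewrite ip0r rnorm0 mulr0 absC0.
have n0 : 0 < rnorm y by rewrite rnorm_gt0.
have : 0 <= rnorm (x - (ip x y / ip y y) *: y) ^+ 2 by exact: sqr_ge0.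
rewrite line_distance_sqr// subr_ge0 ler_pdivrMr ?exprn_gt0// -exprMn.
by rewrite ler_pXn2r ?nnegrE ?absC_ge0// mulr_ge0// rnorm_ge0.
Qed.

Lemma closed_rnorm V x : closed V ->
  (forall eps : R, 0 < eps -> exists2 v, V v & rnorm (v - x) < eps) -> V x.
Proof. by move=> cV h; apply: cV; apply/closure_rnormP. Qed.

Lemma subspaceZ V c x : subspace V -> V x -> V (c *: x).
Proof. by move=> [V0 VD] Vx; rewrite -[_ *: _]addr0; exact: VD. Qed.

Lemma subspaceD V x y : subspace V -> V x -> V y -> V (x + y).
Proof. by move=> [V0 VD] Vx Vy; rewrite -[x]scale1r; exact: VD. Qed.

Lemma subspaceB V x y : subspace V -> V x -> V y -> V (x - y).
Proof.
by move=> hV Vx Vy; apply: subspaceD => //; rewrite -scaleN1r; exact: subspaceZ.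
Qed.

Lemma orthogonal_projection V x : closed V -> subspace V ->
  exists2 v, V v & forall w, V w -> ip (x - v) w = 0.
Proof.
move=> cV sV; pose S := [set a : R | exists2 v, V v & a = rnorm (x - v) ^+ 2].
have V0 : V 0 by case: sV.
have S0 : S !=set0 by exists (rnorm (x - 0) ^+ 2); exists 0.
have Slb : has_lbound S by exists 0 => a [v _ ->]; exact: sqr_ge0.
have iS : has_inf S by [].
pose d := inf S.
have dle v : V v -> d <= rnorm (x - v) ^+ 2.
  by move=> Vv; apply: ge_inf => //; exists v.
(* The midpoint of [v] and [w] lies in [V], so the parallelogram law makes every minimising sequence
   Cauchy. *)
have close v w (e1 e2 : R) : V v -> V w -> rnorm (x - v) ^+ 2 <= d + e1 ->
    rnorm (x - w) ^+ 2 <= d + e2 -> rnorm (v - w) ^+ 2 <= 2 * e1 + 2 * e2.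
  move=> Vv Vw h1 h2; have := parallelogram (x - v) (x - w).
  have -> : x - v - (x - w) = w - v by rewrite opprB addrC addrA subrK.
  have -> : x - v + (x - w) = 2%:R *: (x - 2%:R^-1 *: (v + w)).
    rewrite scalerBr scalerA divff ?pnatr_eq0// scale1r scaler_nat mulr2n.
    by rewrite opprD addrACA.
  rewrite rnormZ absC_nat exprMn [rnorm (w - v)]rnorm_sub.
  have := dle _ (subspaceZ 2%:R^-1 sV (subspaceD sV Vv Vw)).
  move: h1 h2; lra.
have ex n : exists v, V v /\ rnorm (x - v) ^+ 2 <= d + n.+1%:R^-1.
  have n0 : 0 < n.+1%:R^-1 :> R by rewrite invr_gt0.
  have [a [v Vv ->] h] := inf_adherent n0 iS.
  by exists v; split=> //; exact: ltW.
have [u Hu] := choice ex.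
have cau : cvgn u.
  apply: cauchy_seq_cvg => -[e1 e2]; rewrite ltcE/= => /andP[/eqP -> e10].
  have e4 : 0 < e1 ^+ 2 / 4 by rewrite divr_gt0// exprn_gt0.
  exists (Num.truncn (e1 ^+ 2 / 4)^-1).+1 => n m nN mN.
  have inv k : (Num.truncn (e1 ^+ 2 / 4)^-1 < k)%N -> k.+1%:R^-1 < e1 ^+ 2 / 4.
    move=> hk; rewrite invf_plt ?posrE//.
    by rewrite (lt_trans (truncnS_gt _))// ltr_nat.
  have := close _ _ _ _ (Hu n).1 (Hu m).1 (Hu n).2 (Hu m).2 => h.
  rewrite rnormE ltcR -(@ltr_pXn2r _ 2) ?nnegrE ?rnorm_ge0 ?(ltW e10)//.
  have := inv n nN; have := inv m mN; move: h.
  by move: (n.+1%:R^-1 : R) (m.+1%:R^-1 : R) => a b; lra.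
have /cvg_rnormP lim := cau; set v := limn u in lim.
have Vv : V v.
  apply: closed_rnorm => // eps eps0; have [N HN] := lim _ eps0.
  by exists (u N); [exact: (Hu N).1|exact: HN].
have vd : rnorm (x - v) ^+ 2 <= d.
  apply/ler_addgt0Pr => e e0.
  (* [sqrt d + eps] dominates the distance for every [eps] *)
  have key (eps : R) : 0 < eps -> rnorm (x - v) <= Num.sqrt (d + eps) + eps.
    move=> eps0; have [N HN] := lim _ eps0.
    pose n := maxn N (Num.truncn eps^-1).
    have nN : (N <= n)%N by rewrite leq_max leqnn.
    have ne : n.+1%:R^-1 <= eps.
      rewrite invf_ple ?posrE// (le_trans (ltW (truncnS_gt _)))// ler_nat ltnS.
      by rewrite leq_max leqnn orbT.
    have -> : x - v = (x - u n) + (u n - v) by rewrite addrA subrK.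
    rewrite (le_trans (rnormD _ _))// lerD ?(ltW (HN _ nN))//.
    rewrite -[leLHS]ger0_norm ?rnorm_ge0// -sqrtr_sqr ler_wsqrtr//.
    by rewrite (le_trans (Hu n).2)// lerD2l.
  have d0 : 0 <= d by apply: lb_le_inf => // a [w _ ->]; exact: sqr_ge0.
  have [eps [eps0 e1 e2]] : exists eps : R, [/\ 0 < eps, eps <= 1 &
      (2 * Num.sqrt (d + 1) + 2) * eps <= e].
    have c0 : 0 < 2 * Num.sqrt (d + 1) + 2 by rewrite ltr_wpDl// mulr_ge0// sqrtr_ge0.
    exists (Num.min 1 (e / (2 * Num.sqrt (d + 1) + 2))); split.
    - by rewrite lt_min ltr01 divr_gt0.
    - by rewrite ge_min lexx.
    - by rewrite -ler_pdivlMl// mulrC ge_min lexx orbT.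
  have k1 := key _ eps0; have s0 := sqrtr_ge0 (d + eps).
  have s1 : Num.sqrt (d + eps) <= Num.sqrt (d + 1) by rewrite ler_wsqrtr// lerD2l.
  have : rnorm (x - v) ^+ 2 <= (Num.sqrt (d + eps) + eps) ^+ 2.
    by rewrite ler_pXn2r ?nnegrE ?rnorm_ge0// addr_ge0// ltW.
  rewrite sqrrD sqr_sqrtr ?addr_ge0 ?(ltW eps0)// => /le_trans; apply.
  rewrite -mulr_natl; nra.
exists v => // w Vw; have [->|w0] := eqVneq w 0; first by rewrite ip0r.
have := dle _ (subspaceD sV Vv (subspaceZ (ip (x - v) w / ip w w) sV Vw)).
rewrite opprD addrA line_distance_sqr// => h.
have n0 : 0 < rnorm w ^+ 2 by rewrite exprn_gt0// rnorm_gt0.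
have : absC (ip (x - v) w) ^+ 2 / rnorm w ^+ 2 <= 0 by move: h vd; lra.
rewrite ler_pdivrMr// mul0r => h2; apply/eqP; rewrite -absC_eq0 -sqrf_eq0.
by rewrite eq_le h2 sqr_ge0.
Qed.

Lemma riesz_representation (f : H -> R[i]) (C : R) :
  (forall c x y, f (c *: x + y) = c * f x + f y) ->
  (forall x, absC (f x) <= C * rnorm x) -> exists z, forall x, f x = ip x z.
Proof.
move=> lf bf; have C0 : 0 <= `|C| by [].
have {}bf x : absC (f x) <= `|C| * rnorm x.
  by rewrite (le_trans (bf x))// ler_wpM2r ?rnorm_ge0// ler_norm.
have f0 : f 0 = 0.
  by apply/eqP; rewrite -absC_eq0 eq_le absC_ge0 (le_trans (bf 0))// rnorm0 mulr0.
have fB x y : f (x - y) = f x - f y.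
  by rewrite addrC -scaleN1r lf mulN1r addrC.
have [H0|] := pselect (forall x, f x = 0).
  by exists 0 => x; rewrite H0 ip0r.
move=> /existsNP[x0 /eqP fx0]; pose V := [set x | f x = 0].
have sV : subspace V.
  by split=> // c x y; rewrite /V /= lf => -> ->; rewrite mulr0 addr0.
have cV : closed V.
  move=> x /closure_rnormP h; apply/eqP; rewrite -absC_eq0; apply/eqP.
  apply: (@eq0_of_le_eps _ _ `|C|); rewrite ?absC_ge0// => eps eps0.
  have [y fy yx] := h _ eps0; rewrite -[f x]subr0 -fy -fB.
  by rewrite (le_trans (bf _))// ler_wpM2l// rnorm_sub ltW.
have [v Vv hv] := orthogonal_projection x0 cV sV.
pose u := x0 - v; have fu : f u = f x0 by rewrite /u fB Vv subr0.
have u0 : u != 0 by apply: contraNneq fx0 => E; rewrite -fu E f0.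
have nu : rnorm u ^+ 2 != 0 by rewrite sqrf_eq0 rnorm_eq0.
exists ((conjc (f u) / (rnorm u ^+ 2)%:C) *: u) => x.
have Vx : V (x - (f x / f u) *: u).
  by rewrite /V /= fB -[_ *: u]addr0 lf f0 addr0 divfK ?subrr// fu.
have : ip (x - (f x / f u) *: u) u = 0 by apply: ip_eq0C; exact: hv.
rewrite ipBl ipZl ip_sqr => /eqP; rewrite subr_eq0 => /eqP E.
rewrite ipZr conjc_div conjcK conjc_real E.
have nuC : (rnorm u ^+ 2)%:C != 0 :> R[i].
  by rewrite (_ : 0 = 0%:C)// (inj_eq (@complexI R)).
move: fx0; rewrite -fu; move: (f u) (_%:C) nuC => a b b0 a0.
by field; rewrite a0 b0.
Qed.

End HilbertSpace.

(** * Compact normal operators: totality of the eigenvectors *)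

Section CompactNormal.
Variables (R : realType) (H : completeNormedModType R[i]).
Variable ip : {dot H for @conjc R}.
Hypothesis hip : hilbert ip.
Implicit Types (x y z v w : H) (c : R[i]) (V : set H).

Definition bounded_map (T : H -> H) : Prop :=
  exists2 C : R, 0 <= C & forall x, rnorm (T x) <= C * rnorm x.

(** Compactness in terms of cluster points of the images: this is what a compact closure yields
    directly, and no subsequence has to be extracted. *)
Definition cluster_compact (T : H -> H) : Prop :=
  forall u : nat -> H, (forall n, rnorm (u n) <= 1) ->
  exists y, forall eps : R, 0 < eps -> forall N : nat, exists2 n : nat, (N <= n)%N &
    rnorm (T (u n) - y) < eps.

Definition invariant_subspace (T : H -> H) V : Prop := forall x, V x -> V (T x).

(** Near-maximisers [u n] of the norm of [T] on the unit ball of [V] almost satisfy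
    [T (T u) = B^2 u], and compactness yields a nonzero [q] with [T (T q) = B^2 q]. Factoring into
    [(T - B) (T + B)] leaves an eigenvector for [B] or [- B]. Compactness of [T] enters only through
    the factorisation [G \o A] on [V], so that it can hold on an eigenspace without holding
    globally. *)
Lemma symmetric_compact_eigenvector (A : H -> H) (T G : {linear H -> H}) V :
  cluster_compact A -> bounded_map T -> bounded_map G ->
  closed V -> subspace V -> invariant_subspace T V ->
  (forall x, V x -> T x = G (A x)) ->
  (forall x y, V x -> V y -> ip (T x) y = ip x (T y)) ->
  (exists2 x, V x & x != 0) ->
  exists x (b : R), [/\ V x, x != 0 & T x = b%:C *: x].
Proof.
move=> cA [CT CT0 bT] [CG CG0 bG] cV sV iV TE sym [x0 Vx0 x00].
pose S := [set a : R | exists2 x, V x /\ rnorm x <= 1 & a = rnorm (T x)].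
have V0 : V 0 by case: sV.
have S0 : S 0 by exists 0; rewrite ?linear0 ?rnorm0.
have Sub : has_ubound S.
  exists CT => a [x [Vx x1] ->]; rewrite (le_trans (bT x))//.
  by rewrite -[leRHS]mulr1 ler_wpM2l.
have sS : has_sup S by split=> //; exists 0.
pose B := sup S; have B0 : 0 <= B by apply: ub_le_sup.
have leB x : V x -> rnorm (T x) <= B * rnorm x.
  move=> Vx; have [->|xn] := eqVneq x 0; first by rewrite linear0 rnorm0 mulr0.
  have n0 : 0 < rnorm x by rewrite rnorm_gt0.
  have : S (rnorm (T ((rnorm x)^-1%:C *: x))).
    exists ((rnorm x)^-1%:C *: x) => //; split; first exact: subspaceZ.
    by rewrite rnormZ absC_real gtr0_norm ?invr_gt0// mulVf// gt_eqF.
  move=> /(ub_le_sup Sub); rewrite -/B linearZ rnormZ absC_real.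
  by rewrite gtr0_norm ?invr_gt0// ler_pdivrMl// mulrC.
have [BE|Bn] := eqVneq B 0.
  exists x0, 0; split=> //; rewrite scale0r; apply/eqP; rewrite -rnorm_eq0.
  by have := leB _ Vx0; rewrite BE mul0r eq_le rnorm_ge0 andbT.
have Bp : 0 < B by rewrite lt0r Bn.
have ex n : exists x, [/\ V x, rnorm x <= 1 & B - n.+1%:R^-1 <= rnorm (T x)].
  have n0 : 0 < n.+1%:R^-1 :> R by rewrite invr_gt0.
  have [a [x [Vx x1] ->] h] := sup_adherent n0 sS.
  by exists x; split=> //; exact: ltW.
have [u Hu] := choice ex.
have [y Hy] := cA u (fun n => let: And3 _ h _ := Hu n in h).
pose w := G y; pose q := T w.
have VTu n : V (T (u n)) by apply: iV; case: (Hu n).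
have Tw n : rnorm (T (u n) - w) <= CG * rnorm (A (u n) - y).
  by case: (Hu n) => Vu _ _; rewrite TE// -linearB bG.
have Vw : V w.
  apply: closed_rnorm => // eps eps0.
  have CG1 : 0 < CG + 1 by rewrite ltr_wpDl.
  have [n _ h] := Hy _ (divr_gt0 eps0 CG1) 0%N.
  exists (T (u n)) => //; rewrite (le_lt_trans (Tw n))//.
  rewrite (@le_lt_trans _ _ ((CG + 1) * rnorm (A (u n) - y)))//.
    by rewrite ler_wpM2r ?rnorm_ge0// lerDl.
  by rewrite mulrC -ltr_pdivlMr.
have Vq : V q by exact: iV.
(* By symmetry the cross term is [- 2 B^2 |T u|^2]; the sum is at most [B^2 (B^2 - |T u|^2)], small
   for a near-maximiser. *)
have sq n : rnorm (T (T (u n)) - (B ^+ 2)%:C *: u n) ^+ 2 <= B ^+ 2 * (2 * B * n.+1%:R^-1).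
  case: (Hu n) => Vu u1 hB; rewrite (rnormB_sqr hip) rnormZ absC_real ger0_norm ?sqr_ge0//.
  rewrite ipZr conjc_real sym ?VTu// ip_sqr// -rmorphM/= exprMn.
  have h1 : rnorm (T (T (u n))) ^+ 2 <= B ^+ 2 * rnorm (T (u n)) ^+ 2.
    rewrite -exprMn ler_pXn2r ?nnegrE ?rnorm_ge0 ?mulr_ge0 ?rnorm_ge0//.
    exact: leB.
  have h2 : (B ^+ 2) ^+ 2 * rnorm (u n) ^+ 2 <= (B ^+ 2) ^+ 2.
    rewrite -[leRHS]mulr1 ler_wpM2l ?sqr_ge0// exprn_ile1 ?rnorm_ge0//.
  have h3 : B ^+ 2 - rnorm (T (u n)) ^+ 2 <= 2 * B * n.+1%:R^-1.
    have n0 : 0 < n.+1%:R^-1 :> R by rewrite invr_gt0.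
    have t0 := rnorm_ge0 (T (u n)).
    have tB : rnorm (T (u n)) <= B.
      by rewrite (le_trans (leB _ Vu))// -[leRHS]mulr1 ler_wpM2l.
    move: hB n0 t0 tB; move: (n.+1%:R^-1 : R) (rnorm (T _)) => a b; nra.
  have h4 : B ^+ 2 * (B ^+ 2 - rnorm (T (u n)) ^+ 2) <= B ^+ 2 * (2 * B * n.+1%:R^-1).
    by rewrite ler_wpM2l ?sqr_ge0.
  move: h1 h2 h4; move: (n.+1%:R^-1 : R) => a; lra.
pose D := 1 + CT * CG.
have D0 : 0 < D by rewrite ltr_wpDr ?mulr_ge0.
(* [B^2 u_n] approximates [q = T w], and [T^2] moves it by little *)
have approx eps : 0 < eps -> exists n : nat,
   [/\ B - eps <= rnorm (T (u n)), rnorm (T (T (u n)) - (B ^+ 2)%:C *: u n) <= eps &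
       rnorm (q - (B ^+ 2)%:C *: u n) <= D * eps].
  move=> eps0; pose N := (Num.truncn (eps^-1 + B ^+ 2 * (2 * B) / eps ^+ 2)).+1.
  have [n nN hn] := Hy _ eps0 N; exists n.
  have big : eps^-1 + B ^+ 2 * (2 * B) / eps ^+ 2 < n.+1%:R.
    by rewrite (lt_le_trans (truncnS_gt _))// ler_nat (leq_trans nN).
  have e1 : 0 < eps^-1 by rewrite invr_gt0.
  have e2 : 0 <= B ^+ 2 * (2 * B) / eps ^+ 2.
    by rewrite divr_ge0 ?sqr_ge0// mulr_ge0 ?sqr_ge0// mulr_ge0.
  have c1 : n.+1%:R^-1 <= eps.
    rewrite invf_ple ?posrE//; lra.
  have c2 : rnorm (T (T (u n)) - (B ^+ 2)%:C *: u n) <= eps.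
    rewrite -(@ler_pXn2r _ 2) ?nnegrE ?rnorm_ge0 ?(ltW eps0)//.
    rewrite (le_trans (sq n))// mulrA ler_pdivrMr//.
    have : B ^+ 2 * (2 * B) / eps ^+ 2 <= n.+1%:R by rewrite ltW// (le_lt_trans _ big)// lerDr ltW.
    by rewrite ler_pdivrMr ?exprn_gt0// [eps ^+ 2 * _]mulrC.
  split=> //.
    by case: (Hu n) => _ _; apply: le_trans; rewrite lerD2l lerN2.
  have -> : q - (B ^+ 2)%:C *: u n = (T (T (u n)) - (B ^+ 2)%:C *: u n) -
      T (T (u n) - w) by rewrite linearB opprB [RHS]addrC addrA subrK.
  rewrite (le_trans (rnormB _ _))// /D mulrDl mul1r lerD//.
  rewrite (le_trans (bT _))// -mulrA ler_wpM2l// (le_trans (Tw n))//.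
  by rewrite ler_wpM2l// ltW.
clearbody D.
(* If [q] vanished, some [u n] would be small and [T (u n)] with it, whereas its norm is close to
   [B > 0]. *)
have q0 : q != 0.
  rewrite -rnorm_gt0 ltNge; apply/negP => q0.
  have qE : rnorm q = 0 by apply/eqP; rewrite eq_le q0 rnorm_ge0.
  have B2 : B ^+ 2 = 0.
    apply: (@eq0_of_le_eps _ _ (D + B)); rewrite ?sqr_ge0 ?addr_ge0 ?(ltW D0)//.
    move=> eps eps0; have [n [h1 _ h3]] := approx _ eps0.
    case: (Hu n) => Vu _ _; have h4 := leB _ Vu.
    have h5 : B ^+ 2 * rnorm (u n) <= D * eps.
      have E : rnorm ((B ^+ 2)%:C *: u n) = B ^+ 2 * rnorm (u n).
        by rewrite rnormZ absC_real ger0_norm ?sqr_ge0.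
      have := rnorm_lerB ((B ^+ 2)%:C *: u n) q.
      rewrite rnorm_sub qE E; lra.
    have : B * (B - eps) <= B * (B * rnorm (u n)).
      by rewrite ler_wpM2l// (le_trans h1).
    lra.
  by move: Bn; rewrite -sqrf_eq0 B2 eqxx.
have qq : T (T q) = (B ^+ 2)%:C *: q.
  apply/eqP; rewrite -subr_eq0 -rnorm_eq0; apply/eqP.
  apply: (@eq0_of_le_eps _ _ ((CT * CT + B ^+ 2) * D + B ^+ 2)).
  - exact: rnorm_ge0.
  - by apply: addr_ge0; rewrite ?sqr_ge0// mulr_ge0 ?(ltW D0)// addr_ge0 ?sqr_ge0// mulr_ge0.
  move=> eps eps0; have [n [_ h2 h3]] := approx _ eps0.
  set b := (B ^+ 2)%:C in h2 h3 *; set e := q - b *: u n in h3.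
  have ab : absC b = B ^+ 2 by rewrite absC_real ger0_norm ?sqr_ge0.
  have -> : T (T q) - b *: q = (T (T e) - b *: e) + b *: (T (T (u n)) - b *: u n).
    have TZ x : T (b *: x) = b *: T x by rewrite linearZ.
    by rewrite /e !linearB/= !TZ opprK [- _ + b *: (b *: _)]addrC addrAC !subrKA.
  rewrite (le_trans (rnormD _ _))// [leRHS]mulrDl lerD//.
    rewrite (le_trans (rnormB _ _))// -mulrA mulrDl lerD//.
      rewrite (le_trans (bT _))// -mulrA ler_wpM2l// (le_trans (bT _))//.
      by rewrite ler_wpM2l.
    by rewrite rnormZ ab ler_wpM2l ?sqr_ge0.
  by rewrite rnormZ ab ler_wpM2l ?sqr_ge0.
have [E|ne] := eqVneq (T q + B%:C *: q) 0.
  exists q, (- B); split=> //; apply/eqP.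
  by rewrite rmorphN/= scaleNr -addr_eq0 E.
exists (T q + B%:C *: q), B; split=> //.
  by apply: subspaceD => //; [exact: iV|exact: subspaceZ].
rewrite linearD linearZ/= qq rmorphXn/= expr2 -scalerA -scalerDr addrC.
by [].
Qed.

Variables (A A' : {linear H -> H}).
Hypothesis adj : forall x y, ip (A x) y = ip x (A' y).
Hypothesis normalA : forall x, A (A' x) = A' (A x).
Hypothesis bA : bounded_map A.
Hypothesis compA : cluster_compact A.
Hypothesis injA : forall x, A x = 0 -> x = 0.

Lemma adj_sym x y : ip (A' x) y = ip x (A y).
Proof. by rewrite (ipC _ (A' x)) -adj -ipC. Qed.

Lemma rnorm_adj x : rnorm (A' x) = rnorm (A x).
Proof.
apply/eqP; rewrite -(@eqrXn2 _ 2) ?rnorm_ge0//; apply/eqP.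
by rewrite !(rnorm_sqr hip) adj_sym normalA adj.
Qed.

Lemma bounded_adj : bounded_map A'.
Proof.
by case: bA => C C0 h; exists C => // x; rewrite rnorm_adj.
Qed.

Lemma rnorm_adj_shift c x : rnorm (A' x - conjc c *: x) = rnorm (A x - c *: x).
Proof.
apply/eqP; rewrite -(@eqrXn2 _ 2) ?rnorm_ge0//; apply/eqP.
rewrite !(rnormB_sqr hip) rnorm_adj !rnormZ; congr (_ + _ - 2 * _).
  by congr ((_ * _) ^+ 2); rewrite /absC normcJ.
rewrite !ipZr conjcK adj_sym (ipC ip x (A x)).
by case: (ip (A x) x) => a b; case: c => d f /=; ring.
Qed.

Lemma adj_eigenvector c x : A x = c *: x -> A' x = conjc c *: x.
Proof.
move=> E; apply/eqP; rewrite -subr_eq0 -rnorm_eq0 rnorm_adj_shift.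
by rewrite E subrr rnorm0.
Qed.

Lemma eigenvector_of_adj c x : A' x = conjc c *: x -> A x = c *: x.
Proof.
move=> E; apply/eqP; rewrite -subr_eq0 -rnorm_eq0 -rnorm_adj_shift.
by rewrite E subrr rnorm0.
Qed.

Lemma eigenvectors_orthogonal c d x y :
  A x = c *: x -> A y = d *: y -> c != d -> ip x y = 0.
Proof.
move=> Ex Ey cd; have := adj x y.
rewrite Ex (adj_eigenvector Ey) ipZl ipZr conjcK => /eqP.
by rewrite -subr_eq0 -mulrBl mulf_eq0 subr_eq0 (negbTE cd) => /eqP.
Qed.

(** If [z = (A - c) y] is killed by [A - c], normality makes [A' - conjc c] kill it as well, and
    moving [A - c] across the inner product gives [ip z z = 0]. *)
Lemma generalized_eigenvector c x n :
  iter n (fun y => A y - c *: y) x = 0 -> (0 < n)%N -> A x = c *: x.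
Proof.
have sq y : A (A y - c *: y) - c *: (A y - c *: y) = 0 -> A y - c *: y = 0.
  set z := A y - c *: y => hz; have Ez : A z = c *: z by apply/eqP; rewrite -subr_eq0 hz.
  apply/eqP; rewrite -rnorm_eq0 -sqrf_eq0 (rnorm_sqr hip) {2}/z.
  rewrite ipBr ipZr -adj_sym (adj_eigenvector Ez) ipZl subrr.
  by [].
elim: n => // -[_ /= h _|n IH h _]; first by apply/eqP; rewrite -subr_eq0 h.
by apply: IH => //; apply: sq; exact: h.
Qed.

(** Two symmetric operators replace [A]. First [A' \o A] has an eigenvector in [V]. On its
    eigenspace [V1], with eigenvalue [b1] nonzero by injectivity, [A + A'] factors through [A],
    since [x] is [b1^-1] times [A' (A x)] there. A common eigenvector is annihilated by a quadratic
    polynomial in [A]. *)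
Lemma normal_eigenvector V : closed V -> subspace V ->
  invariant_subspace A V -> invariant_subspace A' V ->
  (exists2 x, V x & x != 0) ->
  exists x c, [/\ V x, x != 0 & A x = c *: x].
Proof.
move=> cV sV iA iA' nV.
have bA' := bounded_adj; case: bA => CA CA0 hA; case: bA' => CA' CA'0 hA'.
pose T1 : {linear H -> H} := A' \o A.
have bT1 : bounded_map T1.
  exists (CA' * CA); first exact: mulr_ge0.
  by move=> x /=; rewrite (le_trans (hA' _))// -mulrA ler_wpM2l.
have bA'' : bounded_map A' by exists CA'.
have [] := @symmetric_compact_eigenvector A T1 A' V compA bT1 bA'' cV sV.
- by move=> x Vx; apply: iA'; exact: iA.
- by [].
- by move=> x y _ _ /=; rewrite adj_sym adj.
- by [].
move=> x1 [b1 [Vx1 x1n E1]].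
have b1n : b1%:C != 0.
  apply: contra_neq x1n => b0; apply: injA; apply/eqP; rewrite -rnorm_eq0.
  rewrite -sqrf_eq0 (rnorm_sqr hip) adj.
  by rewrite (E1 : A' (A x1) = _) b0 scale0r ip0r.
pose V1 := V `&` [set x | A' (A x) = b1%:C *: x].
have sV1 : subspace V1.
  split; first by split; [case: sV|rewrite /= !linear0].
  move=> c x y [Vx Ex] [Vy Ey]; split; first by case: sV => _; apply.
  by rewrite /= !linearP (Ex : A' (A x) = _) (Ey : A' (A y) = _).
have cV1 : closed V1.
  apply: closedI => // x /closure_rnormP h; apply/eqP => /=.
  rewrite -subr_eq0 -rnorm_eq0; apply/eqP.
  case: bT1 => C C0 hC.
  apply: (@eq0_of_le_eps _ _ (C + `|b1|)); rewrite ?rnorm_ge0 ?addr_ge0//.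
  move=> eps eps0; have [y Ey yx] := h _ eps0.
  have -> : A' (A x) - b1%:C *: x = T1 (x - y) - b1%:C *: (x - y).
    have -> : T1 (x - y) = A' (A x) - b1%:C *: y.
      by rewrite -(Ey : A' (A y) = _) /= !linearB.
    by rewrite scalerBr opprB addrA subrK.
  rewrite (le_trans (rnormB _ _))// mulrDl lerD//.
    by rewrite (le_trans (hC _))// ler_wpM2l// rnorm_sub ltW.
  by rewrite rnormZ absC_real ler_wpM2l// rnorm_sub ltW.
pose T2 : {linear H -> H} := A \+ A'.
have bT2 : bounded_map T2.
  exists (CA + CA'); first exact: addr_ge0.
  by move=> x /=; rewrite (le_trans (rnormD _ _))// mulrDl lerD.
pose G : {linear H -> H} := (b1%:C)^-1 \*: (T2 \o A').
have bG : bounded_map G.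
  case: bT2 => C C0 hC; exists (absC (b1%:C)^-1 * (C * CA')).
    by rewrite !mulr_ge0// absC_ge0.
  move=> x /=; rewrite rnormZ -mulrA ler_wpM2l ?absC_ge0// (le_trans (hC _))//.
  by rewrite -mulrA ler_wpM2l.
have iV1 : invariant_subspace T2 V1.
  move=> x [Vx Ex]; split; first by apply: subspaceD => //; [exact: iA|exact: iA'].
  have e1 : b1%:C *: A x = A (A' (A x)) by rewrite (Ex : A' (A x) = _) linearZ.
  have e2 : b1%:C *: A' x = A' (A' (A x)) by rewrite (Ex : A' (A x) = _) linearZ.
  by rewrite /= scalerDr e1 e2 !linearD/= !normalA.
have [] := @symmetric_compact_eigenvector A T2 G V1 compA bT2 bG cV1 sV1 iV1.
- move=> x [Vx Ex] /=.
  by rewrite (Ex : A' (A x) = _) !linearZ/= -scalerDr scalerA mulVf// scale1r.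
- by move=> x y _ _ /=; rewrite ipDl ipDr adj adj_sym addrC.
- by exists x1.
move=> x2 [b2 [[Vx2 E2] x2n E3]].
(* on [x2], [A^2 - b2 A + b1 = 0]: split this quadratic polynomial *)
have quad : A (A x2) = b2%:C *: A x2 - b1%:C *: x2.
  rewrite -linearZ_LR/= -E3 -E2 /= linearD/= normalA.
  by rewrite addrK.
pose z1 := (b2%:C + sqrtc (b2%:C ^+ 2 - 4%:R * b1%:C)) / 2%:R.
pose z2 := b2%:C - z1.
have z12 : z1 * z2 = b1%:C.
  rewrite /z2 /z1; set s := sqrtc _.
  have hs : s ^+ 2 = b2%:C ^+ 2 - 4%:R * b1%:C by rewrite sqr_sqrtc.
  have -> : (b2%:C + s) / 2%:R * (b2%:C - (b2%:C + s) / 2%:R) =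
     (b2%:C ^+ 2 - s ^+ 2) / 4%:R by field.
  by rewrite hs; field.
have [E|ne] := eqVneq (A x2 - z1 *: x2) 0.
  by exists x2, z1; split=> //; apply/eqP; rewrite -subr_eq0 E.
exists (A x2 - z1 *: x2), z2; split=> //.
  by apply: subspaceB => //; [exact: iA|exact: subspaceZ].
rewrite linearB linearZ/= quad scalerBr scalerA [z2 * z1]mulrC z12.
by rewrite /z2 scalerBl addrAC.
Qed.

(** The orthogonal complement of all eigenvectors is closed and invariant under [A] and [A']; were
    it nonzero, it would contain an eigenvector orthogonal to itself. *)
Theorem normal_eigenvectors_total x :
  (forall v c, A v = c *: v -> ip x v = 0) -> x = 0.
Proof.
move=> hx; pose V := [set y | forall v c, A v = c *: v -> ip y v = 0].
have sV : subspace V.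
  split=> [v c _|c y z Vy Vz v d Ev]; first by rewrite ip0l.
  by rewrite ipDl ipZl (Vy _ _ Ev) (Vz _ _ Ev) mulr0 addr0.
have cV : closed V.
  move=> y /closure_rnormP h v c Ev; apply/eqP; rewrite -absC_eq0; apply/eqP.
  apply: (@eq0_of_le_eps _ _ (rnorm v)); rewrite ?absC_ge0 ?rnorm_ge0//.
  move=> eps eps0; have [w Vw wy] := h _ eps0.
  rewrite -[ip y v]subr0 -(Vw _ _ Ev) -ipBl (le_trans (cauchy_schwarz hip _ _))//.
  by rewrite mulrC ler_wpM2l ?rnorm_ge0// rnorm_sub ltW.
have iA : invariant_subspace A V.
  move=> y Vy v c Ev; rewrite adj (adj_eigenvector Ev) ipZr (Vy _ _ Ev).
  by rewrite mulr0.
have iA' : invariant_subspace A' V.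
  by move=> y Vy v c Ev; rewrite adj_sym Ev ipZr (Vy _ _ Ev) mulr0.
apply/eqP/negP => /negP xn.
have [|v [c [Vv vn Ev]]] := normal_eigenvector cV sV iA iA'.
  by exists x.
move: vn; rewrite -rnorm_eq0 -sqrf_eq0 (rnorm_sqr hip) (Vv _ _ Ev).
by rewrite eqxx.
Qed.

End CompactNormal.

(** * Orthogonal expansions and vector-valued contour integrals *)

Section ProjectionSystem.
Variables (R : realType) (H : completeNormedModType R[i]).
Variable ip : {dot H for @conjc R}.
Hypothesis hip : hilbert ip.
Variable P : nat -> H -> H.
Hypothesis P_lin : forall q (c : R[i]) x y, P q (c *: x + y) = c *: P q x + P q y.
Hypothesis P_proj : forall q x y, ip (x - P q x) (P q y) = 0.
Hypothesis P_orth : forall p q x y, p != q -> ip (P p x) (P q y) = 0.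
Hypothesis P_total : forall x, (forall q, P q x = 0) -> x = 0.
Implicit Types (f x y v : H) (c : nat -> R[i]) (q n : nat).

Lemma projD q x y : P q (x + y) = P q x + P q y.
Proof. by have := P_lin q 1 x y; rewrite !scale1r. Qed.

Lemma proj0 q : P q 0 = 0.
Proof. by apply: (addrI (P q 0)); rewrite -projD !addr0. Qed.

Lemma projZ q (a : R[i]) x : P q (a *: x) = a *: P q x.
Proof. by have := P_lin q a x 0; rewrite proj0 !addr0. Qed.

Lemma projB q x y : P q (x - y) = P q x - P q y.
Proof. by rewrite projD -scaleN1r projZ scaleN1r. Qed.

Lemma proj_sum q n (F : nat -> H) : P q (\sum_(j < n) F j) = \sum_(j < n) P q (F j).
Proof.
elim: n => [|n IH]; first by rewrite !big_ord0 proj0.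
by rewrite !big_ord_recr/= projD IH.
Qed.

Lemma proj_pythagoras q x : rnorm x ^+ 2 = rnorm (P q x) ^+ 2 + rnorm (x - P q x) ^+ 2.
Proof.
by have := pythagoras hip (P_proj q x x); rewrite subrK addrC.
Qed.

Lemma rnorm_proj q x : rnorm (P q x) <= rnorm x.
Proof.
rewrite -(@ler_pXn2r _ 2) ?nnegrE ?rnorm_ge0// (proj_pythagoras q x) lerDl.
exact: sqr_ge0.
Qed.

Lemma rnorm_eq0_ip x : ip x x = 0 -> x = 0.
Proof.
by move=> h; apply/eqP; rewrite -rnorm_eq0 -sqrf_eq0 (rnorm_sqr hip) h.
Qed.

Lemma proj_idem q x : P q (P q x) = P q x.
Proof.
apply/eqP; rewrite eq_sym -subr_eq0 -projB; apply/eqP/rnorm_eq0_ip.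
have := P_proj q (x - P q x) (x - P q x).
by rewrite ipBl P_proj sub0r => /eqP; rewrite oppr_eq0 => /eqP.
Qed.

Lemma proj_orth0 p q x : p != q -> P p (P q x) = 0.
Proof.
move=> pq; apply: rnorm_eq0_ip.
have := P_proj p (P q x) (P q x).
by rewrite ipBl P_orth 1?eq_sym// sub0r => /eqP; rewrite oppr_eq0 => /eqP.
Qed.

Definition diag_sum c f n : H := \sum_(q < n) c q *: P q f.

Lemma proj_diag_sum c f n q :
  P q (diag_sum c f n) = if (q < n)%N then c q *: P q f else 0.
Proof.
rewrite /diag_sum (proj_sum _ _ (fun j => c j *: P j f)).
case: ifPn => [qn|]; last first.
  rewrite -leqNgt => nq; rewrite big1// => j _; rewrite projZ proj_orth0 ?scaler0//.
  by rewrite eq_sym neq_ltn (leq_trans (ltn_ord j) nq).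
rewrite (bigD1 (Ordinal qn))//= projZ proj_idem big1 ?addr0// => j jq.
rewrite projZ proj_orth0 ?scaler0// eq_sym.
by apply: contraNneq jq => E; apply/eqP/val_inj.
Qed.

Lemma diag_sum_norm c f m n : (m <= n)%N ->
  rnorm (diag_sum c f n - diag_sum c f m) ^+ 2 =
    \sum_(m <= q < n) absC (c q) ^+ 2 * rnorm (P q f) ^+ 2.
Proof.
move=> mn; rewrite -(subnKC mn); elim: (n - m)%N => [|k IH].
  by rewrite addn0 subrr rnorm0 expr0n big_geq.
rewrite addnS big_nat_recr ?leq_addr//= -IH.
have h q : (q < m + k)%N -> ip (P q f) (P (m + k) f) = 0.
  by move=> qmk; apply: P_orth; rewrite neq_ltn qmk.
have sum0 n' : (n' <= m + k)%N -> ip (diag_sum c f n') (P (m + k) f) = 0.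
  elim: n' => [_|n' IHn hn]; first by rewrite /diag_sum big_ord0 ip0l.
  by rewrite /diag_sum big_ord_recr ipDl ipZl IHn ?(ltnW hn)//= h// mulr0 addr0.
have E : ip (diag_sum c f (m + k) - diag_sum c f m) (c (m + k)%N *: P (m + k) f) = 0.
  by rewrite ipZr ipBl !sum0 ?leq_addr// subr0 mulr0.
have := pythagoras hip E; rewrite rnormZ exprMn addrAC => <-.
by rewrite {1}/diag_sum big_ord_recr.
Qed.

Lemma bessel f n : \sum_(0 <= q < n) rnorm (P q f) ^+ 2 <= rnorm f ^+ 2.
Proof.
have := diag_sum_norm (fun=> 1) f (leq0n n).
rewrite /diag_sum big_ord0 subr0 -/(diag_sum (fun=> 1) f n).
under eq_bigr do rewrite absC1 expr1n mul1r.
move=> <-; set s := diag_sum _ _ _.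
have fs : ip (f - s) s = 0.
  have hs q : (q < n)%N -> ip (f - s) (P q f) = 0.
    move=> qn; have := P_proj q (f - s) f.
    rewrite projB proj_diag_sum qn scale1r subrr subr0 => ->.
    by [].
  have sum0 m : (m <= n)%N -> ip (f - s) (diag_sum (fun=> 1) f m) = 0.
    elim: m => [_|m IHm hm]; first by rewrite /diag_sum big_ord0 ip0r.
    by rewrite /diag_sum big_ord_recr ipDr ipZr IHm ?(ltnW hm)//= hs// mulr0 addr0.
  exact: sum0.
have := pythagoras hip fs; rewrite subrK => ->.
by rewrite lerDr sqr_ge0.
Qed.

Lemma diag_sum_cvg c f (K : R) : (forall q, absC (c q) <= K) ->
  exists v, diag_sum c f @ \oo --> v /\ forall q, P q v = c q *: P q f.
Proof.
move=> cK; have K0 : 0 <= K by rewrite (le_trans (absC_ge0 (c 0%N))).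
pose b n := \sum_(0 <= q < n) rnorm (P q f) ^+ 2.
have bmono : {homo b : m n / (m <= n)%N >-> m <= n}.
  move=> m n mn; rewrite /b (big_cat_nat _ mn)//= lerDl sumr_ge0// => q _.
  exact: sqr_ge0.
have bcvg : cvgn b.
  apply: nondecreasing_is_cvgn => //.
  by exists (rnorm f ^+ 2) => _ [n _ <-]; exact: bessel.
have tail m n : (m <= n)%N ->
    rnorm (diag_sum c f n - diag_sum c f m) ^+ 2 <= K ^+ 2 * (b n - b m).
  move=> mn; rewrite diag_sum_norm//.
  have -> : b n - b m = \sum_(m <= q < n) rnorm (P q f) ^+ 2.
    by rewrite /b (big_cat_nat _ mn)//= [X in X - _]addrC addrK.
  rewrite mulr_sumr; apply: ler_sum => q _; rewrite ler_wpM2r ?sqr_ge0//.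
  by rewrite ler_pXn2r ?nnegrE ?absC_ge0.
have : cvgn (diag_sum c f).
  apply: cauchy_seq_cvg => -[e1 e2]; rewrite ltcE/= => /andP[/eqP -> e10].
  have e3 : 0 < e1 ^+ 2 / (K ^+ 2 + 1).
    by rewrite divr_gt0 ?exprn_gt0// ltr_wpDl ?sqr_ge0.
  have [N HN] : exists N : nat, forall n, (N <= n)%N ->
      limn b - b n < e1 ^+ 2 / (K ^+ 2 + 1).
    move/cvgrPdist_lt : bcvg => /(_ _ e3)[N _ HN]; exists N => n nN.
    by apply: le_lt_trans (HN n nN); exact: ler_norm.
  have half m n : (N <= m)%N -> (m <= n)%N ->
      rnorm (diag_sum c f n - diag_sum c f m) < e1.
    move=> Nm mn; rewrite -(@ltr_pXn2r _ 2) ?nnegrE ?rnorm_ge0 ?(ltW e10)//.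
    rewrite (le_lt_trans (tail m n mn))//.
    have h1 : b n <= limn b by apply: nondecreasing_cvgn_le.
    have h2 := HN m Nm; have h0 := bmono _ _ mn.
    apply: (@le_lt_trans _ _ ((K ^+ 2 + 1) * (b n - b m))).
      by rewrite ler_wpM2r ?subr_ge0// lerDl.
    rewrite mulrC -ltr_pdivlMr ?ltr_wpDl ?sqr_ge0//; lra.
  exists N => n m nN mN; rewrite rnormE ltcR.
  have [mn|/ltnW nm] := leqP m n; first exact: half.
  by rewrite rnorm_sub; exact: half.
move=> dcvg; exists (limn (diag_sum c f)); split=> // q.
apply/eqP; rewrite -subr_eq0 -rnorm_eq0; apply/eqP.
apply: (@eq0_of_le_eps _ _ 1); rewrite ?rnorm_ge0// => eps eps0.
have /cvg_rnormP/(_ _ eps0)[N HN] := dcvg.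
pose n := maxn N q.+1; have nN : (N <= n)%N by rewrite leq_maxl.
have qn : (q < n)%N by rewrite leq_maxr.
have := proj_diag_sum c f n q; rewrite qn => <-.
rewrite -projB mul1r (le_trans (rnorm_proj _ _))// rnorm_sub ltW//.
exact: HN.
Qed.

Lemma expansion_cvg f : diag_sum (fun=> 1) f @ \oo --> f.
Proof.
have [q|v [cv Pv]] := @diag_sum_cvg (fun=> 1) f 1; first by rewrite absC1.
suff E : v = f by rewrite -[X in _ --> X]E.
apply/eqP; rewrite -subr_eq0; apply/eqP/P_total => q.
by rewrite projB Pv scale1r subrr.
Qed.

Lemma expansion_tail f (eps : R) : 0 < eps ->
  exists n, rnorm (f - diag_sum (fun=> 1) f n) < eps.
Proof.
move=> eps0; have /cvg_rnormP/(_ _ eps0)[N HN] := @expansion_cvg f.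
by exists N; rewrite rnorm_sub HN.
Qed.

(** The first [n] components are charged to [eta], the others to the tail of the expansion of [f].
    Totality allows [v] to be known through its components only. *)
Lemma diag_bound c f v (eta K : R) n : 0 <= eta -> (forall q, P q v = c q *: P q f) ->
  (forall q, absC (c q) <= K) -> (forall q, (q < n)%N -> absC (c q) <= eta) ->
  rnorm v ^+ 2 <=
    eta ^+ 2 * rnorm f ^+ 2 + K ^+ 2 * rnorm (f - diag_sum (fun=> 1) f n) ^+ 2.
Proof.
move=> eta0 Pv cK ceta; have K0 : 0 <= K by rewrite (le_trans (absC_ge0 (c 0%N))).
set r := f - diag_sum _ _ _; set M := _ + _.
have M0 : 0 <= M by rewrite addr_ge0// mulr_ge0// sqr_ge0.
have Pr q : (n <= q)%N -> P q r = P q f.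
  by move=> nq; rewrite /r projB proj_diag_sum ltnNge nq subr0.
have part N : rnorm (diag_sum (fun=> 1) v N) ^+ 2 <= M.
  have := diag_sum_norm (fun=> 1) v (leq0n N).
  rewrite {2}/diag_sum big_ord0 subr0 => ->.
  apply: (@le_trans _ _ (\sum_(0 <= q < N)
     (eta ^+ 2 * rnorm (P q f) ^+ 2 + K ^+ 2 * rnorm (P q r) ^+ 2))).
    apply: ler_sum => q _; rewrite absC1 expr1n mul1r Pv rnormZ exprMn.
    have [qn|nq] := ltnP q n.
      apply: ler_wpDr; first by apply: mulr_ge0; apply: sqr_ge0.
      apply: ler_wpM2r; first exact: sqr_ge0.
      by rewrite ler_pXn2r ?nnegrE ?absC_ge0// ceta.
    rewrite Pr//; apply: ler_wpDl; first by apply: mulr_ge0; apply: sqr_ge0.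
    apply: ler_wpM2r; first exact: sqr_ge0.
    by rewrite ler_pXn2r ?nnegrE ?absC_ge0.
  rewrite big_split/= -!mulr_sumr lerD// ler_wpM2l ?sqr_ge0//; exact: bessel.
apply/ler_addgt0Pr => e e0.
have [eps [eps0 eps1 epsE]] : exists eps : R, [/\ 0 < eps, eps <= 1 &
    (2 * rnorm v + 1) * eps <= e].
  have c0 : 0 < 2 * rnorm v + 1 by rewrite ltr_wpDl// mulr_ge0// rnorm_ge0.
  exists (Num.min 1 (e / (2 * rnorm v + 1))); split.
  - by rewrite lt_min ltr01 divr_gt0.
  - by rewrite ge_min lexx.
  - by rewrite -ler_pdivlMl// mulrC ge_min lexx orbT.
have [N HN] := expansion_tail v eps0; have h := part N.
have h1 : rnorm v <= rnorm (diag_sum (fun=> 1) v N) + eps.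
  rewrite -[v in leLHS](subrK (diag_sum (fun=> 1) v N)) addrC.
  by rewrite (le_trans (rnormD _ _))// lerD2l ltW.
have v0 := rnorm_ge0 v; have s0 := rnorm_ge0 (diag_sum (fun=> 1) v N).
have h2 : (rnorm v - eps) <= rnorm (diag_sum (fun=> 1) v N) by lra.
have [le|gt] := leP (rnorm v) eps.
  have : rnorm v ^+ 2 <= eps * 1 by rewrite expr2 ler_pM// (le_trans le).
  have : 0 <= 2 * rnorm v * eps by rewrite !mulr_ge0// ltW.
  move: epsE M0 eps0; lra.
have : (rnorm v - eps) ^+ 2 <= rnorm (diag_sum (fun=> 1) v N) ^+ 2.
  by rewrite ler_pXn2r ?nnegrE ?subr_ge0// ltW.
rewrite sqrrB -mulr_natl => h3.
have : 0 <= eps ^+ 2 by exact: sqr_ge0.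
have : 0 <= eps by exact: ltW.
move: h3 h epsE; lra.
Qed.

Lemma diag_bound_uniform c f v (K : R) : (forall q, P q v = c q *: P q f) ->
  (forall q, absC (c q) <= K) -> rnorm v <= K * rnorm f.
Proof.
move=> Pv cK; have K0 : 0 <= K by rewrite (le_trans (absC_ge0 (c 0%N))).
have := @diag_bound c f v 0 K 0 (lexx 0) Pv cK (fun q h => ltac:(by [])).
rewrite /diag_sum big_ord0 subr0 expr0n mul0r add0r -exprMn.
by rewrite ler_pXn2r ?nnegrE ?mulr_ge0// ?rnorm_ge0.
Qed.

(** [n] and [d] are fixed before the multiplier [c]: for a uniformly bounded family of multipliers,
    smallness in [H] is decided by finitely many scalars. *)
Lemma diag_small f (K eta : R) : 0 <= K -> 0 < eta -> exists n, exists2 d : R, 0 < d &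
  forall c v, (forall q, P q v = c q *: P q f) -> (forall q, absC (c q) <= K) ->
    (forall q, (q < n)%N -> absC (c q) <= d) -> rnorm v < eta.
Proof.
move=> K0 eta0; have K1 : 0 < K + 1 by rewrite ltr_wpDl.
have f0 := rnorm_ge0 f; have f1 : 0 < rnorm f + 1 by rewrite ltr_wpDl.
have e1 : 0 < eta / (2 * (K + 1)) by rewrite divr_gt0// mulr_gt0.
have e2 : 0 < eta / (2 * (rnorm f + 1)) by rewrite divr_gt0// mulr_gt0.
have [n Hn] := expansion_tail f e1; exists n, (eta / (2 * (rnorm f + 1))) => //.
move=> c v Pv cK cd; have := diag_bound (ltW e2) Pv cK cd.
set T := rnorm (f - _) in Hn *; have T0 : 0 <= T by exact: rnorm_ge0.
have h1 : (eta / (2 * (rnorm f + 1))) ^+ 2 * rnorm f ^+ 2 <= (eta / 2) ^+ 2.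
  have e3 : 0 <= eta / 2 by rewrite divr_ge0// ltW.
  have e4 := mulr_ge0 (ltW e2) f0.
  rewrite -exprMn ler_pXn2r ?nnegrE//.
  by rewrite mulrAC ler_pdivrMr ?mulr_gt0//; lra.
have h2 : K ^+ 2 * T ^+ 2 <= (eta / 2) ^+ 2.
  rewrite -exprMn ler_pXn2r ?nnegrE ?mulr_ge0 ?divr_ge0 ?(ltW eta0)//.
  apply: (@le_trans _ _ ((K + 1) * T)); first by rewrite ler_wpM2r// lerDl.
  by rewrite mulrC -ler_pdivlMr// (le_trans (ltW Hn))// invfM mulrA.
move=> hv; rewrite -(@ltr_pXn2r _ 2) ?nnegrE ?rnorm_ge0 ?(ltW eta0)//.
rewrite (le_lt_trans hv)// (le_lt_trans (lerD h1 h2))//.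
have -> : eta ^+ 2 = (eta / 2) ^+ 2 + (eta / 2) ^+ 2 + eta ^+ 2 / 2 by field.
by rewrite ltrDl divr_gt0// exprn_gt0.
Qed.

End ProjectionSystem.

Lemma uniform_small_choice (R : realType) (Pr : nat -> R -> Prop) n :
  (forall q d d', Pr q d -> 0 < d' -> d' <= d -> Pr q d') ->
  (forall q, (q < n)%N -> exists2 d : R, 0 < d & Pr q d) ->
  exists2 d : R, 0 < d & forall q, (q < n)%N -> Pr q d.
Proof.
move=> mono; elim: n => [|n IH] h; first by exists 1.
have [d1 d10 H1] := IH (fun q hq => h q (ltnW hq)).
have [d2 d20 H2] := h n (ltnSn n).
have d0 : 0 < Num.min d1 d2 by rewrite lt_min d10.
exists (Num.min d1 d2) => // q; rewrite ltnS leq_eqVlt => /orP[/eqP ->|qn].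
  by apply: mono H2 _ _ => //; rewrite ge_min lexx orbT.
by apply: mono (H1 _ qn) _ _ => //; rewrite ge_min lexx.
Qed.

Lemma uniform_large_choice (R : realType) (Pr : nat -> R -> Prop) n :
  (forall q d d', Pr q d -> d <= d' -> Pr q d') ->
  (forall q, (q < n)%N -> exists2 d : R, 0 <= d & Pr q d) ->
  exists2 d : R, 0 <= d & forall q, (q < n)%N -> Pr q d.
Proof.
move=> mono; elim: n => [|n IH] h; first by exists 0.
have [d1 d10 H1] := IH (fun q hq => h q (ltnW hq)).
have [d2 d20 H2] := h n (ltnSn n).
exists (d1 + d2) => [|q]; first exact: addr_ge0.
rewrite ltnS leq_eqVlt => /orP[/eqP ->|qn].
  by apply: mono H2 _; rewrite lerDr.
by apply: mono (H1 _ qn) _; rewrite lerDl.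
Qed.

(** * Contour integrals with values in [H] *)

Section VectorContourIntegral.
Variables (R : realType) (H : completeNormedModType R[i]).
Variable ip : {dot H for @conjc R}.
Hypothesis hip : hilbert ip.
Variable P : nat -> H -> H.
Hypothesis P_lin : forall q (c : R[i]) x y, P q (c *: x + y) = c *: P q x + P q y.
Hypothesis P_proj : forall q x y, ip (x - P q x) (P q y) = 0.
Hypothesis P_orth : forall p q x y, p != q -> ip (P p x) (P q y) = 0.
Hypothesis P_total : forall x, (forall q, P q x = 0) -> x = 0.
Variables (p : R -> R[i]^o) (Lp : R) (phi : R[i] -> R[i]) (lam : nat -> R[i]).
Variables (W : nat -> R[i] -> R[i]) (B : R) (F : R[i] -> H) (f : H).
Hypothesis lipp : forall s t, absC (p s - p t) <= Lp * `|s - t|.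
Hypothesis B0 : 0 <= B.
Hypothesis dW : forall q s, strict_deriv (W q) (p s) (phi (p s) / (lam q - p s)).
Hypothesis bW : forall q s m u, s <= m -> m <= u -> u - s < 1 ->
  absC (p u - p s) * absC (phi (p m) / (lam q - p m)) <=
  B * (bounded_ramp u - bounded_ramp s).
Hypothesis limW : forall q (eta : R), 0 < eta -> exists2 S : R, 0 <= S &
  forall a b, a < - S -> S < b ->
  absC (W q (p b) - W q (p a) - (0 +i* (2 * pi)) * phi (lam q)) <= eta.
Hypothesis P_F : forall q s, P q (F (p s)) = (phi (p s) / (lam q - p s)) *: P q f.

Let increment q a b := W q (p b) - W q (p a).

Let ramp_diff a b : bounded_ramp b - bounded_ramp a <= 2 :> R.
Proof.
have := bounded_ramp_norm b; have := bounded_ramp_norm a.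
by rewrite !ler_norml => /andP[h1 h2] /andP[h3 h4]; lra.
Qed.

Let increment_bound q a b : a <= b -> absC (increment q a b) <= 2 * B.
Proof.
move=> ab; apply: (@le_trans _ _ (B * bounded_ramp b - B * bounded_ramp a)).
  apply: (@path_increment_bound R p Lp a b (W q)
    (fun z => phi z / (lam q - z)) (fun s => B * bounded_ramp s)) => //.
  by move=> s u m _ sm mu _ us; rewrite -mulrBr; exact: bW.
by rewrite -mulrBr [2 * B]mulrC ler_wpM2l// ramp_diff.
Qed.

(** The residue lies within 1 of an increment of [W q], and all increments are bounded by
    [2 * B]. *)
Let jump_bound q : absC ((0 +i* (2 * pi)) * phi (lam q)) <= 2 * B + 1.
Proof.
have [S S0 HS] := limW q ltr01.
have h : - S - 1 < - S by lra.
have h' : S < S + 1 by lra.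
have := HS _ _ h h'; set c := _ * phi _; move=> h1.
have ab : - S - 1 <= S + 1 by lra.
have := increment_bound q ab; rewrite /increment; set d := W _ _ - _ in h1 * => h2.
have -> : c = d - (d - c) by ring.
by rewrite (le_trans (absCB _ _))// lerD.
Qed.

(** The integral [w] is first defined by its components, the increments of the primitives. The
    Riemann sums are diagonal too, with multipliers bounded by [2 * B], so [diag_small] leaves
    finitely many scalar sums to control. *)
Lemma vector_path_integral a b : a <= b -> exists2 w,
  is_line_integral p F a b w & forall q, P q w = increment q a b *: P q f.
Proof.
move=> ab.
have [w [_ Pw]] := @diag_sum_cvg _ _ _ hip P P_lin P_proj P_orth
  (fun q => increment q a b) f (2 * B) (fun q => increment_bound q ab).
exists w => // eta eta0.
have K0 : 0 <= 4 * B + 1 by rewrite addr_ge0// mulr_ge0.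
have [n [e e0 He]] := @diag_small _ _ _ hip P P_lin P_proj P_orth P_total f _ _ K0 eta0.
pose S q m (x xi : nat -> R) : R[i] :=
  \sum_(j < m) ((p (x j.+1) - p (x j)) * (phi (p (xi j)) / (lam q - p (xi j))) : R[i]).
have [d d0 Hd] : exists2 d : R, 0 < d & forall q, (q < n)%N -> forall m x xi,
    tagged_subdivision a b d m x xi ->
    absC (S q m x xi - increment q a b) < e.
  apply: (@uniform_small_choice R (fun q d => forall m x xi,
    tagged_subdivision a b d m x xi ->
    absC (S q m x xi - increment q a b) < e)).
    move=> q d d' Hq _ dd m x xi [x0 xn hj]; apply: Hq; split=> // j jm.
    by have [h1 h2] := hj j jm; split=> //; exact: lt_le_trans dd.
  move=> q _.
  exact: (@path_integral_primitive R p Lp a b (W q) (fun z => phi z / (lam q - z))).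
(* Mesh below 1 makes [bW] applicable to every cell, hence the bound on the Riemann sums uniform in
   [q]. *)
exists (Num.min d 1); first by rewrite lt_min d0 ltr01.
move=> m x xi x0 xm hj; set v := _ - w.
have sub : tagged_subdivision a b d m x xi.
  by split=> // j jm; have [h] := hj j jm; rewrite lt_min => /andP[].
have Pv q : P q v = (S q m x xi - increment q a b) *: P q f.
  rewrite /v (projB P_lin) (proj_sum P_lin q m
    (fun j => (p (x j.+1) - p (x j)) *: F (p (xi j)))) Pw [RHS]scalerBl.
  congr (_ - _); transitivity (\sum_(j < m) ((p (x j.+1) - p (x j)) *
      (phi (p (xi j)) / (lam q - p (xi j))) : R[i]) *: P q f).
    by apply: eq_bigr => j _; rewrite (projZ P_lin) P_F scalerA.
  by symmetry; exact: scaler_suml.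
have SB q : absC (S q m x xi) <= 2 * B.
  rewrite (le_trans (absC_sum _ _ _))//.
  apply: (@le_trans _ _ (\sum_(j < m) (B * bounded_ramp (x j.+1) - B * bounded_ramp (x j)))).
    apply: ler_sum => -[j /= jm] _; rewrite absCM -mulrBr.
    have [_ h1 h2 _] := tagged_subdivision_bounds sub jm.
    have [_] := hj j jm; rewrite lt_min => /andP[_ h3].
    exact: bW.
  rewrite (sum_telescope (fun j => B * bounded_ramp (x j))) -mulrBr.
  by rewrite [2 * B]mulrC ler_wpM2l// ramp_diff.
apply: (He _ _ Pv) => q; last by move=> qn; exact/ltW/Hd.
rewrite (le_trans (absCB _ _))//; have := SB q; have := increment_bound q ab.
by lra.
Qed.

Lemma vector_contour_integral v :
  (forall q, P q v = ((0 +i* (2 * pi)) * phi (lam q)) *: P q f) ->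
  forall eta : R, 0 < eta -> exists S : R, forall a b : R, a < - S -> S < b ->
    exists2 w, is_line_integral p F a b w & rnorm (w - v) < eta.
Proof.
move=> Pv eta eta0.
have K0 : 0 <= 4 * B + 1 by rewrite addr_ge0// mulr_ge0.
have [n [e e0 He]] := @diag_small _ _ _ hip P P_lin P_proj P_orth P_total f _ _ K0 eta0.
have [S S0 HS] : exists2 S : R, 0 <= S & forall q, (q < n)%N -> forall a b,
    a < - S -> S < b ->
    absC (increment q a b - (0 +i* (2 * pi)) * phi (lam q))
      <= e.
  apply: (@uniform_large_choice R (fun q S => forall a b, a < - S -> S < b ->
    absC (increment q a b - (0 +i* (2 * pi)) * phi (lam q))
      <= e)).
    move=> q S S' Hq SS a b ha hb; apply: Hq; last exact: le_lt_trans hb.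
    by rewrite (lt_le_trans ha)// lerN2.
  by move=> q _; exact: limW.
exists S => a b ha hb; have ab : a <= b by lra.
have [w Iw Pw] := vector_path_integral ab; exists w => //.
have Pwv q : P q (w - v) =
    (increment q a b - (0 +i* (2 * pi)) * phi (lam q)) *: P q f.
  by rewrite (projB P_lin) Pw Pv [RHS]scalerBl.
apply: (He _ _ Pwv) => q; last by move=> qn; exact: HS.
rewrite (le_trans (absCB _ _))//.
by have := jump_bound q; have := increment_bound q ab; lra.
Qed.

End VectorContourIntegral.

(** * The sectorial operator and its eigenprojections *)

Section ClosedForm.
Variables (R : realType) (H : completeNormedModType R[i]).
Variable ip : {dot H for @conjc R}.
Hypothesis hip : hilbert ip.
Implicit Types (T : set (H * H)) (p q : H * H).

Lemma closure_prod_rnorm T p : closure T p -> forall eps : R, 0 < eps ->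
  exists2 q, T q & rnorm (q.1 - p.1) < eps /\ rnorm (q.2 - p.2) < eps.
Proof.
move=> cT eps eps0.
have : nbhs p [set q : H * H | rnorm (q.1 - p.1) < eps /\ rnorm (q.2 - p.2) < eps].
  exists ([set x | rnorm (x - p.1) < eps], [set x | rnorm (x - p.2) < eps]).
    by split; apply/nbhs_rnormP; exists eps.
  by move=> q [].
by move=> /cT[q [Tq hq]]; exists q.
Qed.

(** Both sides are continuous on the graph; [K] is a local Lipschitz constant. The factor [a] is 1
    for coercivity, and [1 +i* kappa] or its conjugate for the half-planes bounding the sector at
    [iota]. *)
Lemma closure_form_ge T (a : R[i]) (c : R) :
  (forall p, T p -> c * rnorm p.1 ^+ 2 <= Re (a * ip p.2 p.1)) ->
  forall p, closure T p -> c * rnorm p.1 ^+ 2 <= Re (a * ip p.2 p.1).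
Proof.
move=> hT p cp; apply/ler_addgt0Pr => e e0.
pose K := absC a * (rnorm p.1 + 1 + rnorm p.2) + `|c| * (2 * rnorm p.1 + 1).
have n1 := rnorm_ge0 p.1; have n2 := rnorm_ge0 p.2.
have K0 : 0 <= K.
  apply: addr_ge0; apply: mulr_ge0; rewrite ?absC_ge0//; lra.
have K1 : 0 < K + 1 by lra.
pose eps := Num.min 1 (e / (K + 1)).
have eps0 : 0 < eps by rewrite lt_min ltr01 divr_gt0.
have eps1 : eps <= 1 by rewrite ge_min lexx.
have epsE : K * eps <= e.
  apply: (@le_trans _ _ ((K + 1) * eps)); first by rewrite ler_wpM2r ?(ltW eps0)// lerDl.
  by rewrite -ler_pdivlMl// mulrC ge_min lexx orbT.
have [q Tq [q1 q2]] := closure_prod_rnorm cp eps0; have := hT q Tq.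
have d1 : rnorm q.1 <= rnorm p.1 + eps.
  by have := rnorm_lerB q.1 p.1; lra.
have d1' : rnorm p.1 <= rnorm q.1 + eps.
  by have := rnorm_lerB p.1 q.1; rewrite rnorm_sub; lra.
have m1 := rnorm_ge0 q.1.
have e1 : absC (ip q.2 q.1 - ip p.2 p.1) <= (rnorm p.1 + 1 + rnorm p.2) * eps.
  have -> : ip q.2 q.1 - ip p.2 p.1 = ip (q.2 - p.2) q.1 + ip p.2 (q.1 - p.1).
    by rewrite ipBl ipBr addrA subrK.
  rewrite (le_trans (absCD _ _))// mulrDl lerD//.
    rewrite (le_trans (cauchy_schwarz hip _ _))// mulrC ler_pM ?rnorm_ge0//.
      by lra.
    exact: ltW.
  by rewrite (le_trans (cauchy_schwarz hip _ _))// ler_wpM2l ?rnorm_ge0 ?ltW.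
have e2 : `|Re (a * ip q.2 q.1) - Re (a * ip p.2 p.1)| <=
    absC a * ((rnorm p.1 + 1 + rnorm p.2) * eps).
  rewrite -ReN -ReD -mulrBr (le_trans (Re_le_absC _))// absCM.
  by rewrite ler_wpM2l ?absC_ge0.
have e3 : `|c * rnorm p.1 ^+ 2 - c * rnorm q.1 ^+ 2| <= `|c| * ((2 * rnorm p.1 + 1) * eps).
  rewrite -mulrBr normrM ler_wpM2l//.
  rewrite ler_norml; apply/andP; split; nra.
move: e2 e3; rewrite !ler_norml => /andP[_ e2] /andP[_ e3] h.
move: epsE; rewrite /K; lra.
Qed.

Lemma dense_rnorm (D : set H) : dense D -> forall x (eps : R), 0 < eps ->
  exists2 y, D y & rnorm (y - x) < eps.
Proof.
move=> dD x eps eps0.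
have nB : nbhs x [set y | rnorm (y - x) < eps] by apply/nbhs_rnormP; exists eps.
have [|y [/interior_subset h Dy]] := dD _ _ (open_interior [set y | rnorm (y - x) < eps]).
  by exists x.
by exists y.
Qed.

End ClosedForm.

Section SectorialOperator.
Variables (R : realType) (H Hp : completeNormedModType R[i]).
Variables (ip : {dot H for @conjc R}) (J : {linear Hp -> H}).
Variables (L : set (H * H)) (M : set Hp) (C0 C1 C2 : R) (A : {linear H -> H}).
Hypothesis hip : hilbert ip.
Hypothesis H1 : condition_H1 J L M C0.
Hypothesis H2 : condition_H2 ip J L M C1 C2.
Hypothesis AW : forall p, Wtilde J L M p <-> p.1 = A p.2.

Let C00 : 0 < C0. Proof. by case: H1 => _ [] []. Qed.
Let C20 : 0 < C2. Proof. by case: H2. Qed.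

Lemma Wtilde_coercive p : Wtilde J L M p ->
  C2 / C0 ^+ 2 * rnorm p.1 ^+ 2 <= Re (ip p.2 p.1).
Proof.
have [_ [_ hJ] _ _] := H1; have [_ _ h2] := H2.
have := @closure_form_ge _ _ _ hip (op_restr L (J @` M)) 1 (C2 / C0 ^+ 2).
move=> h hp; have := h _ p hp; rewrite mul1r; apply=> -[x y] [Lp [f Mf Jf]] /=.
move: Lp Jf => /= Lp Jf; rewrite mul1r -Jf.
have [_] := h2 f f Mf Mf y (ltac:(by rewrite Jf)).
apply: le_trans; rewrite mulrAC ler_pdivrMr ?exprn_gt0// -mulrA ler_pM2l//.
by rewrite -exprMn mulrC ler_pXn2r ?nnegrE ?mulr_ge0 ?rnorm_ge0 ?(ltW C00)// mulrC.
Qed.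

Lemma A_coercive y : C2 / C0 ^+ 2 * rnorm (A y) ^+ 2 <= Re (ip y (A y)).
Proof. by apply: (@Wtilde_coercive (A y, y)); apply/AW. Qed.

Lemma A_bounded : bounded_map A.
Proof.
have c0 : 0 < C2 / C0 ^+ 2 by rewrite divr_gt0// exprn_gt0.
exists (C2 / C0 ^+ 2)^-1; first by rewrite invr_ge0 ltW.
move=> y; have := A_coercive y; rewrite ler_pdivlMl//.
have := cauchy_schwarz hip y (A y); have := Re_le_absC (ip y (A y)).
have n0 := rnorm_ge0 (A y); rewrite ler_norml => /andP[_ h1] h2 h3.
have [->|nz] := eqVneq (rnorm (A y)) 0; first by rewrite mulr0 rnorm_ge0.
have n1 : 0 < rnorm (A y) by rewrite lt0r nz.
rewrite -(ler_pM2r n1) -mulrA -expr2 (le_trans h3)// (le_trans h1)//.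
Qed.

Lemma A_cluster_compact : cluster_compact A.
Proof.
have [_ [_ hJ] cJ _] := H1; have [_ _ h2] := H2.
(* For [rnorm u <= 1], pairs [(J f, y)] of the restricted graph close to [(A u, u)] have
   [rnorm y <= 2], and then [C2 |f|^2 <= 2 C0 |f|]. So [A u] is a limit of images of the ball of
   radius [r] in [Hp]. *)
pose r := 2 * C0 / C2; have r0 : 0 <= r by rewrite divr_ge0 ?mulr_ge0 ?ltW.
pose B := [set f : Hp | rnorm f <= r].
have bB : bounded_set B.
  exists r%:C; split; first by apply/complex_realP; exists r.
  move=> x rx f Bf; rewrite /= rnormE (le_trans _ (ltW rx))// lecR.
  exact: Bf.
have := cJ B bB; rewrite precompactE => cK u hu.
have inK n : closure (J @` B) (A (u n)).
  apply/closure_rnormP => eps eps0.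
  have hW : Wtilde J L M (A (u n), u n) by apply/AW.
  have e0 : 0 < Num.min eps 1 by rewrite lt_min eps0 ltr01.
  have [[x y] [/= Lxy [f Mf Jf]] [/= h1 h3]] := closure_prod_rnorm hW e0.
  move: Jf h1 h3 => /= Jf; rewrite !lt_min => /andP[h1 _] /andP[_ h3].
  exists x => //; exists f => //; rewrite /B /=.
  have [_ hf] := h2 f f Mf Mf y (ltac:(by rewrite Jf)).
  have y2 : rnorm y <= 2.
    by have := rnorm_lerB y (u n); have := hu n; lra.
  have a1 : Re (ip y (J f)) <= 2 * (C0 * rnorm f).
    rewrite (le_trans (ler_norm _))// (le_trans (Re_le_absC _))//.
    rewrite (le_trans (cauchy_schwarz hip _ _))// ler_pM ?rnorm_ge0//.
  have [->|fn] := eqVneq (rnorm f) 0; first exact: r0.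
  have f0 : 0 < rnorm f by rewrite lt0r fn rnorm_ge0.
  rewrite /r ler_pdivlMr// -(ler_pM2r f0) mulrAC -expr2 mulrC (le_trans hf)//.
  by rewrite -mulrA.
have [|y [_ cy]] := cK (fmap (A \o u) \oo).
  by exists 0%N => // n _; exact: inK.
exists y => eps eps0 N.
have : (A \o u @ \oo) [set x | exists2 n : nat, (N <= n)%N & x = A (u n)].
  by exists N => // n nN; exists n.
move=> /cy /(_ (_ : nbhs y [set x | rnorm (x - y) < eps]))[].
  by apply/nbhs_rnormP; exists eps.
by move=> x [[n nN ->] h]; exists n.
Unshelve. all: by end_near.
Qed.

Lemma adjoint_exists : exists A' : {linear H -> H},
  forall x y, ip (A x) y = ip x (A' y).
Proof.
case: A_bounded => C Cge hC.
have ex y : exists z, forall x, ip (A x) y = ip x z.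
  apply: (@riesz_representation _ _ _ hip (fun x => ip (A x) y) (C * rnorm y)).
    by move=> c x z; rewrite linearP ipDl ipZl.
  move=> x; rewrite (le_trans (cauchy_schwarz hip _ _))// mulrAC.
  by rewrite ler_wpM2r ?rnorm_ge0.
have [B hB] := choice ex.
have ipI x y : (forall w, ip w x = ip w y) -> x = y.
  move=> h; apply/eqP; rewrite -subr_eq0 -rnorm_eq0 -sqrf_eq0 (rnorm_sqr hip).
  by rewrite ipBr h subrr.
have lB : linear B.
  move=> c x y; apply: ipI => w.
  by rewrite ipDr ipZr -!hB ipDr ipZr.
pose BL := GRing.isLinear.Build _ _ _ _ B lB.
pose B' : {linear H -> H} := HB.pack B BL.
by exists B' => x y; exact: hB.
Qed.

(** The inverse graphs of [Wtilde] and of its adjoint are those of [A] and [A']; the equality of the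
    two compositions is read at the pair [(A' (A x), x)]. *)
Lemma normal_commute (A' : {linear H -> H}) :
  (forall x y, ip (A x) y = ip x (A' y)) ->
  normal_operator ip (Wtilde J L M) -> forall x, A (A' x) = A' (A x).
Proof.
move=> adj [_ _ E] x.
have ipI y z : (forall w, ip w y = ip w z) -> y = z.
  move=> h; apply/eqP; rewrite -subr_eq0 -rnorm_eq0 -sqrf_eq0 (rnorm_sqr hip).
  by rewrite ipBr h subrr.
have adjW q : adjoint ip (Wtilde J L M) q <-> q.1 = A' q.2.
  split=> [h|Eq p /AW Ep]; last by rewrite Eq Ep adj.
  apply: ipI => w; rewrite -adj; apply: (h (A w, w)); exact/AW.
have : op_comp (Wtilde J L M) (adjoint ip (Wtilde J L M)) (A' (A x), x).
  by exists (A x); [exact/adjW|exact/AW].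
by rewrite E => -[y /AW /= -> /adjW /= ->].
Qed.

(** [A x = 0] puts [(0, x)] into the closure [Wtilde], so the claim is that this closure is
    single-valued. By normality [A' x = 0] too, hence [x] is orthogonal to the range of [A], which
    is the dense domain of [Wtilde]. *)
Lemma A_injective (A' : {linear H -> H}) :
  (forall x y, ip (A x) y = ip x (A' y)) ->
  normal_operator ip (Wtilde J L M) -> forall x, A x = 0 -> x = 0.
Proof.
move=> adj nW x Ax0; have nA := normal_commute adj nW; case: nW => _ dW _.
have A'x : A' x = 0.
  by apply/eqP; rewrite -rnorm_eq0 (rnorm_adj hip adj nA) Ax0 rnorm0.
apply/eqP; rewrite -rnorm_eq0 -sqrf_eq0; apply/eqP.
apply: (@eq0_of_le_eps _ _ (rnorm x)); rewrite ?sqr_ge0 ?rnorm_ge0//.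
move=> eps eps0; have [y [[z w] /AW/= -> <-] h] := dense_rnorm dW x eps0.
have : ip x (A w) = 0 by apply: ip_eq0C; rewrite adj A'x ip0r.
move: h; rewrite /= => h h0.
have : absC (ip x (x - A w)) <= rnorm x * eps.
  rewrite (le_trans (cauchy_schwarz hip _ _))// ler_wpM2l ?rnorm_ge0//.
  by rewrite rnorm_sub ltW.
rewrite ipBr h0 subr0 (ip_sqr hip) absC_real ger0_norm ?sqr_ge0//.
Qed.

Lemma eigenvalue_Re_ge (c : R[i]) x : x != 0 -> c != 0 -> A x = c *: x ->
  C2 / C0 ^+ 2 <= Re c^-1.
Proof.
move=> x0 c0 Ex; have n0 : 0 < rnorm x ^+ 2 by rewrite exprn_gt0// rnorm_gt0.
have := A_coercive (c^-1 *: x); rewrite linearZ/= Ex scalerA mulVf// scale1r.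
rewrite ipZl (ip_sqr hip) ReM /= mulr0 subr0.
by rewrite ler_pM2r.
Qed.

End SectorialOperator.

(** * Eigenprojections from the Jordan data *)

Section EigenProjections.
Variables (R : realType) (H : completeNormedModType R[i]).
Variable ip : {dot H for @conjc R}.
Hypothesis hip : hilbert ip.
Variables (A A' : {linear H -> H}).
Hypothesis adj : forall x y, ip (A x) y = ip x (A' y).
Hypothesis normalA : forall x, A (A' x) = A' (A x).
Hypothesis bA : bounded_map A.
Hypothesis compA : cluster_compact A.
Hypothesis injA : forall x, A x = 0 -> x = 0.
Variables (Q : set nat) (mu : nat -> R[i]) (m : nat -> nat)
  (k : nat -> nat -> nat) (e g : nat -> nat -> nat -> H).
Hypothesis charQ : characteristic_sequence A Q mu.
Hypothesis jordan : jordan_basis A Q mu m k e.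
Hypothesis chains : adjoint_chains ip A Q mu m k g.
Hypothesis biorth : biorthogonal ip Q m k e g.

Lemma mu_neq0 q : Q q -> mu q != 0.
Proof.
move=> Qq; case: charQ => _ _ E _.
have : [set mu q | q in Q] (mu q) by exists q.
by rewrite E => -[].
Qed.

Lemma mu_eigenvector q : Q q -> exists2 x, x != 0 & A x = mu q *: x.
Proof.
move=> Qq; case: charQ => _ _ E _.
have : [set mu q | q in Q] (mu q) by exists q.
by rewrite E => -[].
Qed.

(** A second chain vector would be a generalized eigenvector, hence an eigenvector, which forces the
    first one to vanish, against its nonzero pairing. *)
Lemma chain_length q xi : Q q -> (xi < m q)%N -> k q xi = 0%N.
Proof.
move=> Qq xim; apply/eqP; rewrite -leqn0 leqNgt; apply/negP => k0.
have [_ _ h0 h1] := jordan Qq; have E0 := h0 _ xim; have E1 := h1 _ _ xim k0.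
have := @generalized_eigenvector _ _ _ hip A A' adj normalA (mu q) (e q xi 1%N) 2.
rewrite /= E1 [mu q *: _ + _]addrC addrK E0 subrr => /(_ erefl isT).
move=> /eqP; rewrite -subr_eq0 addrK => /eqP e0.
have [] := biorth Qq xim (leq0n _).
by rewrite e0 ip0l eqxx.
Qed.

Lemma e_eigen q xi : Q q -> (xi < m q)%N -> A (e q xi 0%N) = mu q *: e q xi 0%N.
Proof. by move=> Qq xim; have [_ _ h _] := jordan Qq; exact: h. Qed.

Lemma g_eigen q xi : Q q -> (xi < m q)%N -> A (g q xi 0%N) = mu q *: g q xi 0%N.
Proof.
move=> Qq xim; have [h _] := chains Qq xim.
apply: (eigenvector_of_adj hip adj normalA).
apply/eqP; rewrite -subr_eq0 -rnorm_eq0 -sqrf_eq0 (rnorm_sqr hip).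
set w := _ - _; rewrite {2}/w ipBr -adj.
by have := h (w, A w) erefl; rewrite /= => ->; rewrite subrr.
Qed.

Lemma eg_neq0 q xi : Q q -> (xi < m q)%N -> ip (e q xi 0%N) (g q xi 0%N) != 0.
Proof.
move=> Qq xim; have [] := biorth Qq xim (leq0n _).
by rewrite (chain_length Qq xim).
Qed.

Lemma eg_eq0 q xi xi' : Q q -> (xi < m q)%N -> (xi' < m q)%N -> xi != xi' ->
  ip (e q xi 0%N) (g q xi' 0%N) = 0.
Proof.
move=> Qq xim xim' ne; have [_ h] := biorth Qq xim (leq0n _).
by apply: h => // -[_ E _]; rewrite E eqxx in ne.
Qed.

Lemma eigen_span q x : Q q -> A x = mu q *: x ->
  exists c : nat -> R[i], x = \sum_(j < m q) c j *: e q j 0%N.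
Proof.
move=> Qq Ex; have [_ [_ Es] _ _] := jordan Qq.
have : root_subspace A (mu q) x by exists 1%N; rewrite /= Ex subrr.
rewrite Es => -[c _ <-]; exists c.
have -> : [seq e q xi i | xi <- iota 0 (m q), i <- iota 0 (k q xi).+1] =
    [seq e q xi 0%N | xi <- iota 0 (m q)].
  rewrite -[RHS]flatten_map1; congr flatten; apply/eq_in_map => xi.
  by rewrite mem_iota/= add0n => xim; rewrite (chain_length Qq xim).
rewrite size_map size_iota; apply: eq_bigr => j _; congr (_ *: _).
by rewrite (nth_map 0%N) ?size_iota ?nth_iota.
Qed.

Definition eigen_proj q (f : H) : H :=
  if q \in Q then \sum_(xi < m q) root_coef ip k e g f q xi 0 *: e q xi 0%N else 0.

Lemma eigen_proj_notin q f : ~ Q q -> eigen_proj q f = 0.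
Proof. by move=> nQ; rewrite /eigen_proj; case: ifPn => // /set_mem. Qed.

Lemma eigen_proj_eigen q f : A (eigen_proj q f) = mu q *: eigen_proj q f.
Proof.
rewrite /eigen_proj; case: ifPn => [/set_mem Qq|_]; last by rewrite linear0 scaler0.
rewrite linear_sum scaler_sumr; apply: eq_bigr => xi _.
by rewrite linearZ/= e_eigen// !scalerA mulrC.
Qed.

Lemma eigenspace_closed (c : R[i]) : closed [set x | A x = c *: x].
Proof.
move=> x /closure_rnormP h; apply/eqP; rewrite -subr_eq0 -rnorm_eq0; apply/eqP.
case: bA => C CC0 hC.
apply: (@eq0_of_le_eps _ _ (C + absC c)); rewrite ?rnorm_ge0 ?addr_ge0 ?absC_ge0//.
move=> eps eps0; have [y Ey yx] := h _ eps0.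
have -> : A x - c *: x = A (x - y) - c *: (x - y).
  by rewrite linearB (Ey : A y = _) scalerBr opprB addrA subrK.
rewrite (le_trans (rnormB _ _))// mulrDl lerD//.
  by rewrite (le_trans (hC _))// ler_wpM2l// rnorm_sub ltW.
by rewrite rnormZ ler_wpM2l ?absC_ge0// rnorm_sub ltW.
Qed.

(** The biorthogonal coefficients define an a priori oblique projection. As the [g] are eigenvectors
    of [A] itself, [f] and its orthogonal projection have the same pairings with them, hence the
    same coefficients. *)
Lemma eigen_proj_orth q f x : Q q -> A x = mu q *: x -> ip (f - eigen_proj q f) x = 0.
Proof.
move=> Qq Ex; pose V := [set x | A x = mu q *: x].
have sV : subspace V.
  split=> [|c y z]; rewrite /V /=; first by rewrite linear0 scaler0.
  by move=> Ey Ez; rewrite linearP Ey Ez scalerDr !scalerA mulrC.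
have [v Vv hv] := orthogonal_projection hip f (@eigenspace_closed (mu q)) sV.
suff -> : eigen_proj q f = v by exact: hv.
rewrite /eigen_proj mem_set//; have [c Ev] := eigen_span Qq Vv.
rewrite Ev; apply: eq_bigr => -[xi xim] _ /=; congr (_ *: _).
rewrite /root_coef (chain_length Qq xim) subn0.
have -> : ip f (g q xi 0%N) = ip v (g q xi 0%N).
  apply/eqP; rewrite -subr_eq0 -ipBl; apply/eqP/hv; exact: g_eigen.
rewrite Ev linear_sumlz (bigD1 (Ordinal xim))//= ipZl big1 ?addr0.
  by rewrite mulfK// eg_neq0.
by move=> j jx; rewrite ipZl eg_eq0 ?mulr0.
Qed.

Lemma eigen_proj_unique q f u : Q q -> A u = mu q *: u ->
  (forall x, A x = mu q *: x -> ip (f - u) x = 0) -> eigen_proj q f = u.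
Proof.
move=> Qq Eu hu; apply/eqP; rewrite -subr_eq0 -rnorm_eq0 -sqrf_eq0 (rnorm_sqr hip).
set d := _ - _; have Ed : A d = mu q *: d.
  by rewrite linearB scalerBr eigen_proj_eigen Eu.
have -> : ip d d = ip (f - u) d - ip (f - eigen_proj q f) d.
  by rewrite -ipBl; congr (ip _ _); rewrite opprB addrC addrA subrK.
by rewrite hu// eigen_proj_orth// subrr.
Qed.

Lemma eigen_proj_lin q (c : R[i]) x y :
  eigen_proj q (c *: x + y) = c *: eigen_proj q x + eigen_proj q y.
Proof.
rewrite /eigen_proj; case: ifPn => [/set_mem Qq|_]; last by rewrite scaler0 addr0.
rewrite scaler_sumr -big_split; apply: eq_bigr => xi _ /=.
by rewrite /root_coef ipDl ipZl scalerA -scalerDl mulrDl mulrA.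
Qed.

Lemma eigen_proj_proj q x y : ip (x - eigen_proj q x) (eigen_proj q y) = 0.
Proof.
have [Qq|nQ] := pselect (Q q); last by rewrite !eigen_proj_notin// ip0r.
by apply: eigen_proj_orth => //; exact: eigen_proj_eigen.
Qed.

Lemma eigen_proj_orthogonal p q x y : p != q ->
  ip (eigen_proj p x) (eigen_proj q y) = 0.
Proof.
move=> pq; have [Qp|nQ] := pselect (Q p); last by rewrite eigen_proj_notin// ip0l.
have [Qq|nQ] := pselect (Q q); last by rewrite (@eigen_proj_notin q)// ip0r.
apply: (eigenvectors_orthogonal hip adj normalA (eigen_proj_eigen _ _) (eigen_proj_eigen _ _)).
by apply: contra_neq pq; case: charQ => _ h _ _; exact: h.
Qed.

Lemma eigen_proj_total x : (forall q, eigen_proj q x = 0) -> x = 0.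
Proof.
move=> hx; apply: (normal_eigenvectors_total hip adj normalA bA compA injA).
move=> v c Ev; have [->|vn] := eqVneq v 0; first by rewrite ip0r.
have cn : c != 0.
  by apply: contra_neq vn => c0; apply: injA; rewrite Ev c0 scale0r.
case: charQ => _ _ E _.
have : [set z | z != 0 /\ exists2 x, x != 0 & A x = z *: x] c.
  by split=> //; exists v.
rewrite -E => -[q Qq qc]; rewrite -[x]subr0 -(hx q).
by apply: eigen_proj_orth => //; rewrite qc.
Qed.

Lemma eigen_proj_A q x : eigen_proj q (A x) = mu q *: eigen_proj q x.
Proof.
have [Qq|nQ] := pselect (Q q); last by rewrite !eigen_proj_notin// scaler0.
apply: eigen_proj_unique => //.
  by rewrite linearZ/= eigen_proj_eigen.
move=> y Ey; rewrite -eigen_proj_eigen -linearB adj.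
rewrite (adj_eigenvector hip adj normalA Ey) ipZr.
by rewrite eigen_proj_orth// mulr0.
Qed.

(** Otherwise every index occurs and all [absC (mu q)] are at least [r^-1]; normalised eigenvectors
    then have orthogonal images at mutual distance at least [r^-1], against compactness. *)
Lemma eigenvalues_unbounded (r : R) : exists N : nat, forall q, (N <= q)%N -> Q q ->
  r < absC (mu q)^-1.
Proof.
apply: contrapT => hN.
have far N : exists q, [/\ (N <= q)%N, Q q & absC (mu q)^-1 <= r].
  apply: contrapT => h; apply: hN; exists N => q Nq Qq; rewrite ltNge; apply/negP => le.
  by apply: h; exists q.
case: charQ => iQ injmu _ mono.
have allQ q : Q q.+1 /\ absC (mu q.+1)^-1 <= r.
  have [q' [qq' Qq' le]] := far q.+1; have Qq : Q q.+1 by apply: (iQ _ Qq').2.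
  by split=> //; apply: le_trans (mono _ _ Qq Qq' qq') le.
have ex n : exists x, rnorm x = 1 /\ A x = mu n.+1 *: x.
  have [x xn Ex] := mu_eigenvector (allQ n).1.
  have n0 : 0 < rnorm x by rewrite rnorm_gt0.
  exists ((rnorm x)^-1%:C *: x); rewrite rnormZ absC_real gtr0_norm ?invr_gt0//.
  by rewrite mulVf ?gt_eqF// linearZ/= Ex !scalerA mulrC.
have [u Hu] := choice ex.
have [y Hy] := compA (fun n => eq_ind_r (fun z => z <= 1) (lexx 1) (Hu n).1).
have mu0 n : 0 < absC (mu n.+1) by rewrite absC_gt0 mu_neq0//; case: (allQ n).
have r0 : 0 < r.
  by have [_] := allQ 0%N; apply: lt_le_trans; rewrite absCV invr_gt0.
have mur n : r^-1 <= absC (mu n.+1).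
  by have [_] := allQ n; rewrite absCV invf_ple ?posrE.
have e0 : 0 < r^-1 / 2 by rewrite divr_gt0// invr_gt0.
have [n1 _ h1] := Hy _ e0 0%N; have [n2 n12 h2] := Hy _ e0 n1.+1.
have close : rnorm (A (u n1) - A (u n2)) < r^-1.
  have -> : A (u n1) - A (u n2) = (A (u n1) - y) - (A (u n2) - y).
    by rewrite opprB addrA subrK.
  rewrite (le_lt_trans (rnormB _ _))//; lra.
have orth : ip (A (u n1)) (A (u n2)) = 0.
  rewrite (Hu n1).2 (Hu n2).2 ipZl ipZr.
  rewrite (eigenvectors_orthogonal hip adj normalA (Hu n1).2 (Hu n2).2) ?mulr0//.
  apply/negP => /eqP /injmu E.
  have [] := E (allQ n1).1 (allQ n2).1; move: n12 => /[swap] ->.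
  by rewrite ltnn.
have := rnormB_sqr hip (A (u n1)) (A (u n2)); rewrite orth mulr0 subr0.
rewrite {2}(Hu n1).2 rnormZ (Hu n1).1 mulr1 => E.
have c2 : rnorm (A (u n1) - A (u n2)) ^+ 2 < (r^-1) ^+ 2.
  by rewrite ltr_pXn2r ?nnegrE ?rnorm_ge0// invr_ge0 ltW.
have c1 : (r^-1) ^+ 2 <= absC (mu n1.+1) ^+ 2.
  by rewrite ler_pXn2r ?nnegrE ?absC_ge0// invr_ge0 ltW.
have := sqr_ge0 (rnorm (A (u n2))); lra.
Qed.

(** A solution of [u - z A u = f] is exhibited as [f + z y], where [y] has the components on the
    right-hand side; hence [fredholm_resolvent] returns a solution, and projecting its equation
    determines the components. For [q] outside [Q], [lam q] only has to keep its distance from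
    [z]. *)
Lemma eigen_proj_resolvent (lam : nat -> R[i]) (z : R[i]) (d : R) f :
  (forall q, Q q -> lam q = (mu q)^-1) -> 0 < d ->
  (forall q, d <= absC (lam q - z)) ->
  forall q, eigen_proj q (A (fredholm_resolvent A z f)) =
    (lam q - z)^-1 *: eigen_proj q f.
Proof.
move=> lamE d0 hd.
have cb q : absC (lam q - z)^-1 <= d^-1.
  by rewrite absCV lef_pV2 ?posrE// (lt_le_trans d0).
have ln q : lam q - z != 0 by rewrite -absC_gt0 (lt_le_trans d0).
have [y [_ Py]] := diag_sum_cvg hip eigen_proj_lin eigen_proj_proj
  eigen_proj_orthogonal f cb.
have key q : Q q -> mu q * (1 + z * (lam q - z)^-1) = (lam q - z)^-1.
  move=> Qq; have l0 := ln q; have E : mu q = (lam q)^-1 by rewrite lamE// invrK.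
  have l1 : lam q != 0 by rewrite lamE// invr_eq0 mu_neq0.
  by rewrite E; field; rewrite l0 l1.
have AE : A (f + z *: y) = y.
  apply/eqP; rewrite -subr_eq0; apply/eqP/eigen_proj_total => q.
  rewrite (projB eigen_proj_lin) eigen_proj_A (projD eigen_proj_lin).
  rewrite (projZ eigen_proj_lin) Py.
  have [Qq|nQ] := pselect (Q q); last by rewrite eigen_proj_notin// !scaler0 addr0 scaler0 subrr.
  by rewrite scalerA -{1}[eigen_proj q f]scale1r -scalerDl scalerA key// subrr.
have : one_minus A z (fredholm_resolvent A z f) = f.
  rewrite /fredholm_resolvent; case: xgetP => [u -> //|].
  by move=> /(_ (f + z *: y)) h; exfalso; apply: h; rewrite /= /one_minus AE addrK.
set u := fredholm_resolvent A z f => Eu q.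
have [Qq|nQ] := pselect (Q q); last by rewrite !eigen_proj_notin// scaler0.
rewrite eigen_proj_A -[in RHS]Eu /one_minus (projB eigen_proj_lin).
rewrite (projZ eigen_proj_lin) eigen_proj_A scalerA.
rewrite -{2}[eigen_proj q u]scale1r -scalerBl scalerA; congr (_ *: _).
have l0 := ln q; have E : mu q = (lam q)^-1 by rewrite lamE// invrK.
have l1 : lam q != 0 by rewrite lamE// invr_eq0 mu_neq0.
by rewrite E; field; rewrite l0 l1.
Qed.

End EigenProjections.

(** * Geometry of the two contours *)

Section Sectors.
Variable R : realType.
Implicit Types (z w : R[i]) (phi theta : R).

Lemma acute_cos_gt0 (x : R) : 0 <= x -> x < pi / 2 -> 0 < cos x.
Proof.
by move=> x0 x1; have pi0 := pi_gt0 R; apply: cos_gt0_pihalf; apply/andP; split; lra.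
Qed.

Lemma acute_sin_gt0 (x : R) : 0 < x -> x < pi / 2 -> 0 < sin x.
Proof.
by move=> x0 x1; have pi0 := pi_gt0 R; apply: sin_gt0_pi; apply/andP; split; lra.
Qed.

Lemma cot_gt0 (x : R) : 0 < x -> x < pi / 2 -> 0 < cos x / sin x.
Proof. by move=> x0 x1; rewrite divr_gt0 ?acute_sin_gt0 ?acute_cos_gt0// ltW. Qed.

Lemma norm_argC_imp theta z : 0 <= theta -> theta < pi / 2 -> `|argC z| <= theta ->
  cos theta * `|Im z| <= sin theta * Re z.
Proof.
move=> t0 t1; have pi0 := pi_gt0 R.
have c0 : 0 < cos theta by apply: acute_cos_gt0; lra.
have s0 : 0 <= sin theta by apply: sin_ge0_pi; apply/andP; split; lra.
have [->|zn] := eqVneq z 0; first by rewrite normr0 !mulr0.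
rewrite norm_argC_le//; last by apply/andP; split; lra.
move=> h; have x0 : 0 <= Re z by rewrite (le_trans _ h)// mulr_ge0 ?absC_ge0 ?ltW.
have h2 : (cos theta * absC z) ^+ 2 <= Re z ^+ 2.
  by rewrite ler_pXn2r ?nnegrE ?mulr_ge0 ?absC_ge0 ?(ltW c0).
rewrite -(@ler_pXn2r _ 2) ?nnegrE ?mulr_ge0 ?(ltW c0)//.
move: h2; rewrite !exprMn absC_sqr real_normK ?num_real//.
have := cos2Dsin2 theta; move: (cos theta ^+ 2) (sin theta ^+ 2) => a b E.
have -> : b = 1 - a by lra.
lra.
Qed.

Lemma norm_argC_leE phi z : 0 < phi -> phi < pi / 2 ->
  (`|argC z| <= phi) = (cos phi / sin phi * `|Im z| <= Re z).
Proof.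
move=> p0 p1; have pi0 := pi_gt0 R.
have c0 : 0 < cos phi by apply: acute_cos_gt0; lra.
have s0 : 0 < sin phi by apply: acute_sin_gt0; lra.
apply/idP/idP => [h|h].
  rewrite mulrAC ler_pdivrMr// [Re z * _]mulrC.
  by apply: norm_argC_imp => //; exact: ltW.
have [->|zn] := eqVneq z 0; first by rewrite /argC eqxx normr0 ltW.
have x0 : 0 <= Re z.
  by rewrite (le_trans _ h)// mulr_ge0// divr_ge0// ltW.
have {}h : cos phi * `|Im z| <= sin phi * Re z.
  by move: h; rewrite mulrAC ler_pdivrMr// [Re z * _]mulrC.
rewrite norm_argC_le//; last by apply/andP; split; lra.
rewrite -(@ler_pXn2r _ 2) ?nnegrE ?mulr_ge0 ?absC_ge0 ?(ltW c0)//.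
have : (cos phi * `|Im z|) ^+ 2 <= (sin phi * Re z) ^+ 2.
  by rewrite ler_pXn2r ?nnegrE ?mulr_ge0 ?(ltW c0) ?(ltW s0).
rewrite !exprMn absC_sqr real_normK ?num_real//.
have := cos2Dsin2 phi; move: (cos phi ^+ 2) (sin phi ^+ 2) => a b E.
have -> : b = 1 - a by lra.
lra.
Qed.

Lemma norm_argC_eqE phi z : 0 < phi -> phi < pi / 2 -> z != 0 ->
  (`|argC z| = phi) <-> (cos phi / sin phi * `|Im z| = Re z).
Proof.
move=> p0 p1 zn; have pi0 := pi_gt0 R.
have c0 : 0 < cos phi by apply: acute_cos_gt0; lra.
have s0 : 0 < sin phi by apply: acute_sin_gt0; lra.
split=> h.
  have h1 : `|argC z| <= phi by rewrite h.
  apply/eqP; rewrite eq_le -norm_argC_leE// h1/=.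
  have x0 : 0 <= Re z.
    rewrite norm_argC_leE// in h1.
    by rewrite (le_trans _ h1)// mulr_ge0// divr_ge0// ltW.
  move: h; rewrite norm_argC// => h.
  have E : Re z = cos phi * absC z.
    by rewrite -h acosK ?in_itv/= ?Re_div_absC_bounds// divfK// absC_eq0.
  have E2 : Re z ^+ 2 = cos phi ^+ 2 * absC z ^+ 2 by rewrite {1}E exprMn.
  rewrite mulrAC ler_pdivlMr// mulrC.
  rewrite -(@ler_pXn2r _ 2) ?nnegrE ?mulr_ge0 ?(ltW c0) ?(ltW s0)//.
  move: E2; rewrite !exprMn absC_sqr real_normK ?num_real//.
  have := cos2Dsin2 phi; move: (cos phi ^+ 2) (sin phi ^+ 2) => a b E'.
  have -> : b = 1 - a by lra.
  lra.
apply/eqP; rewrite eq_le norm_argC_leE// h lexx/=.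
rewrite leNgt; apply/negP => lt.
have x0 : 0 <= Re z by rewrite -h mulr_ge0// divr_ge0// ltW.
have hs : cos phi * `|Im z| = sin phi * Re z.
  by rewrite -h; field; rewrite gt_eqF.
have ar : acos (Re z / absC z) < phi by rewrite -norm_argC.
have z1 : 0 < absC z by rewrite absC_gt0.
have : cos phi < Re z / absC z.
  have b := Re_div_absC_bounds zn.
  rewrite -[ltRHS]acosK ?in_itv// ltr_cos// in_itv/=.
    by rewrite acos_ge0// acos_lepi.
  by apply/andP; split; lra.
rewrite ltr_pdivlMr// -(@ltr_pXn2r _ 2) ?nnegrE ?mulr_ge0 ?absC_ge0 ?(ltW c0)//.
have : (cos phi * `|Im z|) ^+ 2 = (sin phi * Re z) ^+ 2 by rewrite hs.
rewrite !exprMn absC_sqr real_normK ?num_real//.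
have := cos2Dsin2 phi; move: (cos phi ^+ 2) (sin phi ^+ 2) => a b E'.
have -> : b = 1 - a by lra.
lra.
Qed.

(** The horizontal clearance between nested sectors is [x] times [1 - tan theta / tan phi], which is
    the quotient of sines and cosines in the statement. *)
Lemma sector_gap theta phi (x y c : R) : 0 <= theta -> theta < phi -> phi < pi / 2 ->
  0 <= c -> c <= x -> cos theta * y <= sin theta * x ->
  c * (sin (phi - theta) / (sin phi * cos theta)) <= x - cos phi / sin phi * y.
Proof.
move=> t0 tp p1 c0 cx h; have pi0 := pi_gt0 R.
have ct : 0 < cos theta by apply: acute_cos_gt0; lra.
have cp : 0 < cos phi by apply: acute_cos_gt0; lra.
have sp : 0 < sin phi by apply: acute_sin_gt0; lra.
have s0 : 0 < sin (phi - theta) by apply: acute_sin_gt0; lra.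
apply: (@le_trans _ _ (x * (sin (phi - theta) / (sin phi * cos theta)))).
  by rewrite ler_wpM2r// divr_ge0 ?mulr_ge0 ?ltW.
rewrite sinB mulrBl mulrBr lerB//.
  rewrite -[leRHS]mulr1 le_eqVlt; apply/orP; left; apply/eqP.
  by field; rewrite !gt_eqF.
have -> : cos phi / sin phi * y = (cos phi / (sin phi * cos theta)) * (cos theta * y).
  by field; rewrite !gt_eqF.
have -> : x * (cos phi * sin theta / (sin phi * cos theta)) =
    (cos phi / (sin phi * cos theta)) * (sin theta * x) by ring.
by rewrite ler_wpM2l// divr_ge0 ?mulr_ge0 ?ltW.
Qed.

Lemma sector_margin_gt0 theta phi : 0 <= theta -> theta < phi -> phi < pi / 2 ->
  0 < sin (phi - theta) / (sin phi * cos theta).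
Proof.
move=> t0 tp p1; rewrite divr_gt0 ?mulr_gt0//.
- by apply: acute_sin_gt0; lra.
- by apply: acute_sin_gt0; lra.
- by apply: acute_cos_gt0; lra.
Qed.

Lemma ReV z : Re z^-1 = Re z / absC z ^+ 2.
Proof. by rewrite absC_sqr; case: z. Qed.

Lemma ImV z : Im z^-1 = - Im z / absC z ^+ 2.
Proof. by rewrite absC_sqr; case: z => a b /=; rewrite mulNr. Qed.

(** With equal slopes and [iota = 0], [arc_height] already dominates the second sector. *)
Lemma gamma_contour_graph phi (r : R) : 0 < phi -> phi < pi / 2 -> 0 < r ->
  gamma_contour phi r = range (graph_path r (cos phi / sin phi) (cos phi / sin phi) 0).
Proof.
move=> p0 p1 r0; have pi0 := pi_gt0 R.
have c0 : 0 < cos phi by apply: acute_cos_gt0; lra.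
have s0 : 0 < sin phi by apply: acute_sin_gt0; lra.
set k := cos phi / sin phi; have k0 : 0 < k by rewrite divr_gt0.
have gE y : graph_height r k k 0 y = arc_height r k y.
  by rewrite /graph_height add0r (max_idPl (arc_height_ge_line _ k0 _)).
have sq y : arc_height r k y ^+ 2 = Num.max (r ^+ 2 - y ^+ 2) (k ^+ 2 * y ^+ 2).
  by rewrite sqr_sqrtr// le_max mulr_ge0 ?orbT// sqr_ge0.
have zn z : r <= absC z -> z != 0.
  by move=> h; rewrite -absC_gt0 (lt_le_trans r0).
apply/seteqP; split=> z.
  move=> h; exists (Im z) => //; rewrite /graph_path gE.
  suff -> : arc_height r k (Im z) = Re z by case: (z).
  have ky : k ^+ 2 * Im z ^+ 2 = (k * `|Im z|) ^+ 2.
    by rewrite [RHS]exprMn real_normK ?num_real.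
  case: h => [[ar]|[ar]].
    rewrite norm_argC_leE// -/k => h.
    have x0 : 0 <= Re z by rewrite (le_trans _ h)// mulr_ge0// ltW.
    have E : r ^+ 2 - Im z ^+ 2 = Re z ^+ 2 by rewrite -ar absC_sqr addrK.
    rewrite /arc_height E (max_idPl _) ?sqrtr_sqr ?ger0_norm// ky.
    by rewrite ler_pXn2r ?nnegrE// mulr_ge0// ltW.
  have zn' : z != 0 by apply: zn; exact: ltW.
  rewrite norm_argC_eqE// -/k => h.
  have x0 : 0 <= Re z by rewrite -h mulr_ge0// ltW.
  rewrite /arc_height ky h (max_idPr _) ?sqrtr_sqr ?ger0_norm//.
  rewrite lerBlDr -absC_sqr ler_pXn2r ?nnegrE ?absC_ge0// ltW//.
move=> [y _ <-]; rewrite /graph_path gE; set x := arc_height r k y.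
have x0 : 0 <= x := arc_height_ge0 r k y.
have hl : k * `|y| <= x := arc_height_ge_line r k0 y.
have ky : k ^+ 2 * y ^+ 2 = (k * `|y|) ^+ 2 by rewrite [RHS]exprMn real_normK ?num_real.
have a2 : absC (x +i* y) ^+ 2 = x ^+ 2 + y ^+ 2 by rewrite absC_sqr.
have [h|h] := leP (k ^+ 2 * y ^+ 2) (r ^+ 2 - y ^+ 2).
  left; split; last by rewrite norm_argC_leE.
  apply/eqP; rewrite -(@eqrXn2 _ 2) ?absC_ge0// ?ltW//; apply/eqP.
  by rewrite a2 sq (max_idPl h) subrK.
right; have xE : x = k * `|y|.
  by rewrite /x /arc_height (max_idPr (ltW h)) ky sqrtr_sqr ger0_norm// mulr_ge0// ltW.
have ra : r < absC (x +i* y).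
  rewrite -(@ltr_pXn2r _ 2) ?nnegrE ?absC_ge0// ?(ltW r0)// a2 xE -ky.
  by rewrite -ltrBlDr.
by split=> //; rewrite norm_argC_eqE// zn// ltW.
Qed.

(** The set whose boundary is taken is [{ h (Im z) <= Re z }] for a Lipschitz [h]: it is closed, and
    its interior is given by the strict inequality. *)
Lemma Gamma_contour_graph phi0 iota phi (r : R) :
  0 < phi0 -> phi0 < pi / 2 -> 0 < phi -> phi < pi / 2 -> 0 < r ->
  Gamma_contour phi0 iota phi r =
    range (graph_path r (cos phi0 / sin phi0) (cos phi / sin phi) iota).
Proof.
move=> p00 p01 p0 p1 r0; have pi0 := pi_gt0 R.
set k0 := cos phi0 / sin phi0; set k1 := cos phi / sin phi.
have k00 : 0 < k0 by exact: cot_gt0.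
have k10 : 0 < k1 by exact: cot_gt0.
pose E : set R[i]^o := (sector 0 phi0 `&` sector iota phi) `\`
  [set z | absC z < r /\ `|argC z| <= phi0].
rewrite -[LHS]/(closure E `\` E°).
set h := graph_height r k0 k1 iota.
have lip := @graph_height_lipschitz R r k0 k1 iota k00 k10; rewrite -/h in lip.
set Lip := (1 + k0 ^+ 2) / k0 + k1 in lip.
have Lip0 : 0 < Lip by rewrite addr_gt0// divr_gt0// ltr_wpDr ?sqr_ge0.
have inE z : E z <-> h (Im z) <= Re z.
  have s1 : sector 0 phi0 z <-> k0 * `|Im z| <= Re z.
    by rewrite /sector /= subr0 norm_argC_leE.
  have s2 : sector iota phi z <-> iota + k1 * `|Im z| <= Re z.
    rewrite /sector /= norm_argC_leE// ImD ReD ImN ReN /= subr0.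
    by rewrite -lerBrDl.
  have rE : (r <= absC z) = (r ^+ 2 <= Re z ^+ 2 + Im z ^+ 2).
    by rewrite -absC_sqr ler_pXn2r ?nnegrE ?absC_ge0// ltW.
  split.
    move=> [[/s1 h1 /s2 h2] h3].
    have x0 : 0 <= Re z by rewrite (le_trans _ h1)// mulr_ge0// ltW.
    rewrite graph_height_le// h1 h2 !andbT -rE leNgt; apply/negP => lt.
    by apply: h3; split=> //; move/s1: h1; rewrite /sector /= subr0.
  move=> hz; have x0 : 0 <= Re z := le_trans (graph_height_ge0 _ _ _ _ _) hz.
  move: hz; rewrite /h graph_height_le// => /and3P[h1 h2 h3].
  split; first by split; [apply/s1|apply/s2].
  by move=> [lt _]; move: h1; rewrite -rE leNgt lt.
have lipE z w : h (Im z) <= h (Im w) + Lip * absC (z - w).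
  have := lip (Im z) (Im w); rewrite ler_norml => /andP[_ h1].
  have : Lip * `|Im z - Im w| <= Lip * absC (z - w).
    by rewrite ler_pM2l// -ImN -ImD Im_le_absC.
  lra.
have ReB z w : Re w <= Re z + absC (z - w).
  have := Re_le_absC (w - z); rewrite ReD ReN absC_sub.
  by rewrite ler_norml => /andP[_]; lra.
have clE z : closure E z <-> h (Im z) <= Re z.
  split=> [cz|hz]; last by apply: subset_closure; apply/inE.
  apply/ler_addgt0Pr => e e0.
  have L1 : 0 < Lip + 1 by lra.
  have [w /inE Ew wz] := iffLR (@closure_rnormP _ R[i]^o _ _) cz _ (divr_gt0 e0 L1).
  have {}wz : (Lip + 1) * absC (w - z) <= e.
    by rewrite mulrC -ler_pdivlMr//; exact: ltW.
  have := lipE z w; have := ReB z w; rewrite (absC_sub z w); lra.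
have intE z : (E°) z <-> h (Im z) < Re z.
  split=> [/nbhs_rnormP[e e0 He]|hz].
    have e2 : 0 < e / 2 by rewrite divr_gt0.
    have ez : absC (z - (e / 2)%:C - z) < e.
      rewrite addrAC subrr sub0r absCN absC_real gtr0_norm//; lra.
    have /inE := He (z - (e / 2)%:C) ez.
    rewrite ReD ImD ReN ImN /= subr0; lra.
  apply/nbhs_rnormP; have L1 : 0 < Lip + 1 by lra.
  exists ((Re z - h (Im z)) / (Lip + 1)).
    by rewrite divr_gt0// subr_gt0.
  move=> w /= wz; apply/inE.
  have {}wz : (Lip + 1) * absC (w - z) <= Re z - h (Im z).
    by rewrite mulrC -ler_pdivlMr//; exact: ltW.
  have := lipE w z; have := ReB w z; lra.
apply/seteqP; split=> z.
  move=> [/clE h1 /intE h2]; exists (Im z) => //.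
  have -> : z = Re z +i* Im z by case: (z).
  by rewrite /graph_path /=; congr (_ +i* _); apply/eqP; rewrite eq_le h1 leNgt; apply/negP.
move=> [y _ <-]; split; first by apply/clE.
by move=> /intE; rewrite /= ltxx.
Qed.

Lemma graph_contour_param (r k0 k1 iota : R) : 0 < k0 -> 0 < k1 ->
  contour_param (graph_path r k0 k1 iota) (range (graph_path r k0 k1 iota)).
Proof.
move=> k00 k10; split=> //.
- exact: lipschitz_path_continuous (@graph_path_lipschitz R r k0 k1 iota k00 k10).
- by move=> s t [].
Qed.

End Sectors.

(** What the two cases of the theorem have in common. [psi] is an angle of decay slightly larger
    than that of the contour, and [gap] is the horizontal clearance of the characteristic
    numbers. *)
Definition graph_contour_data (R : realType) (alpha : R) (varpi : set R[i]^o)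
    (Q : set nat) (mu : nat -> R[i]) : Prop :=
  exists r k0 k1 iota psi gap : R,
  [/\ [/\ 0 < r, 0 < k0, 0 < k1 & iota <= 0],
      [/\ 0 < psi, psi < pi / 2, alpha * psi < pi / 2 & 1 < k1 * tan psi],
      varpi = range (graph_path r k0 k1 iota), 0 < gap &
      forall q, Q q -> gap <= Re (mu q)^-1 -
        graph_height r k0 k1 iota (Im (mu q)^-1)].

(** [psi] is halfway between [phi] and [pi / (2 * alpha)]; the surplus over [phi] is what absorbs a
    negative vertex in [region_decay]. *)
Lemma intermediate_angle (R : realType) (alpha phi : R) :
  1 < alpha -> 0 < phi -> phi < pi / (2 * alpha) -> phi < pi / 2 /\
  exists psi : R, [/\ 0 < psi, psi < pi / 2, alpha * psi < pi / 2 &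
    1 < cos phi / sin phi * tan psi].
Proof.
move=> a1 p0 p1; have pi0 := pi_gt0 R; have a0 : 0 < alpha by lra.
have E : pi / (2 * alpha) = (pi / 2) / alpha :> R by field; rewrite gt_eqF.
have h2 : pi / (2 * alpha) < pi / 2 :> R.
  by rewrite E ltr_pdivrMr// ltr_pMr//; lra.
split; first exact: lt_trans p1 h2.
exists ((phi + pi / (2 * alpha)) / 2); set psi := _ / 2.
have q0 : phi < psi by rewrite /psi; lra.
have q1 : psi < pi / (2 * alpha) by rewrite /psi; lra.
clearbody psi; split; [lra|lra| |].
  by rewrite mulrC -ltr_pdivlMr// -E.
have cp : 0 < cos psi by apply: acute_cos_gt0; lra.
have sf : 0 < sin phi by apply: acute_sin_gt0; lra.
have s0 : 0 < sin (psi - phi) by apply: acute_sin_gt0; lra.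
have -> : cos phi / sin phi * tan psi = (sin psi * cos phi) / (cos psi * sin phi).
  by rewrite /tan; field; rewrite !gt_eqF.
rewrite ltr_pdivlMr ?mulr_gt0// mul1r.
by move: s0; rewrite sinB subr_gt0.
Qed.

(** * Clearance of the characteristic numbers from both contours *)

Section ContourGeometry.
Variables (R : realType) (H Hp : completeNormedModType R[i]).
Variables (ip : {dot H for @conjc R}) (J : {linear Hp -> H}).
Variables (L : set (H * H)) (M : set Hp) (C0 C1 C2 : R) (A : {linear H -> H}).
Variables (Q : set nat) (mu : nat -> R[i]).
Hypothesis hip : hilbert ip.
Hypothesis H1 : condition_H1 J L M C0.
Hypothesis H2 : condition_H2 ip J L M C1 C2.
Hypothesis AW : forall p, Wtilde J L M p <-> p.1 = A p.2.
Hypothesis charQ : characteristic_sequence A Q mu.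

Let C00 : 0 < C0. Proof. by case: H1 => _ [] []. Qed.
Let C20 : 0 < C2. Proof. by case: H2. Qed.

Lemma numerical_range_eigen (T : set (H * H)) (c : R[i]) x : x != 0 ->
  (forall a : R[i], T (a *: x, a *: (c *: x))) -> numerical_range ip T c.
Proof.
move=> xn hT; have n0 : rnorm x != 0 by rewrite rnorm_eq0.
pose a : R[i] := ((rnorm x)^-1)%:C.
have na : `|a *: x| = 1.
  by rewrite normrZ normCE absC_real rnormE normrV ?unitfE// ger0_norm ?rnorm_ge0//
    -rmorphM mulVf.
exists (a *: x, a *: (c *: x)) => //=.
by rewrite scalerA mulrC -scalerA ipZl hip na expr1n mulr1.
Qed.

(** The first characteristic number has the least modulus and is not regular; with no eigenvalue at
    all, any [rho > r] will do. *)
Lemma characteristic_modulus_gt (r : R) : (forall z, absC z <= r -> regular_point A z) ->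
  exists2 rho : R, r < rho & forall q, Q q -> rho <= absC (mu q)^-1.
Proof.
move=> reg; have [Q1 _ _ Qm] := charQ.
have [Q1'|nQ] := pselect (Q 1%N); last first.
  exists (r + 1) => [|q Qq]; first by rewrite ltrDl.
  have [q0 h] := Q1 _ Qq; by case: nQ; apply: h; rewrite ltn0Sn.
exists (absC (mu 1%N)^-1) => [|q Qq]; last by apply: Qm => //; case: (Q1 _ Qq).
rewrite ltNge; apply/negP => /reg[B [_ _ BK]].
have [x xn Ex] := mu_eigenvector charQ Q1'.
have := BK x; rewrite /one_minus Ex scalerA mulVf ?(mu_neq0 charQ)//.
by rewrite scale1r subrr linear0 => /esym/eqP; rewrite (negPf xn).
Qed.

Lemma graph_contour_data_intro (alpha r k0 k1 iota psi gap : R) (varpi : set R[i]^o) :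
  0 < r -> (forall z, absC z <= r -> regular_point A z) ->
  0 < k0 -> 0 < k1 -> iota <= 0 ->
  [/\ 0 < psi, psi < pi / 2, alpha * psi < pi / 2 & 1 < k1 * tan psi] ->
  varpi = range (graph_path r k0 k1 iota) -> 0 < gap ->
  (forall q, Q q ->
     gap <= Re (mu q)^-1 - k0 * `|Im (mu q)^-1| /\
     gap <= Re (mu q)^-1 - (iota + k1 * `|Im (mu q)^-1|)) ->
  graph_contour_data alpha varpi Q mu.
Proof.
move=> r0 reg k00 k10 i0 hpsi E g0 hg.
have [rho rrho hrho] := characteristic_modulus_gt reg.
exists r, k0, k1, iota, psi.
exists (Num.min gap (Num.min 1 ((rho ^+ 2 - r ^+ 2) / (2 * r + 1)))).
split=> // [|q Qq].
  rewrite !lt_min g0 ltr01/= divr_gt0//; last by lra.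
  by rewrite subr_gt0 ltr_pXn2r ?nnegrE ?(ltW r0)// (le_trans _ (ltW rrho)) ?(ltW r0).
by have [h1 h2] := hg q Qq; exact: graph_gap (hrho q Qq) h1 h2.
Qed.

(** Eigenvalues lie in the numerical range of [A], and inversion preserves a sector symmetric about
    the real axis; coercivity keeps the characteristic numbers away from its vertex. *)
Lemma contour_case_i_data (alpha : R) (varpi : set R[i]^o) : 1 < alpha ->
  contour_case_i ip A alpha varpi -> graph_contour_data alpha varpi Q mu.
Proof.
move=> a1 [theta [eps [r [[t0 t1] hnum [e0 e1] [r0 reg] E]]]].
have p0 : 0 < theta + eps by lra.
have [p1 [psi hpsi]] := intermediate_angle a1 p0 e1.
have k0 := cot_gt0 p0 p1; have pi0 := pi_gt0 R.
have t2 : theta < pi / 2 by lra.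
set c := C2 / C0 ^+ 2; have c0 : 0 < c by rewrite divr_gt0// exprn_gt0.
pose s := sin (theta + eps - theta) / (sin (theta + eps) * cos theta).
have s0 : 0 < s by apply: sector_margin_gt0; lra.
apply: (graph_contour_data_intro r0 reg k0 k0 (lexx 0) hpsi).
- by rewrite E gamma_contour_graph.
- exact: mulr_gt0 c0 s0.
move=> q Qq; rewrite add0r; suff h : c * s <= Re (mu q)^-1 -
  cos (theta + eps) / sin (theta + eps) * `|Im (mu q)^-1| by [].
have [x xn Ex] := mu_eigenvector charQ Qq; have mn := mu_neq0 charQ Qq.
have hc := eigenvalue_Re_ge hip H1 H2 AW xn mn Ex.
apply: sector_gap => //; [lra|exact: ltW|].
have : sector 0 theta (mu q).
  by apply: hnum; apply: numerical_range_eigen xn _ => a; rewrite -Ex /op_graph /= linearZ.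
rewrite /sector /= subr0 => /(norm_argC_imp t0 t2) h.
have m0 : 0 < absC (mu q) ^+ 2 by rewrite exprn_gt0// absC_gt0.
rewrite ReV ImV mulNr normrN normrM (ger0_norm (x := (_ ^+ 2)^-1)) ?invr_ge0 ?(ltW m0)//.
by rewrite !mulrA ler_pM2r// invr_gt0.
Qed.

(** The two signs give the half-planes whose intersection is the sector at [iota]. Half of
    [C2 |f|^2] yields the first term of [iota]; the other half absorbs [kappa C3 |f| |J f|] by
    completing the square, at the price of the second term. *)
Lemma Wtilde_parabola (C3 kappa sg : R) p : 0 < C3 -> 0 < kappa -> `|sg| = 1 ->
  (forall f h, M f -> M h -> forall Lf, L (J f, Lf) ->
     `|Im (ip Lf (J h))| <= C3 * rnorm f * rnorm (J h)) ->
  Wtilde J L M p ->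
  (C2 / (2 * C0 ^+ 2) - (kappa * C3) ^+ 2 / (2 * C2)) * rnorm p.1 ^+ 2 <=
    Re ((1 +i* (sg * kappa)) * ip p.2 p.1).
Proof.
move=> C30 k0 sg1 hIm; apply: (closure_form_ge hip) => -[x y] [Ly [f Mf Jf]] /=.
move: Ly Jf => /= Ly Jf; subst x; have [_ [_ hJ] _ _] := H1; have [_ _ h2] := H2.
have [_ hRe] := h2 f f Mf Mf y Ly; have hI := hIm f f Mf Mf y Ly.
rewrite ReM /= mul1r; set n := rnorm (J f); set F := rnorm f.
have n0 : 0 <= n by exact: rnorm_ge0.
have F0 : 0 <= F by exact: rnorm_ge0.
have h1 : sg * kappa * Im (ip y (J f)) <= kappa * (C3 * F * n).
  apply: le_trans (ler_norm _) _; rewrite !normrM sg1 mul1r (gtr0_norm k0).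
  by rewrite ler_pM2l.
have h3 : C2 / (2 * C0 ^+ 2) * n ^+ 2 <= C2 / 2 * F ^+ 2.
  have -> : C2 / (2 * C0 ^+ 2) * n ^+ 2 = C2 / 2 * (n ^+ 2 / C0 ^+ 2).
    by field; rewrite gt_eqF.
  rewrite ler_pM2l ?divr_gt0// ler_pdivrMr ?exprn_gt0// mulrC -exprMn.
  by rewrite ler_pXn2r ?nnegrE ?mulr_ge0 ?(ltW C00)//; exact: hJ.
have h4 : 0 <= (C2 * F - kappa * C3 * n) ^+ 2 / (2 * C2).
  by rewrite divr_ge0 ?sqr_ge0// mulr_ge0// ltW.
have E : (C2 * F - kappa * C3 * n) ^+ 2 / (2 * C2) =
    C2 / 2 * F ^+ 2 - kappa * (C3 * F * n) + (kappa * C3) ^+ 2 / (2 * C2) * n ^+ 2.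
  by field; rewrite gt_eqF.
rewrite E in h4; move: hRe h1 h3 h4; rewrite -/F mulrBl.
move: ((kappa * C3) ^+ 2 / (2 * C2) * n ^+ 2) (C2 / (2 * C0 ^+ 2) * n ^+ 2).
move: (kappa * (C3 * F * n)) (sg * kappa * Im (ip y (J f))) => a b c d.
have -> : C2 / 2 * F ^+ 2 = C2 * F ^+ 2 / 2 by ring.
lra.
Qed.

Lemma contour_case_ii_data (alpha : R) (varpi : set R[i]^o) : 1 < alpha ->
  contour_case_ii ip J L M C0 C2 A alpha varpi ->
  graph_contour_data alpha varpi Q mu.
Proof.
move=> a1 [C3 [kappa [theta0 [eps [r]]]]] /=.
set iota := _ - _; set thetai := atan _.
move=> [[C30 hIm] [t0 t1 hnum] [k0 i0 _] [e0 e1 e2] [[r0 reg] E]].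
have pi0 := pi_gt0 R.
have ti0 : 0 < thetai.
  have tk : 0 < tan thetai by rewrite /thetai atanK divr_gt0.
  rewrite ltNge; apply/negP => neg; have := atan_gtNpi2 (1 / kappa); rewrite -/thetai => gt.
  have cn : 0 < cos thetai by apply: cos_gt0_pihalf; apply/andP; split; lra.
  have : 0 <= sin (- thetai) by apply: sin_ge0_pi; apply/andP; split; lra.
  by rewrite sinN oppr_ge0 leNgt; move: tk; rewrite /tan pmulr_lgt0 ?invr_gt0// => ->.
have p0 : 0 < thetai + eps by lra.
have q0 : 0 < theta0 + eps by lra.
have [p1 [psi hpsi]] := intermediate_angle a1 p0 e1.
have ti1 : thetai < pi / 2 by lra.
set c := C2 / C0 ^+ 2; have c0 : 0 < c by rewrite divr_gt0// exprn_gt0.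
pose s (th : R) := sin (th + eps - th) / (sin (th + eps) * cos th).
have s0 (th : R) : 0 <= th -> th + eps < pi / 2 -> 0 < s th.
  by move=> h1 h2; apply: sector_margin_gt0; lra.
apply: (@graph_contour_data_intro alpha r (cos (theta0 + eps) / sin (theta0 + eps))
  (cos (thetai + eps) / sin (thetai + eps)) iota psi
  (Num.min (c * s theta0) (c * s thetai))) => //.
- exact: cot_gt0.
- exact: cot_gt0.
- exact: ltW.
- by rewrite E Gamma_contour_graph.
- by rewrite lt_min; apply/andP; split; apply: mulr_gt0 c0 _; apply: s0 => //; exact: ltW.
move=> q Qq; have [x xn Ex] := mu_eigenvector charQ Qq; have mn := mu_neq0 charQ Qq.
have hc := eigenvalue_Re_ge hip H1 H2 AW xn mn Ex.
set lam := (mu q)^-1 in hc *.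
have Wx (a : R[i]) : Wtilde J L M (a *: x, a *: (lam *: x)).
  by apply/AW; rewrite /= !linearZ/= Ex [lam *: _]scalerA /lam mulVf// scale1r.
split.
  apply: (@le_trans _ _ (c * s theta0)); first by rewrite ge_min lexx.
  apply: sector_gap => //; [lra|exact: ltW|].
  have : sector 0 theta0 lam by apply: hnum; exact: numerical_range_eigen xn Wx.
  by rewrite /sector /= subr0 => /(norm_argC_imp t0 t1).
apply: (@le_trans _ _ (c * s thetai)); first by rewrite ge_min lexx orbT.
(* The sector has vertex [iota], so the gap is computed for [lam - iota], whose real part is even
   larger than that of [lam]. *)
rewrite opprD addrA; apply: sector_gap => //; [exact: ltW|lra|exact: ltW| |].
  by apply: (le_trans hc); rewrite lerDl oppr_ge0 ltW.
have par (sg : R) : `|sg| = 1 -> iota <= Re lam - sg * kappa * Im lam.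
  move=> sg1; have := Wtilde_parabola C30 k0 sg1 hIm (Wx 1).
  rewrite /= !scale1r ipZl mulrA (ip_sqr hip) -/iota.
  have n0 : 0 < rnorm x ^+ 2 by rewrite exprn_gt0// rnorm_gt0.
  rewrite ReM ImM /= mulr0 subr0 ler_pM2r// ReM /= mul1r.
  by [].
have hk : kappa * `|Im lam| <= Re lam - iota.
  have := par 1 (normr1 _); have := par (-1) (etrans (normrN _) (normr1 _)).
  rewrite mul1r mulN1r; case: ger0P => h; lra.
have ct : 0 < cos thetai by apply: acute_cos_gt0; lra.
have st : sin thetai = cos thetai / kappa.
  have : tan thetai = 1 / kappa by rewrite /thetai atanK.
  by rewrite /tan => h; rewrite -[LHS](divfK (lt0r_neq0 ct)) h mul1r mulrC.
rewrite st -mulrA ler_pM2l//.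
by rewrite mulrC ler_pdivlMr// mulrC.
Qed.

End ContourGeometry.

(** * Grouping of the characteristic numbers *)

(** Comparison with a telescoping series: [K / x^2 <= 2 K (1 / x - 1 / (x + 1))] for [x >= 1]. The
    term of index 0 is arbitrary. *)
Lemma series_cvg_inverse_square (R : realType) (u : nat -> R) (K : R) :
  (forall n, 0 <= u n) -> (forall n, u n.+1 * n.+1%:R ^+ 2 <= K) -> cvgn (series u).
Proof.
move=> u0 uK; have K0 : 0 <= K.
  by apply: le_trans (uK 0%N); rewrite mulr_ge0// sqr_ge0.
apply: nondecreasing_is_cvgn.
  by apply/nondecreasing_seqP => n; rewrite /series/= big_nat_recr//= lerDl.
have bd n : series u n.+1 <= u 0%N + 2 * K * (1 - n.+1%:R^-1).
  elim: n => [|n IH]; first by rewrite /series/= big_nat1 invr1 subrr mulr0 addr0.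
  rewrite /series/= big_nat_recr//=; apply: le_trans (lerD IH (lexx _)) _.
  rewrite -addrA lerD2l.
  have x0 : 0 < n.+1%:R :> R by rewrite ltr0n.
  have x1 : 1 <= n.+1%:R :> R by rewrite ler1n.
  have : u n.+1 <= K / n.+1%:R ^+ 2 by rewrite ler_pdivlMr ?exprn_gt0.
  rewrite -[n.+2%:R]natr1; move: (n.+1%:R) x0 x1 => x x0 x1 h.
  have : K / x ^+ 2 <= 2 * K * (x^-1 - (x + 1)^-1).
    have -> : 2 * K * (x^-1 - (x + 1)^-1) = (K / x ^+ 2) * (2 * x / (x + 1)).
      by field; rewrite !gt_eqF//; lra.
    rewrite ler_peMr ?divr_ge0 ?sqr_ge0// ler_pdivlMr; lra.
  lra.
exists (u 0%N + 2 * K) => _ [n _ <-].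
have h : 2 * K * (1 - n.+1%:R^-1) <= 2 * K.
  by rewrite ler_piMr ?mulr_ge0// gerBl invr_ge0.
apply: (@le_trans _ _ (series u n.+1)); last by apply: le_trans (bd n) _; rewrite lerD2l.
by rewrite /series/= big_nat_recr//= lerDl.
Qed.

Section Grouping.
Variables (R : realType) (Q : set nat) (a : nat -> R) (tau : R).
Hypotheses (indexQ : index_set Q) (a_gt0 : forall q, Q q -> 0 < a q).
Hypothesis a_mono : forall p q, Q p -> Q q -> (p <= q)%N -> a p <= a q.
Hypothesis a_unbounded : forall x : R, exists N, forall q, (N <= q)%N -> Q q -> x < a q.
Hypotheses (tau0 : 0 < tau) (tau1 : tau < 1).

Let cell q := Num.truncn (a q `^ (1 / tau)).

Let cell_mono p q : Q p -> Q q -> (p <= q)%N -> (cell p <= cell q)%N.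
Proof.
move=> Qp Qq pq; apply: le_truncn.
by rewrite ge0_ler_powR ?divr_ge0 ?(ltW tau0)// ?nnegrE ?(ltW (a_gt0 _))// a_mono.
Qed.

Let powR_tauVK x : 0 <= x -> (x `^ (1 / tau)) `^ tau = x.
Proof. by move=> x0; rewrite -powRrM mul1r mulVf ?gt_eqF// powRr1. Qed.

(** [m] is the last index in the cell of [n.+1], which exists because [a] is unbounded. If the
    sequence stops before [n.+1], one nonexistent index is consumed, so that [N] is defined
    everywhere. *)
Let cell_succ n : exists m, [/\ (n < m)%N,
  forall q, Q q -> (n < q)%N -> (q <= m)%N -> cell q = cell n.+1 &
  forall q, Q q -> (m < q)%N -> (cell n.+1 < cell q)%N].
Proof.
have [Qn|nQ] := pselect (Q n.+1); last first.
  exists n.+1; split=> // q Qq nq => [qn|]; last first.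
    by case: nQ; have [_ h] := indexQ Qq; apply: h; rewrite /= ltnW.
  by case: nQ; have [_ h] := indexQ Qq; apply: h.
have [N HN] := a_unbounded ((cell n.+1).+1%:R `^ tau).
pose P q := `[< Q q /\ cell q = cell n.+1 >].
have exP : exists q, P q by exists n.+1; apply/asboolP.
have ubP q : P q -> (q <= N)%N.
  move=> /asboolP[Qq Eq]; rewrite leqNgt; apply/negP => Nq.
  have := HN q (ltnW Nq) Qq; rewrite ltNge => /negP; apply.
  rewrite -[a q]powR_tauVK ?(ltW (a_gt0 Qq))//.
  rewrite ge0_ler_powR ?(ltW tau0) ?nnegrE ?powR_ge0//.
  by rewrite -Eq ltW// truncnS_gt.
exists (ex_maxn exP ubP); case: ex_maxnP => M /asboolP[QM EM] Mmax.
split=> [|q Qq nq qM|q Qq Mq].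
- by apply: Mmax; apply/asboolP.
- by apply/eqP; rewrite eqn_leq (cell_mono Qn Qq nq) -{1}EM cell_mono.
- have nM : (n < M)%N by apply: Mmax; apply/asboolP.
  rewrite ltn_neqAle cell_mono// ?(ltnW (leq_ltn_trans nM Mq))// andbT.
  apply/eqP => E; have : P q by apply/asboolP.
  by move=> /Mmax; rewrite leqNgt Mq.
Qed.

(* The groups are the blocks of indices whose [a q `^ (1 / tau)] have the same
   integer part: consecutive terms of a group are then close, while the integer
   part grows by at least one from a group to the next. *)
Lemma grouping_exists : exists N : nat -> nat,
  [/\ N 0%N = 0%N, forall nu, (N nu < N nu.+1)%N,
      forall nu q, Q q -> (N nu < q)%N -> nu%:R `^ tau <= a q &
      forall nu l, (2 <= l <= N nu.+1 - N nu)%N -> Q (N nu + l)%N ->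
        a (N nu + l)%N - a (N nu + l - 1)%N <= a (N nu + l)%N `^ (1 - 1 / tau)].
Proof.
have [next hnext] := choice cell_succ.
pose N := fun nu => iter nu next 0%N.
have Nlt nu : (N nu < N nu.+1)%N by have [] := hnext (N nu).
have Ncell nu q : Q q -> (N nu < q)%N -> (nu <= cell q)%N.
  elim: nu q => [//|nu IH] q Qq Nq; have [h1 _ h3] := hnext (N nu).
  apply: leq_ltn_trans (h3 _ Qq Nq); apply: IH => //.
  have [_ h] := indexQ Qq; apply: h => /=.
  exact: ltnW (leq_ltn_trans (Nlt nu) Nq).
exists N; split=> // [nu q Qq Nq|nu l /andP[l2 lN] Ql].
  rewrite -[leRHS]powR_tauVK ?(ltW (a_gt0 Qq))//.
  rewrite ge0_ler_powR ?(ltW tau0) ?nnegrE ?powR_ge0//.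
  by rewrite -truncn_ge_nat ?powR_ge0//; exact: Ncell.
set q := (N nu + l)%N in Ql *; have [_ h2 _] := hnext (N nu).
have l1 : (1 < l)%N by [].
have Nq1 : (N nu < q - 1)%N by rewrite ltn_subRL addnC ltn_add2l.
have q1q : (q - 1 <= q)%N by rewrite leq_subr.
have qN : (q <= N nu.+1)%N by rewrite /q -leq_subRL// ltnW.
have Qp : Q (q - 1)%N.
  by have [_ h] := indexQ Ql; apply: h; rewrite q1q (leq_ltn_trans _ Nq1).
have E1 := h2 _ Ql (leq_trans Nq1 q1q) qN.
have E2 := h2 _ Qp Nq1 (leq_trans q1q qN).
have aq := a_gt0 Ql; have ap := a_gt0 Qp; have apq := a_mono Qp Ql q1q.
set x := a q in aq apq *; set y := a (q - 1)%N in ap apq *.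
have X0 : 0 < x `^ (1 / tau) by exact: powR_gt0.
have XY : x `^ (1 / tau) - y `^ (1 / tau) <= 1.
  have := truncnS_gt (x `^ (1 / tau)).
  have : (Num.truncn (y `^ (1 / tau)))%:R <= y `^ (1 / tau) by rewrite truncn_le powR_ge0.
  move: E1 E2; rewrite /cell -/x -/y => -> ->; rewrite -natr1; lra.
(* Since [y / x <= 1] and the exponent exceeds 1, powers lie below the identity. With [XY] this
   gives [(x - y) / x] times the power of [x] at most 1, so the constant of the theorem can be 1. *)
have uY : y `^ (1 / tau) <= x `^ (1 / tau) * (y / x).
  have {1}-> : y = x * (y / x) by rewrite mulrC divfK ?gt_eqF.
  rewrite powRM ?(ltW aq) ?divr_ge0 ?(ltW ap) ?(ltW aq)//.
  rewrite ler_pM2l// ge1r_powR//; last by rewrite ler_pdivlMr// mul1r ltW.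
  by rewrite divr_gt0//= ler_pdivrMr// mul1r.
rewrite powRB; last by rewrite (gt_eqF aq) implybT.
rewrite powRr1 ?(ltW aq)// ler_pdivlMr//.
have e : x `^ (1 / tau) * (y / x) * x = x `^ (1 / tau) * y by field; rewrite gt_eqF.
have : x `^ (1 / tau) * x - y `^ (1 / tau) * x <= x.
  by rewrite -mulrBl ler_piMl// ltW.
have : y `^ (1 / tau) * x <= x `^ (1 / tau) * (y / x) * x by rewrite ler_pM2r.
rewrite e mulrBl; lra.
Qed.

End Grouping.

(** * The contour integral as a sum over the groups *)

Section SpectralExpansion.
Variables (R : realType) (H : completeNormedModType R[i]).
Variable ip : {dot H for @conjc R}.
Hypothesis hip : hilbert ip.
Variable P : nat -> H -> H.
Hypothesis P_lin : forall q (c : R[i]) x y, P q (c *: x + y) = c *: P q x + P q y.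
Hypothesis P_proj : forall q x y, ip (x - P q x) (P q y) = 0.
Hypothesis P_orth : forall p q x y, p != q -> ip (P p x) (P q y) = 0.
Hypothesis P_total : forall x, (forall q, P q x = 0) -> x = 0.
Variables (r k0 k1 iota alpha psi gap : R) (lam : nat -> R[i]).
Hypotheses (r0 : 0 < r) (k00 : 0 < k0) (k10 : 0 < k1) (iota0 : iota <= 0).
Hypotheses (alpha1 : 1 <= alpha) (psi0 : 0 < psi) (psi_lt : psi < pi / 2).
Hypotheses (alpha_psi : alpha * psi < pi / 2) (k1_psi : 1 < k1 * tan psi).
Hypothesis gap0 : 0 < gap.
Hypothesis lam_gap : forall q,
  gap <= Re (lam q) - graph_height r k0 k1 iota (Im (lam q)).

Let p := graph_path r k0 k1 iota.

Let Re_lam q : gap <= Re (lam q).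
Proof.
by apply: le_trans (lam_gap q) _; rewrite gerBl graph_height_ge0.
Qed.

Let decay t n : 0 < t -> exists2 K : R, 0 <= K & forall q,
  absC (exp_pow alpha t (lam q)) * absC (lam q) ^+ n.+1 <= K.
Proof.
move=> t0; have [K K0 HK] :=
  region_decay k00 k10 iota0 alpha1 psi0 psi_lt alpha_psi k1_psi n t0.
exists K => // q; have h := lam_gap q.
have h1 := graph_height_ge_line r k1 iota k00 (Im (lam q)).
have h2 := graph_height_ge_line1 r k0 k1 iota (Im (lam q)).
apply: HK; first exact: lt_le_trans gap0 (Re_lam q).
  by apply: le_trans h1 _; rewrite -subr_ge0 (le_trans (ltW gap0)).
by apply: le_trans h2 _; rewrite -subr_ge0 (le_trans (ltW gap0)).
Qed.

Lemma contour_expansion t f (F : R[i] -> H) : 0 < t ->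
  (forall q s, P q (F (p s)) = (exp_pow alpha t (p s) / (lam q - p s)) *: P q f) ->
  exists v, diag_sum P (fun q => exp_pow alpha t (lam q)) f @ \oo --> v /\
    is_contour_integral (range p) F ((0 +i* (2 * pi)) *: v).
Proof.
move=> t0 PF; have [K K0 HK] := decay 0 t0.
have bK q : absC (exp_pow alpha t (lam q)) <= K / gap.
  rewrite ler_pdivlMr//; apply: le_trans (HK q); rewrite expr1.
  by rewrite ler_wpM2l ?absC_ge0// (le_trans (Re_lam q))// (le_trans (ler_norm _))// Re_le_absC.
have [v [cv Pv]] := diag_sum_cvg hip P_lin P_proj P_orth f bK.
exists v; split=> //.
have [B B0 HB] := graph_cauchy r0 k00 k10 iota0 alpha1 psi0 psi_lt alpha_psi k1_psi t0 gap0.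
have /choice[W HW] q := HB (lam q) (lt_le_trans gap0 (Re_lam q)) (lam_gap q).
exists p; first exact: graph_contour_param.
apply: (@vector_contour_integral _ _ ip hip P P_lin P_proj P_orth P_total p
  ((1 + k0 ^+ 2) / k0 + k1 + 1) (exp_pow alpha t) lam W B F f) => //.
- exact: graph_path_lipschitz.
- by move=> q s; have [] := HW q.
- by move=> q s m u; have [_ h _] := HW q; exact: h.
- by move=> q; have [_ _] := HW q.
by move=> q; rewrite (projZ P_lin) Pv scalerA.
Qed.

Lemma block_diag_sum c f m n : (m <= n)%N ->
  \sum_(m.+1 <= q < n.+1) c q *: P q f = diag_sum P c f n.+1 - diag_sum P c f m.+1.
Proof.
move=> mn; rewrite /diag_sum -!(big_mkord xpredT (fun q => c q *: P q f)).
by rewrite [X in _ = X - _](big_cat_nat (n := m.+1))//= addrAC subrr add0r.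
Qed.

Lemma blocks_summable t f (N : nat -> nat) (tau : R) : 0 < t -> 0 < tau ->
  (forall nu, (N nu < N nu.+1)%N) ->
  (forall nu q, (N nu < q)%N -> P q f = 0 \/ nu%:R `^ tau <= absC (lam q)) ->
  cvgn (series (fun nu => rnorm
    (\sum_((N nu).+1 <= q < (N nu.+1).+1) exp_pow alpha t (lam q) *: P q f))).
Proof.
(* With this exponent, [absC (lam q) ^+ n.+1] is at least [nu ^+ 2] in the group of index [nu] for
   [nu >= 1], wherever [P q f] is nonzero. *)
move=> t0 tau0 Nlt hN; pose n := Num.truncn (2 / tau).
have n2 : 2 <= tau * n.+1%:R by rewrite mulrC -ler_pdivrMr// ltW// truncnS_gt.
have [K K0 HK] := decay n t0; pose c q := exp_pow alpha t (lam q).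
apply: (@series_cvg_inverse_square _ _ (K * rnorm f)) => [nu|nu]; first exact: rnorm_ge0.
have x1 : 1 <= nu.+1%:R :> R by rewrite ler1n.
have x0 : 0 < nu.+1%:R :> R by rewrite ltr0n.
rewrite -ler_pdivlMr ?exprn_gt0// mulrAC block_diag_sum ?(ltnW (Nlt _))//.
(* The multiplier is also cut to 0 where the lower bound on [absC (lam q)] fails; this changes
   nothing, as [P q f = 0] there, and makes the bound hold for every [q]. *)
set v := _ - _; pose b q : R[i] :=
  if (N nu.+1 < q <= N nu.+2)%N && (nu.+1%:R `^ tau <= absC (lam q)) then c q else 0.
apply: (diag_bound_uniform hip P_lin P_proj P_orth P_total (c := b)) => q.
  rewrite /v (projB P_lin) !(proj_diag_sum hip P_lin P_proj P_orth) !ltnS /b.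
  have [h1|h1] := leqP q (N nu.+1).
    by rewrite (leq_trans h1 (ltnW (Nlt _)))/= scale0r subrr.
  have [h2|h2] /= := leqP q (N nu.+2); last by rewrite scale0r subrr.
  by rewrite subr0; case: ifPn => // h3; case: (hN _ _ h1) => [->|]; rewrite ?scaler0// (negPf h3).
rewrite /b; case: ifPn => [/andP[_ h]|_]; last by rewrite absC0 divr_ge0 ?sqr_ge0.
rewrite ler_pdivlMr ?exprn_gt0//; apply: le_trans (HK q).
rewrite ler_wpM2l ?absC_ge0//; apply: (@le_trans _ _ ((nu.+1%:R `^ tau) ^+ n.+1)).
  rewrite -[leRHS]powR_mulrn ?powR_ge0// -powRrM -[leLHS]powR_mulrn ?(ltW x0)//.
  exact: ler_powR.
by rewrite ler_pXn2r ?nnegrE ?powR_ge0 ?absC_ge0.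
Qed.

(** The partial sums are the subsequence of [diag_sum] at [(N n).+1]. The groups start at index 1,
    so the term of index 0 must vanish. *)
Lemma series_blocks_cvg (c : nat -> R[i]) f (v : H) (N : nat -> nat) : P 0%N f = 0 -> N 0%N = 0%N ->
  (forall nu, (N nu < N nu.+1)%N) -> diag_sum P c f @ \oo --> v ->
  series (fun nu => \sum_((N nu).+1 <= q < (N nu.+1).+1) c q *: P q f : H) @ \oo --> v.
Proof.
move=> P0 N0 Nlt cv.
have -> : series (fun nu => \sum_((N nu).+1 <= q < (N nu.+1).+1) c q *: P q f) =
    fun n => diag_sum P c f (N n).+1.
  apply/funext; elim=> [|n IH].
    by rewrite /series/= big_geq// N0 /diag_sum big_ord1 P0 scaler0.
  rewrite /series/= big_nat_recr//= -[X in X + _]/(series _ n) IH.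
  by rewrite block_diag_sum ?(ltnW (Nlt _))// addrC subrK.
have Nn n : (n <= N n)%N by elim: n => // n IH; exact: leq_ltn_trans IH (Nlt n).
apply: cvg_comp cv; apply/cvgnyPge => B; exists B => // n /= Bn.
exact: leq_trans Bn (leqW (Nn n)).
Qed.

End SpectralExpansion.

Section RootGroups.
Variables (R : realType) (H : completeNormedModType R[i]).
Variable ip : {dot H for @conjc R}.
Hypothesis hip : hilbert ip.
Variables (A A' : {linear H -> H}).
Hypothesis adj : forall x y, ip (A x) y = ip x (A' y).
Hypothesis normalA : forall x, A (A' x) = A' (A x).
Variables (Q : set nat) (mu : nat -> R[i]) (m : nat -> nat)
  (k : nat -> nat -> nat) (e g : nat -> nat -> nat -> H).
Hypothesis jordan : jordan_basis A Q mu m k e.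
Hypothesis biorth : biorthogonal ip Q m k e g.

Lemma Palpha0 (alpha : R) z t : Palpha alpha 0 z t = 1.
Proof.
rewrite /Palpha /= fact0 divr1 mulNr expCN mulfV//.
exact: expC_neq0.
Qed.

Lemma root_group_eigen (alpha : R) (lam : nat -> R[i]) N f t nu :
  (forall q, Q q -> lam q = (mu q)^-1) ->
  root_group ip alpha Q mu m k e g N f t nu =
  \sum_((N nu).+1 <= q < (N nu.+1).+1)
    exp_pow alpha t (lam q) *: eigen_proj ip Q m k e g q f.
Proof.
move=> lamE; rewrite /root_group big_mkcond; apply: eq_bigr => q _.
rewrite /eigen_proj; case: ifPn => [/set_mem Qq|_]; last by rewrite scaler0.
rewrite scaler_sumr; apply: eq_bigr => xi _.
have kE := chain_length hip adj normalA jordan biorth Qq (ltn_ord xi).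
rewrite kE big_ord1 /root_coef_t kE big_ord1 Palpha0 mul1r scalerA.
by rewrite /exp_pow lamE.
Qed.

End RootGroups.

Theorem theorem4 (R : realType)
  (H : completeNormedModType R[i]) (ip : {dot H for @conjc R})
  (Hp : completeNormedModType R[i]) (ipp : {dot Hp for @conjc R})
  (J : {linear Hp -> H}) (L : set (H * H)) (M : set Hp) (C0 C1 C2 : R)
  (A : {linear H -> H})
  (I : set nat) (ev : nat -> R)
  (Q : set nat) (mu : nat -> R[i]) (m : nat -> nat) (k : nat -> nat -> nat)
  (e g : nat -> nat -> nat -> H)
  (alpha tau : R) (varpi : set R[i]^o) :
  (* the setting *)
  hilbert ip -> (exists2 D : set H, countable D & dense D) ->
  hilbert ipp ->
  operator L -> dense (op_dom L) -> ~ selfadjoint ip L ->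
  condition_H1 J L M C0 ->
  condition_H2 ip J L M C1 C2 ->
  m_sectorial ip (Wtilde J L M) ->
  continuous A -> (forall p, Wtilde J L M p <-> p.1 = A p.2) ->
  eigenvalue_sequence (real_part ip (Wtilde J L M)) I ev ->
  characteristic_sequence A Q mu ->
  jordan_basis A Q mu m k e ->
  adjoint_chains ip A Q mu m k g ->
  biorthogonal ip Q m k e g ->
  (* the hypotheses of the theorem *)
  1 < alpha ->
  normal_operator ip (Wtilde J L M) ->
  (let F := within I \oo in
   (fun i => derive1 (fun x : R => ln x `^ (1 + 1 / alpha)) (ev i)) =o_F
   (fun i : nat => i%:R `^ (- (1 / alpha)))) ->
  contour_case_i ip A alpha varpi \/
  contour_case_ii ip J L M C0 C2 A alpha varpi ->
  0 < tau -> tau < 1 / alpha ->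
  exists N : nat -> nat,
    [/\ forall nu, (N nu < N nu.+1)%N,
        forall (f : H) (t : R), 0 < t ->
          (exists2 v : H,
             is_contour_integral varpi
               (fun z => expC (- powC z alpha * t%:C) *:
                         A (fredholm_resolvent A z f)) v &
             series (root_group ip alpha Q mu m k e g N f t) @ \oo
               --> (0 +i* (2 * pi))^-1 *: v) /\
          cvgn (series (fun nu =>
            rnorm (root_group ip alpha Q mu m k e g N f t nu))) &
        exists2 C : R, 0 < C &
          forall nu l : nat, (2 <= l <= N nu.+1 - N nu)%N ->
            Q (N nu + l)%N ->
            absC (mu (N nu + l)%N)^-1 -
            absC (mu (N nu + l - 1)%N)^-1 <=
            C * absC (mu (N nu + l)%N)^-1 `^ (1 - 1 / tau)].
Proof.
move=> hip _ _ _ _ _ H1 H2 _ _ AW _ charQ jordan chains biorth a1 nW _ hcont tau0 taua.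
have tau1 : tau < 1 by apply: lt_trans taua _; rewrite ltr_pdivrMr; lra.
have [A' adj] := adjoint_exists hip H1 H2 AW.
have nA := normal_commute hip AW adj nW.
have bA := A_bounded hip H1 H2 AW.
have compA := A_cluster_compact hip H1 H2 AW.
have injA := A_injective hip AW adj nW.
have [r [k0 [k1 [iota [psi [gap [[r0 k00 k10 i0] [p0 p1 p2 p3] -> gap0 hgap]]]]]]] :
    graph_contour_data alpha varpi Q mu.
  case: hcont; first exact: (contour_case_i_data hip H1 H2 AW charQ a1).
  exact: (contour_case_ii_data hip H1 H2 AW charQ a1).
(* Outside [Q] the projection is 0, and [lam q] is set to a real point at distance [gap] to the
   right of the contour, so that the clearance holds for every index. *)
pose lam q : R[i] :=
  if q \in Q then (mu q)^-1 else (graph_height r k0 k1 iota 0 + gap)%:C.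
have lamE q : Q q -> lam q = (mu q)^-1 by move=> Qq; rewrite /lam mem_set.
have lam_gap q : gap <= Re (lam q) -
    graph_height r k0 k1 iota (Im (lam q)).
  rewrite /lam; case: ifPn => [/set_mem|_]; first exact: hgap.
  by rewrite /= addrAC subrr add0r.
pose P := eigen_proj ip Q m k e g.
have P_lin := eigen_proj_lin ip Q m k e g.
have P_proj := eigen_proj_proj hip adj nA bA jordan chains biorth.
have P_orth := eigen_proj_orthogonal hip adj nA g charQ jordan.
have P_total := eigen_proj_total hip adj nA bA compA injA charQ jordan chains biorth.
have [indexQ _ _ mono] := charQ.
have a_gt0 q : Q q -> 0 < absC (mu q)^-1.
  by move=> Qq; rewrite absC_gt0 invr_eq0 (mu_neq0 charQ).
have [N [N0 Nlt Nge Ngap]] := grouping_exists indexQ a_gt0 mono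
  (eigenvalues_unbounded hip adj nA compA charQ) tau0 tau1.
have P0 f : P 0%N f = 0.
  by apply: eigen_proj_notin => /indexQ[].
exists N; split=> // [f t t0|]; last first.
  by exists 1 => // nu l hl Ql; rewrite mul1r; exact: Ngap.
have groupE : root_group ip alpha Q mu m k e g N f t =
    fun nu => \sum_((N nu).+1 <= q < (N nu.+1).+1) exp_pow alpha t (lam q) *: P q f.
  by apply/funext => nu; exact: (root_group_eigen hip adj nA).
rewrite groupE; split; last first.
  apply: (blocks_summable (tau := tau) hip P_lin P_proj P_orth P_total k00 k10 i0 (ltW a1) p0 p1 p2 p3
    gap0 lam_gap) => // nu q Nq.
  have [Qq|nQ] := pselect (Q q); last by left; exact: eigen_proj_notin.
  by right; rewrite lamE//; exact: Nge.
set F := fun z => _ *: _.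
have [|v [cv hv]] := @contour_expansion _ _ _ hip _ P_lin P_proj P_orth P_total _ _ _ _ _ _ _
  lam r0 k00 k10 i0 (ltW a1) p0 p1 p2 p3 gap0 lam_gap t f F t0.
  move=> q s; set z := graph_path _ _ _ _ _.
  have d0 : 0 < gap / (1 + ((1 + k0 ^+ 2) / k0 + k1)).
    by rewrite divr_gt0// addr_gt0// addr_gt0// divr_gt0// ltr_wpDr ?sqr_ge0.
  rewrite /F /P (projZ P_lin) (eigen_proj_resolvent hip adj nA bA compA injA charQ
    jordan chains biorth f lamE d0) ?scalerA// => q'.
  exact: graph_distance.
exists ((0 +i* (2 * pi)) *: v) => //.
rewrite scalerA mulVf ?scale1r; last by rewrite eq_complex /= negb_and mulf_neq0 ?orbT// gt_eqF// pi_gt0.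
exact: (series_blocks_cvg (P := P)).
Qed.
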